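(* Let $X_1,\dots,X_n$ be independent $d$-dimensional random variables with density $f$, let $\alpha\in(0,1)$ and $x_0\in\mathbb{R}^d$. Assume that $f$ is twice continuously differentiable in a neighbourhood of $x_0$ with $f(x_0)\ne0$, gradient $\nabla f(x_0)=0$ and a Hessian $H_f(x_0)$ satisfying $e_0^\top H_f(x_0)e_0\le -c<0$ for all $e_0\in\mathbb{R}^d$ with $\|e_0\|=1$. Consider the family of wedges $\mathcal K_n=\{K^1,\dots,K^{M_n}\}$ with vertex $x_0$ described in the context, with constants $C_1,C_2$ satisfying $$C_1^{d+4}C_2^{d-1}>\frac{4D^2}{c^2}\,\frac{f(x_0)}{d+4},$$ where $$D=\frac{\sqrt2(2d+2)(d+2)}{\left(1-\frac{d}{d+2}\right)^{(d+2)/d}\Big[1-\frac{d^2}{2(2d+2)^2}\Big(-1+\big\{1+4(\tfrac{2d+2}{d})^2\big\}^{1/2}\Big)\Big]^{1/2}}.$$ Then all $M_n$ tests, which reject the hypothesis that $f$ is increasing on $K^i$ whenever $T_{K^i}<-\tilde c'_{K^i}(\alpha)$ ($i=1,\dots,M_n$), reject their null hypothesis with asymptotic probability one, i.e. $$\mathbb P\big(T_{K^i}<-\tilde c'_{K^i}(\alpha)\ \text{for all } i=1,\dots,M_n\big)\to1\qquad(n\to\infty).$$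
   Context: Wedges. For $x_0,e\in\mathbb{R}^d$ with $\|e\|=1$ (Euclidean norm), fix an orthonormal basis $\{e_1,\dots,e_{d-1}\}$ of $(\mathrm{span}\{e\})^\perp$ and put $P_ex:=\langle x-x_0,e\rangle$. The wedge with vertex $x_0$, direction $e$, length $l>0$ and angle $\varphi\in(0,\pi/2)$ is $K(x_0,e,\varphi):=\{x: 0<P_ex\le l,\ \langle x-x_0,e_i\rangle\in[-\tan(\varphi)P_ex,\tan(\varphi)P_ex],\ i=1,\dots,d-1\}$. $f$ is increasing on a wedge $K$ with vertex $x_0$ if $f(x_0+\tilde t_2e_0)\ge f(x_0+\tilde t_1e_0)$ for all unit vectors $e_0$ and all $\tilde t_2>\tilde t_1\ge0$ with $x_0+\tilde t_2e_0\in K$. Family $\mathcal K_n$. Let $l_n=(\log(n)/n)^{1/(d+4)}$, let $C_1,C_2,\varepsilon>0$ be constants and $\varphi_n=\frac{C_2}{2}\log(n)^{-1}$. $\mathcal K_n$ consists of $M_n$ pairwise disjoint wedges $K^1,\dots,K^{M_n}$ with common vertex $x_0$, length $C_1\log(n)^{\frac{d-1}{d+4}}l_n$, angle $\varphi_n$ and unit directions $e_n^1,\dots,e_n^{M_n}$ chosen successively: $e_n^1$ is arbitrary; once $e_n^1,\dots,e_n^{i-1}$ are specified, whenever possible a unit vector $e_n^i$ is chosen such that $|\mathrm{angle}(e_n^i,e_n^j)|\ge(2+\varepsilon)\arctan(\sqrt{d-1}\tan(\varphi_n))$ for all $j<i$. Statistics. Let $\beta(z)=(2z-1)\mathbf 1_{(0,1)}(z)$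 and $\Gamma(\delta)=\sqrt{2\log(\exp(1)/\delta)}$. For a wedge $K$ with direction $e$: $N$ is the number of observations in $K$; $X_{(1)},\dots,X_{(N)}$ are these observations ordered by increasing $P_e$; $K_N=\{x\in K:0<P_ex\le P_eX_{(N)}\}$; $\tilde F(z)=\mathbb P(P_eX\le z\mid N,X\in K_N,X_{(N)})$ for $X$ with density $f$ independent of the sample; $T_K=\sum_{j=1}^{N-1}\beta\big((P_eX_{(j)})^d/(P_eX_{(N)})^d\big)$ and $T_K^U=\sum_{j=1}^{N-1}\beta(\tilde F(P_eX_{(j)}))$. For the wedge $K^i$ write $N^i$, $T_{K^i}$, $T_{K^i}^U$. Critical values. $\tilde\kappa'_n(\alpha)$ is defined by $$\mathbb P\Big(\max_{i=1,\dots,M_n}\Big(-\sqrt{\tfrac{3}{N^i-1}}\,T^U_{K^i}-\Gamma\big(\tfrac{N^i}{n-1}\big)\Big)\le\tilde\kappa'_n(\alpha)\,\Big|\,N^1,\dots,N^{M_n}\Big)=1-\alpha,$$ and $\tilde c'_{K^i}(\alpha)=\sqrt{\frac{N^i-1}{3}}\big(\tilde\kappa'_n(\alpha)+\Gamma(\frac{N^i}{n-1})\big)$. Wedges with $N^i\le1$ contribute no term to the maximum and lead to no rejection. *)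

(* Defs.v *)
From HB Require Import structures.
From mathcomp Require Import all_boot all_order all_algebra.
From mathcomp Require Import all_classical all_reals all_analysis.

Set Implicit Arguments.
Unset Strict Implicit.
Unset Printing Implicit Defensive.

Import Order.TTheory GRing.Theory Num.Theory.
Import numFieldNormedType.Exports.

Local Open Scope classical_set_scope.
Local Open Scope ring_scope.

Definition matrix_display : measure_display -> measure_display.
Proof. exact. Qed.

Section matrix_measurable.
Context {d} {T : measurableType d} (m n : nat).

Definition entry_preimages : set (set 'M[T]_(m, n)) :=
  [set A | exists i j, preimage_set_system setT
             (fun M : 'M[T]_(m, n) => M i j) measurable A].

HB.instance Definition _ := @isMeasurable.Build (matrix_display d)
  'M[T]_(m, n) <<s entry_preimages >>
  (@sigma_algebra0 _ setT entry_preimages)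
  (@sigma_algebraC _ entry_preimages)
  (@sigma_algebra_bigcup _ setT entry_preimages).

End matrix_measurable.

Section lebesgue_row.
Variable R : realType.

Definition row_cons n (x : measurableTypeR R * 'rV[R]_n) : 'rV[R]_n.+1 :=
  \row_i (if unlift ord0 i is Some j then x.2 ord0 j else x.1).

Definition row_uncons n (v : 'rV[R]_n.+1) : measurableTypeR R * 'rV[R]_n :=
  (v ord0 ord0, \row_j v ord0 (lift ord0 j)).

Lemma row_consK n : cancel (@row_cons n) (@row_uncons n).
Proof.
case=> x v; rewrite /row_uncons mxE unlift_none; congr pair.
by apply/rowP => j; rewrite !mxE liftK.
Qed.

Lemma measurable_fun_matrixP d (T : measurableType d) m n
    (f : T -> 'M[measurableTypeR R]_(m, n)) :
  measurable_fun setT f <->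
  (forall i j, measurable_fun setT (fun x => f x i j)).
Proof.
split=> [mf i j|mf].
- move=> _ A mA.
  rewrite (_ : _ @^-1` A =
    f @^-1` ((fun M : 'M[measurableTypeR R]_(m, n) => M i j) @^-1` A))//.
  apply: mf => //.
  by apply: sub_sigma_algebra; exists i, j; exists A => //; rewrite setTI.
- apply: (measurability (@entry_preimages _ _ m n)) => //.
  move=> _ [_ [i [j [A mA <-]]] <-].
  by rewrite setTI -comp_preimage; apply: mf.
Qed.

Lemma measurable_row_cons n : measurable_fun setT (@row_cons n).
Proof.
apply/measurable_fun_matrixP => i j; rewrite /row_cons.
case: (unliftP ord0 j) => [k ->|->].
- under eq_fun do rewrite mxE liftK.
  apply: (measurableT_comp (f := fun v : 'rV[measurableTypeR R]_n => v ord0 k)).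
    by apply: (iffLR (measurable_fun_matrixP id)); exact: measurable_id.
  exact: measurable_snd.
- under eq_fun do rewrite mxE unlift_none.
  exact: measurable_fst.
Qed.

Lemma measurable_row_uncons n : measurable_fun setT (@row_uncons n).
Proof.
apply/measurable_fun_pairP; split => /=.
  by apply: (iffLR (measurable_fun_matrixP id)); exact: measurable_id.
apply/measurable_fun_matrixP => i j.
under eq_fun do rewrite mxE.
by apply: (iffLR (measurable_fun_matrixP id)); exact: measurable_id.
Qed.

Section row_product.
Variables (n : nat) (l : {sigma_finite_measure set (measurableTypeR R) -> \bar R})
  (m : {sigma_finite_measure set 'rV[R]_n -> \bar R}).

Definition row_product : set 'rV[R]_n.+1 -> \bar R :=
  pushforward (l \x m)%E (@row_cons n).

HB.instance Definition _ := Measure.copy row_product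
  (measure_function_pushforward__canonical__measure_function_Measure
     (product_measure1 l m) (@measurable_row_cons n)).

Lemma row_product_sigma_finite : sigma_finite setT row_product.
Proof.
have /sigma_finiteP[F [TF ndF Foo]] := sigma_finiteT l.
have /sigma_finiteP[G [TG ndG Goo]] := sigma_finiteT m.
exists (fun k => @row_uncons n @^-1` (F k `*` G k)).
  rewrite -preimage_bigcup (_ : \bigcup_i _ = setT) ?preimage_setT//.
  rewrite -subTset => -[x y] _.
  have [i _ Fix] : (\bigcup_i F i) x by rewrite -TF.
  have [j _ Gjy] : (\bigcup_i G i) y by rewrite -TG.
  exists (maxn i j) => //; split.
  - by move: x Fix; exact/subsetPset/ndF/leq_maxl.
  - by move: y Gjy; exact/subsetPset/ndG/leq_maxr.
move=> k; have [mF Fk] := Foo k; have [mG Gk] := Goo k; split.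
  rewrite -[X in measurable X]setTI; apply: measurable_row_uncons => //.
  exact: measurableX.
rewrite /row_product /pushforward -comp_preimage.
rewrite (_ : _ @^-1` (_ `*` _) = F k `*` G k); last first.
  rewrite (_ : _ \o _ = id)//; apply/funext => x; exact: row_consK.
by rewrite product_measure1E// lte_mul_pinfty// ge0_fin_numE.
Qed.

HB.instance Definition _ := Measure_isSigmaFinite.Build _ _ _
  row_product row_product_sigma_finite.

End row_product.

Fixpoint lebesgue_row n : {sigma_finite_measure set 'rV[R]_n -> \bar R} :=
  if n is k.+1 then row_product (@lebesgue_measure R) (lebesgue_row k) else \d_(0 : 'rV[R]_0).

Lemma lebesgue_row_box n (a b : 'rV[R]_n) :
  (forall i, a ord0 i <= b ord0 i) ->
  lebesgue_row n [set v | forall i, a ord0 i < v ord0 i <= b ord0 i] =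
  (\prod_(i < n) (b ord0 i - a ord0 i)%:E)%E.
Proof.
elim: n a b => [|n IHn] a b ab.
  by rewrite big_ord0 /= diracE mem_set// => -[].
pose a' := (row_uncons a).2; pose b' := (row_uncons b).2.
pose B' := [set v : 'rV[R]_n | forall i, a' ord0 i < v ord0 i <= b' ord0 i].
have mB' : measurable B'.
  rewrite (_ : B' = \bigcap_(i in [set: 'I_n])
      ((fun v : 'rV[R]_n => v ord0 i) @^-1` `]a' ord0 i, b' ord0 i]%classic)).
    apply: fin_bigcap_measurable => // i _; rewrite -[X in measurable X]setTI.
    apply: (iffLR (measurable_fun_matrixP id)) => //.
  apply/seteqP; split=> v /= h i; first by move=> _; rewrite /= in_itv/= h.
  by have := h i I; rewrite /= in_itv.
rewrite [LHS]/= /row_product /pushforward.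
rewrite (_ : _ @^-1` _ =
  (`]a ord0 ord0, b ord0 ord0]%classic : set (measurableTypeR R)) `*` B').
  rewrite product_measure1E//= lebesgue_measure_itv/= lte_fin.
  rewrite big_ord_recl IHn; last by move=> i; rewrite !mxE.
  congr (_ * _)%E; last by apply: eq_bigr => i _; rewrite !mxE.
  case: ltP => // ba; suff -> : b ord0 ord0 = a ord0 ord0 by rewrite subrr.
  by apply/eqP; rewrite eq_le ba ab.
apply/seteqP; split=> -[x v] /=.
- move=> h; split; first by have := h ord0; rewrite mxE unlift_none in_itv.
  by move=> i; have := h (lift ord0 i); rewrite !mxE liftK.
- move=> [xab vB] i; rewrite mxE.
  case: (unliftP ord0 i) => [k ->|->]; last by rewrite ?unlift_none; move: xab; rewrite in_itv.
  by rewrite ?liftK; have := vB k; rewrite !mxE.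
Qed.

End lebesgue_row.

Section density.
Variables (R : realType) (d : nat).

Definition density_law (f : 'rV[R]_d -> R) : set 'rV[R]_d -> \bar R :=
  fun A => (\int[lebesgue_row R d]_(x in A) (f x)%:E)%E.

Definition has_density dO (Omega : measurableType dO) (P : probability Omega R)
    (Y : {RV P >-> 'rV[R]_d}) (f : 'rV[R]_d -> R) : Prop :=
  [/\ measurable_fun setT f, (forall x, 0 <= f x) &
      forall A, measurable A -> P (Y @^-1` A) = density_law f A].

(* Taking some of the [A i] to be [setT] gives every finite subfamily. *)
Definition mutually_independent dO (Omega : measurableType dO)
    (P : probability Omega R) (X : nat -> {RV P >-> 'rV[R]_d}) : Prop :=
  forall n (A : 'I_n -> set 'rV[R]_d), (forall i, measurable (A i)) ->
    P [set omega | forall i : 'I_n, A i (X i omega)] =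
    (\prod_(i < n) P (X i @^-1` A i))%E.

End density.

Definition cond_prob (R : realType) (T : Type) (mu : set T -> \bar R)
    (A B : set T) : R :=
  fine (mu (A `&` B)) / fine (mu B).

Section differential.
Variables (R : realType) (d : nat).
Implicit Types (f : 'rV[R]_d -> R) (x : 'rV[R]_d).

Definition basis_vector (i : 'I_d) : 'rV[R]_d := delta_mx ord0 i.

Definition partial f (i : 'I_d) : 'rV[R]_d -> R :=
  fun x => 'D_(basis_vector i) f x.

Definition gradient f x : 'rV[R]_d := \row_i partial f i x.

Definition hessian f x : 'M[R]_d :=
  \matrix_(i, j) partial (partial f j) i x.

Definition twice_continuously_differentiable_near f x0 : Prop :=
  \forall x \near x0,
    {for x, continuous f} /\
    (forall i, derivable f x (basis_vector i) /\
       {for x, continuous (partial f i)}) /\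
    (forall i j, derivable (partial f i) x (basis_vector j) /\
       {for x, continuous (partial (partial f i) j)}).

End differential.

Section wedges.
Variables (R : realType) (d : nat).
Implicit Types (u v x : 'rV[R]_d).

Definition dotr u v : R := (u *m v^T) ord0 ord0.

(* The norm [`|u|] of the library is the maximum norm. *)
Definition enorm u : R := Num.sqrt (dotr u u).

Definition angle u v : R := acos (dotr u v / (enorm u * enorm v)).

(* The rows of [wedge_basis] are the vectors $e_1, \dots, e_{d-1}$. *)
Record wedge := Wedge {
  vertex : 'rV[R]_d;
  direction : 'rV[R]_d;
  wedge_basis : 'M[R]_(d.-1, d);
  wedge_length : R;
  wedge_angle : R
}.
Implicit Types W : wedge.

Definition wf_wedge W : Prop :=
  [/\ enorm (direction W) = 1,
      wedge_basis W *m (wedge_basis W)^T = 1%:M,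
      wedge_basis W *m (direction W)^T = 0,
      0 < wedge_length W &
      0 < wedge_angle W < pi / 2].

Definition wproj W x : R := dotr (x - vertex W) (direction W).

Definition wedge_set W : set 'rV[R]_d :=
  [set x | 0 < wproj W x <= wedge_length W /\
     forall i, - (tan (wedge_angle W) * wproj W x)
               <= dotr (x - vertex W) (row i (wedge_basis W))
               <= tan (wedge_angle W) * wproj W x].

(* $\{x \in K : 0 < P_e x \le r\}$, which is $K_N$ when $r = P_e X_{(N)}$. *)
Definition wedge_trunc W (r : R) : set 'rV[R]_d :=
  wedge_set W `&` [set x | 0 < wproj W x <= r].

End wedges.

Section family.
Variables (R : realType) (d : nat).
Variables (C1 C2 eps : R) (x0 : 'rV[R]_d).

Definition lseq (n : nat) : R := (ln n%:R / n%:R) `^ (d%:R + 4)^-1.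

Definition family_length (n : nat) : R :=
  C1 * ln n%:R `^ ((d%:R - 1) / (d%:R + 4)) * lseq n.

Definition family_angle (n : nat) : R := C2 / 2 * (ln n%:R)^-1.

Definition family_wedge (n : nat) (W : wedge R d) : Prop :=
  [/\ wf_wedge W, vertex W = x0, wedge_length W = family_length n &
      wedge_angle W = family_angle n].

(* For [1 < d] the bound on the angle implies disjointness; for [d = 1] it is
   void and disjointness alone limits the choice of directions. *)
Definition separated_wedges (n : nat) (W W' : wedge R d) : Prop :=
  (2 + eps) * atan (Num.sqrt (d%:R - 1) * tan (family_angle n))
    <= `|angle (direction W) (direction W')| /\
  wedge_set W `&` wedge_set W' = set0.

(* The last clause says that the successive choice went on for as long as a
   further wedge was possible. *)
Definition wedge_family (n M : nat) (K : 'I_M -> wedge R d) : Prop :=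
  [/\ (0 < M)%N,
      forall i, family_wedge n (K i),
      forall i j : 'I_M, (j < i)%N -> separated_wedges n (K i) (K j) &
      ~ exists W, family_wedge n W /\ forall j, separated_wedges n W (K j)].

End family.

Section tests.
Variables (R : realType) (d : nat).
Implicit Types (W : wedge R d) (s : seq 'rV[R]_d).

Definition beta (z : R) : R := (2 * z - 1) * (z \in `]0, 1[)%:R.

Definition Gamma (delta : R) : R := Num.sqrt (2 * ln (expR 1 / delta)).

Definition ordered_obs W s : seq 'rV[R]_d :=
  sort (fun x y => wproj W x <= wproj W y) [seq x <- s | `[< wedge_set W x >]].

Definition nobs W s : nat := size (ordered_obs W s).

(* $P_e X_{(j+1)}$: indices start at 0. *)
Definition obs_proj W s (j : nat) : R := wproj W (nth 0 (ordered_obs W s) j).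

Definition last_proj W s : R := obs_proj W s (nobs W s).-1.

Definition T_stat W s : R :=
  \sum_(j < (nobs W s).-1) beta (obs_proj W s j ^+ d / last_proj W s ^+ d).

(* $\tilde F$ given $P_e X_{(N)} = r$, where [mu] is the law of $X$: as $X$ is
   independent of the sample, conditioning on $N$ and $X_{(N)}$ only fixes the
   set $K_N$. *)
Definition Ftilde (mu : set 'rV[R]_d -> \bar R) W (r z : R) : R :=
  cond_prob mu [set x | wproj W x <= z] (wedge_trunc W r).

Definition TU_stat (mu : set 'rV[R]_d -> \bar R) W s : R :=
  \sum_(j < (nobs W s).-1) beta (Ftilde mu W (last_proj W s) (obs_proj W s j)).

(* The maximum is [-oo] if every wedge has at most one observation. *)
Definition max_stat (mu : set 'rV[R]_d -> \bar R) (n M : nat)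
    (K : 'I_M -> wedge R d) s : \bar R :=
  \big[maxe/-oo%E]_(i < M | (1 < nobs (K i) s)%N)
    (- (Num.sqrt (3 / ((nobs (K i) s)%:R - 1)) * TU_stat mu (K i) s)
     - Gamma ((nobs (K i) s)%:R / (n%:R - 1)))%:E.

(* The counts are discrete, so conditioning on them is elementary conditioning
   on each value [nu] of positive probability; [kappa] is a function of [nu].
   If no entry of [nu] exceeds 1 there is no term in the maximum, nothing is
   rejected, and [kappa nu] is irrelevant. *)
Definition critical_value dO (Omega : measurableType dO)
    (P : probability Omega R) (sample : Omega -> seq 'rV[R]_d)
    (mu : set 'rV[R]_d -> \bar R) (alpha : R) (n M : nat)
    (K : 'I_M -> wedge R d) (kappa : ('I_M -> nat) -> R) : Prop :=
  forall nu : 'I_M -> nat, (exists i, (1 < nu i)%N) ->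
    let counts_eq := [set omega | forall i, nobs (K i) (sample omega) = nu i] in
    (0 < P counts_eq)%E ->
    cond_prob P
      [set omega | (max_stat mu n K (sample omega) <= (kappa nu)%:E)%E]
      counts_eq = 1 - alpha.

Definition crit (n N : nat) (kappa : R) : R :=
  Num.sqrt ((N%:R - 1) / 3) * (kappa + Gamma (N%:R / (n%:R - 1))).

Definition rejects (n : nat) W (kappa : R) s : Prop :=
  (1 < nobs W s)%N /\ T_stat W s < - crit n (nobs W s) kappa.

Definition Dconst : R :=
  Num.sqrt 2 * (2 * d%:R + 2) * (d%:R + 2) /
  ((1 - d%:R / (d%:R + 2)) `^ ((d%:R + 2) / d%:R) *
   Num.sqrt (1 - d%:R ^+ 2 / (2 * (2 * d%:R + 2) ^+ 2) *
                 (- 1 + Num.sqrt (1 + 4 * ((2 * d%:R + 2) / d%:R) ^+ 2)))).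

End tests.

(* Main.v *)
(** Let [l = ln n], let [L] be the length and [V] the volume of the wedges of
    the [n]-th family, and let [m = n f(x0) V] be the order of magnitude of the
    number of observations in one of them. By Taylor's formula at the critical
    point [x0], [f] is [f(x0) - q t^2 / 2] up to a small multiple of [t^2] at
    height [t] in a wedge, where [q >= c]. Hence the mean of
    [2 (P_e X / L)^d - 1] over the wedge is at most
    [- c d V L^2 / (4 (d + 1) (d + 2))], and the condition on [C1] and [C2] makes
    the resulting mean of [T_K] smaller than
    [- sqrt (4.5 d / (d + 4)) sqrt (m l)], whereas the term of the critical value
    coming from [Gamma] is at most about [sqrt (4 d / (3 (d + 4))) sqrt (m l)].
    Exponential inequalities control, in every wedge, the number of observations,
    the sums of the scores and the distance from [P_e X_(N)] to [L], outside an
    event of probability [exp (- a l)]; comparing volumes, [M_n] is at most a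
    power of [l], so that a union bound is enough.

    No limit theory under the conditional laws is needed for [kappa]. On the good
    event the maximum of the statistics built on [T^U] is at most [sqrt l / 4]. If
    [kappa nu > sqrt l / 4], then the good event has conditional probability at
    most [1 - alpha] given the counts [nu], because [kappa nu] is an exact
    quantile. The counts with this property therefore have total probability at
    most [alpha^-1] times that of the complement of the good event. *)

Require Import Defs.
From HB Require Import structures.
From mathcomp Require Import all_boot all_order all_algebra.
From mathcomp Require Import all_classical all_reals all_analysis.
From mathcomp Require Import measurable_realfun ring lra.

Set Implicit Arguments.
Unset Strict Implicit.
Unset Printing Implicit Defensive.

Import Order.TTheory GRing.Theory Num.Theory.
Import numFieldNormedType.Exports.

Local Open Scope classical_set_scope.
Local Open Scope ring_scope.

Import HBNNSimple.

(** * Expectations and an exponential inequality *)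

(** The scales fit together as follows. In dimension [D], [L^(D+4)] is of order [l^D / n], so that
    [m L^4] is of order [l]: the signal [m L^2] and the fluctuations [sqrt (m l)] have the same
    order and only constants decide. The factor [4.5 = 4 * 18 / 16] comes from
    [Dconst^2 >= 18 (D+1)^2 (D+2)^2]. The factor [4/3] comes from [Gamma^2], about [2 ln (n/m)] with
    [ln (n/m)] about [D l / (D+4)], and from the crude bound [2 m] on the counts. The gap between
    the two pays for every constant factor that is lost.

    The obstacle is that the statistics are not sums of independent terms: every score involves the
    random height of the last observation. The remedy is a slab at the top of the wedge, of relative
    width of order [sqrt (l/m)]. This is wide enough to contain an observation outside an event of
    probability [exp (- a l)], and thin enough to hold only a small multiple of [sqrt (m l)]
    observations. Replacing the random height by [L], or by the mass of the whole wedge, then costs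
    a small part of the signal, and what remains is a sum of independent bounded scores. *)

Section transport.
Local Open Scope ereal_scope.
Context d1 d2 (T : measurableType d1) (U : measurableType d2) (R : realType).
Variables (m : {measure set T -> \bar R}) (nu : {measure set U -> \bar R}).
Variables (phi : T -> U) (w : T -> R).
Hypotheses (mphi : measurable_fun setT phi) (mw : measurable_fun setT w).
Hypothesis w0 : forall x, (0 <= w x)%R.
Hypothesis nuE : forall A, measurable A -> nu A = \int[m]_(x in phi @^-1` A) (w x)%:E.

(** Both sides are additive and continuous along increasing sequences in [h], so simple functions
    suffice. It is used with [phi] an observation and [w] the product of the other factors, for
    independence, and with [phi] the identity and [w] the density. *)
Lemma ge0_integral_transport (h : U -> R) : measurable_fun setT h ->
  (forall y, (0 <= h y)%R) ->
  \int[nu]_y (h y)%:E = \int[m]_x (h (phi x) * w x)%:E.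
Proof.
move=> mh h0.
have mphiA A : measurable A -> measurable (phi @^-1` A).
  by move=> mA; rewrite -(setTI (_ @^-1` _)); exact: mphi.
have mhE : measurable_fun [set: U] (EFin \o h) by exact/measurable_EFinP.
pose f_ := nnsfun_approx measurableT mhE.
have f_cvg y : (f_ n y)%:E @[n --> \oo] --> (h y)%:E.
  by apply: (@cvg_nnsfun_approx _ _ _ _ measurableT _ mhE) => // x _; rewrite lee_fin.
have ndf y : {homo (fun n => f_ n y) : a b / (a <= b)%N >-> (a <= b)%R}.
  by move=> a b ab; exact/lefP/(nd_nnsfun_approx measurableT mhE).
transitivity (limn (fun n => \int[nu]_y (f_ n y)%:E)).
  rewrite -monotone_convergence//.
  - by apply: eq_integral => y _; apply/esym/cvg_lim => //; exact: f_cvg.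
  - by move=> n; exact/measurable_EFinP/measurable_funP.
  - by move=> n y _; rewrite lee_fin.
  - by move=> y _ a b ab; rewrite lee_fin; exact: ndf.
transitivity (limn (fun n => \int[m]_x (f_ n (phi x) * w x)%:E)); last first.
  rewrite -monotone_convergence//.
  - apply: eq_integral => x _; apply/cvg_lim => //.
    under eq_fun do rewrite EFinM.
    rewrite EFinM; apply: cvgeM => //; last exact: cvg_cst.
  - move=> n; apply/measurable_EFinP/measurable_funM => //.
    exact: measurableT_comp.
  - by move=> n x _; rewrite lee_fin mulr_ge0.
  - by move=> x _ a b ab; rewrite lee_fin ler_wpM2r// ndf.
congr (limn _); apply/funext => n.
under eq_integral do rewrite fimfunE -fsumEFin//.
rewrite ge0_integral_fsum//; last 2 first.
  - by move=> r; exact/measurable_EFinP/measurable_funM.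
  - by move=> r y _; rewrite nnfun_muleindic_ge0.
under [RHS]eq_integral => x _.
  rewrite EFinM [X in X%:E * _]fimfunE -fsumEFin// ge0_mule_fsuml; last first.
    by move=> r; rewrite nnfun_muleindic_ge0.
  over.
rewrite [RHS]ge0_integral_fsum//; last 2 first.
  - move=> r; rewrite (_ : (fun _ => _) = EFin \o (fun x =>
        (r * \1_(f_ n @^-1` [set r]) (phi x)) * w x)%R); last exact/funext.
    apply/measurable_EFinP; apply: measurable_funM => //.
    by apply: measurable_funM => //; exact: (measurableT_comp _ mphi).
  - move=> r y _; apply: mule_ge0; last by rewrite lee_fin.
    by rewrite nnfun_muleindic_ge0.
apply: eq_fsbigr => r _.
(* A constant leaves the integral of a nonnegative function only if it is nonnegative itself; a
   negative [r] is not a value of [f_ n], and both sides vanish. *)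
have [r0|r0] := ltP r 0%R.
  rewrite preimage_nnfun0// indic0.
  under eq_integral do rewrite /= mulr0.
  under [RHS]eq_integral do rewrite /= mulr0 mul0e.
  by rewrite !integral0.
have mA : measurable (f_ n @^-1` [set r]) by [].
under eq_integral do rewrite EFinM.
under [RHS]eq_integral do rewrite EFinM -muleA.
have mw' : measurable_fun setT
    (fun x : T => ((\1_(f_ n @^-1` [set r]) (phi x))%:E * (w x)%:E : \bar R)).
  under eq_fun do rewrite -EFinM.
  apply/measurable_EFinP; apply: measurable_funM => //.
  exact: (measurableT_comp _ mphi).
rewrite !ge0_integralZl_EFin//; first last.
- exact/measurable_EFinP.
- by move=> x _; rewrite -EFinM lee_fin mulr_ge0.
congr (_ * _); rewrite integral_indic// setIT nuE// integral_mkcond.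
by apply: eq_integral => x _; rewrite epatch_indic /= muleC.
Qed.
End transport.

Ltac mfun := repeat first
  [ assumption | exact: measurable_cst | apply: measurable_funB
  | apply: measurable_funD | apply: measurable_funM ].

Lemma measurable_set_ge (R : realType) d (T : measurableType d) (S : T -> R) t :
  measurable_fun setT S -> measurable [set x | t <= S x].
Proof.
move=> mS; rewrite (_ : [set _ | _] = S @^-1` `[t, +oo[%classic); last first.
  by apply/seteqP; split => x /=; rewrite in_itv/= andbT.
by rewrite -[X in measurable X]setTI; exact: mS.
Qed.

Section independence.
Local Open Scope ereal_scope.
Context (R : realType) (d : nat) dO (Omega : measurableType dO)
  (P : probability Omega R) (X : nat -> {RV P >-> 'rV[R]_d}).
Hypothesis Xind : mutually_independent X.

Lemma measurable_RV_comp (h : 'rV[R]_d -> R) i : measurable_fun setT h ->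
  measurable_fun setT (fun omega => h (X i omega)).
Proof. by move=> mh; apply: (measurableT_comp mh). Qed.

(* Induction on the number [k] of factors that are not indicators: by the
   induction hypothesis, the measure with density [w], the product of the other
   factors, is transported by [X j] to a multiple of the law of [X j]. *)
Lemma expectation_prod_partial n (k : nat) (g : 'I_n -> 'rV[R]_d -> R) :
  (forall i, measurable_fun setT (g i)) ->
  (forall i x, (0 <= g i x)%R) ->
  (forall i, \int[P]_omega (g i (X i omega))%:E < +oo) ->
  (forall i : 'I_n, (k <= i)%N -> exists2 A, measurable A & g i = \1_A) ->
  \int[P]_omega (\prod_(i < n) g i (X i omega))%:E =
  \prod_(i < n) \int[P]_omega (g i (X i omega))%:E.
Proof.
elim: k g => [|k IHk] g mg g0 goo gA.
  have /choice[A AP] : forall i, exists A, measurable A /\ g i = \1_A.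
    by move=> i; have [//|A mA gE] := gA i; exists A.
  have mA i : measurable (A i) by have [] := AP i.
  have mXA (i : 'I_n) : measurable (X i @^-1` A i).
    by rewrite -[X in measurable X]setTI; exact: measurable_funPT.
  have -> : \int[P]_omega (\prod_(i < n) g i (X i omega))%:E =
      P [set omega | forall i : 'I_n, A i (X i omega)].
    have mI : measurable [set omega | forall i : 'I_n, A i (X i omega)].
      rewrite (_ : [set _ | _] = \bigcap_(i in [set: 'I_n]) (X i @^-1` A i)).
        by apply: fin_bigcap_measurable => // i _.
      by apply/seteqP; split => omega /= h i; [move=> _|]; exact: h.
    transitivity (\int[P]_omega
        (\1_[set omega | forall i : 'I_n, A i (X i omega)] omega)%:E); last first.
      by rewrite integral_indic// setIT.
    apply: eq_integral => omega _; congr EFin.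
    have [h|] := boolP (`[< forall i : 'I_n, A i (X i omega) >]).
      move/asboolP : h => h.
      rewrite indicE mem_set// big1// => i _; have [_ ->] := AP i.
      by rewrite indicE mem_set.
    move/asboolPn => h; rewrite indicE memNset//.
    have /existsNP[i iA] := h.
    rewrite (bigD1 i)//=; have [_ ->] := AP i.
    by rewrite indicE memNset ?mul0r.
  rewrite Xind//; apply: eq_bigr => i _; have [_ ->] := AP i.
  by rewrite (_ : (fun _ => _) = (fun omega => (\1_(X i @^-1` A i) omega)%:E))//
    integral_indic// setIT.
have [kn|nk] := ltnP k n; last first.
  by apply: IHk => // i ki; exfalso; have := ltn_ord i; rewrite ltnNge (leq_trans nk).
pose j := Ordinal kn.
pose w omega : R := (\prod_(i < n | i != j) g i (X i omega))%R.
have mw : measurable_fun setT w.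
  rewrite /w; under eq_fun do rewrite big_mkcond/=.
  apply: (measurable_prod (h := fun (i : 'I_n) x =>
    if i != j then g i (X i x) else 1%R)) => i _.
  case: (i != j); first exact: measurable_RV_comp.
  exact: measurable_cst.
have w0 omega : (0 <= w omega)%R by apply: prodr_ge0.
pose c := (\prod_(i < n | i != j) \int[P]_omega (g i (X i omega))%:E).
have E0 i : 0 <= \int[P]_omega (g i (X i omega))%:E.
  by apply: integral_ge0 => omega _; rewrite lee_fin.
have Efin i : \int[P]_omega (g i (X i omega))%:E \is a fin_num.
  by rewrite ge0_fin_numE.
have c0 : 0 <= c by rewrite /c; apply: prode_ge0.
have cfin : c \is a fin_num by rewrite /c; apply: prode_fin_num.
have c0' : (0 <= fine c)%R by exact: fine_ge0.
pose nu := mscale (NngNum c0') (distribution P (X j)).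
have nuE A : measurable A -> nu A = \int[P]_(omega in X j @^-1` A) (w omega)%:E.
  move=> mA.
  (* With the factor [j] replaced by an indicator, all factors from index [k] on are indicators, and
     the induction hypothesis applies. *)
  pose g' i := if i == j then \1_A : _ -> R else g i.
  have mg' : forall i, measurable_fun setT (g' i).
    by move=> i; rewrite /g'; case: ifP.
  have mXA : measurable (X j @^-1` A).
    by rewrite -[X in measurable X]setTI; exact: measurable_funPT.
  have Ej : \int[P]_omega ((\1_A : _ -> R) (X j omega))%:E = P (X j @^-1` A).
    by rewrite (_ : (fun _ => _) = (fun omega => (\1_(X j @^-1` A) omega)%:E))//
      integral_indic// setIT.
  have g'j : \int[P]_omega (g' j (X j omega))%:E = P (X j @^-1` A).
    by rewrite /g' eqxx.
  have g'i i : i != j -> g' i = g i by rewrite /g' => /negbTE ->.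
  have H : \int[P]_omega (\prod_(i < n) g' i (X i omega))%:E =
      P (X j @^-1` A) * c.
    rewrite IHk//; last 3 first.
    - by move=> i x; rewrite /g'; case: ifP.
    - move=> i; have [->|ij] := eqVneq i j; last by rewrite g'i.
      by rewrite g'j; apply: le_lt_trans (probability_le1 _ _) _ => //; rewrite ltry.
    - move=> i ki; have [->|ij] := eqVneq i j; first by exists A; rewrite // /g' eqxx.
      rewrite g'i//; apply: gA; rewrite ltn_neqAle eq_sym ki andbT.
      by apply: contra ij => /eqP ij; exact/eqP/val_inj.
    rewrite (bigD1 j)//= g'j; congr (_ * _).
    by apply: eq_bigr => i ij; rewrite g'i.
  rewrite /nu /mscale/= fineK// muleC -H [RHS]integral_mkcond.
  apply: eq_integral => omega _; rewrite epatch_indic/= (bigD1 j)//= EFinM muleC.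
  congr (_ * _); last by rewrite /g' eqxx.
  by congr EFin; apply: eq_bigr => i ij; rewrite g'i.
under eq_integral do rewrite (bigD1 j)//=.
have := ge0_integral_transport (measurable_funPT (X j)) mw w0 nuE (mg j) (g0 j).
move=> <-.
rewrite ge0_integral_mscale//=; last 2 first.
- exact/measurable_EFinP.
- by move=> x _; rewrite lee_fin.
rewrite (bigD1 j)//= fineK// muleC; congr (_ * _).
have mgj : measurable_fun setT (EFin \o g j) by exact/measurable_EFinP.
by rewrite (ge0_integral_distribution (X j) mgj)// => y; rewrite lee_fin.
Qed.

Lemma expectation_prod n (h : 'rV[R]_d -> R) (b : R) :
  measurable_fun setT h -> (forall x, (0 <= h x)%R) ->
  (forall i, \int[P]_omega (h (X i omega))%:E <= b%:E) ->
  \int[P]_omega (\prod_(i < n) h (X i omega))%:E <= (b ^+ n)%:E.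
Proof.
move=> mh h0 hb.
rewrite (@expectation_prod_partial n n (fun _ => h))//; last 2 first.
- by move=> i; apply: le_lt_trans (hb i) _; rewrite ltry.
- by move=> i; rewrite leqNgt ltn_ord.
elim: n => [|n IHn]; first by rewrite big_ord0 expr0.
have E0 i : 0 <= \int[P]_omega (h (X i omega))%:E.
  by apply: integral_ge0 => omega _; rewrite lee_fin.
rewrite big_ord_recr/= exprSr EFinM lee_pmul//.
by apply: prode_ge0.
Qed.

(** From [exp (-x) >= 1 - x] and [(1 - x) (1 + x + 2 x^2) = 1 + x^2 (1 - 2 x) >= 1]. *)
Lemma expR_le_quad (x : R) : (x <= 2^-1 -> expR x <= 1 + x + 2 * x ^+ 2)%R.
Proof.
move=> x12.
have x1 : (0 < 1 - x)%R by lra.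
have h : ((1 - x) * expR x <= 1)%R.
  have := expR_ge1Dx (- x); rewrite expRN => h.
  by rewrite -ler_pdivlMr ?expR_gt0// div1r.
rewrite -(ler_pM2l x1); apply: le_trans h _.
nra.
Qed.

(** Markov's inequality for the exponential of the sum. As [|g|] is at most the indicator of [A],
    the second moment of [g] is at most [p], so the exponent sees the expected number of points in
    [A] and not [n]. The bound [mean] is stated for [g + 1_A], which is nonnegative. The parameter
    [s] stays free because each tail calls for its own choice. *)
Lemma bernstein_upper (A : set 'rV[R]_d) (g : 'rV[R]_d -> R) (n : nat)
    (p mean u s : R) :
  measurable A -> measurable_fun setT g ->
  (forall x, (`|g x| <= \1_A x)%R) ->
  (forall i, P (X i @^-1` A) = p%:E) ->
  (forall i, \int[P]_omega (g (X i omega) + \1_A (X i omega))%:E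
     <= (mean + p)%:E) ->
  (0 <= s <= 2^-1)%R ->
  P [set omega | (n%:R * mean + u <= \sum_(i < n) g (X i omega))%R] <=
    (expR (- s * u + 2 * s ^+ 2 * (n%:R * p)))%:E.
Proof.
move=> mA mg gA pE meanE /andP[s0 s12].
have m1A : measurable_fun setT (\1_A : 'rV[R]_d -> R) by [].
have mexp : measurable_fun setT (fun x => expR (s * g x)).
  by apply: measurableT_comp => //; exact: measurable_funM.
have Eexp i : \int[P]_omega (expR (s * g (X i omega)))%:E <=
    (expR (s * mean + 2 * s ^+ 2 * p))%:E.
  (* This is [1 + s g + 2 s^2 1_A], an upper bound for the exponential, written as a sum of
     nonnegative functions so that the integral can be split; [1 - s 1_A >= 0] because
     [s <= 1/2]. *)
  apply: (@le_trans _ _ (\int[P]_omega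
     ((1 - s * \1_A (X i omega))%:E + (s%:E * (g (X i omega) + \1_A (X i omega))%:E +
       (2 * s ^+ 2)%:E * (\1_A (X i omega))%:E)))).
    apply: ge0_le_integral => //.
    - by apply/measurable_EFinP; exact: (measurable_RV_comp i mexp).
    - apply/measurable_EFinP.
      apply: (@measurable_RV_comp (fun x => (1 - s * \1_A x) + (s * (g x + \1_A x) + 2 * s ^+ 2 * \1_A x)))%R.
      by mfun.
    - move=> omega _; rewrite -!EFinM -!EFinD lee_fin.
      have := gA (X i omega); rewrite indicE; case: (_ \in _) => /= gle.
        move: gle; rewrite ler_norml => /andP[g1 g2].
        have /expR_le_quad : (s * g (X i omega) <= 2^-1)%R by nra.
        have : ((s * g (X i omega)) ^+ 2 <= s ^+ 2)%R.
          rewrite -subr_ge0.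
          have -> : (s ^+ 2 - (s * g (X i omega)) ^+ 2 =
            s ^+ 2 * ((1 - g (X i omega)) * (1 + g (X i omega))))%R by ring.
          by rewrite mulr_ge0 ?sqr_ge0// mulr_ge0//; lra.
        lra.
      move: gle; rewrite normr_le0 => /eqP ->.
      by rewrite mulr0 expR0; lra.
  have nn1 omega : (0 <= g (X i omega) + \1_A (X i omega))%R.
    have := gA (X i omega); rewrite ler_norml => /andP[]; lra.
  have mX1 : measurable_fun setT (fun omega => \1_A (X i omega) : R).
    exact: measurable_RV_comp.
  have mXg : measurable_fun setT (fun omega => g (X i omega) + \1_A (X i omega))%R.
    by apply: (@measurable_RV_comp (fun x => g x + \1_A x))%R; exact: measurable_funD.
  have E1 : \int[P]_omega (\1_A (X i omega))%:E = p%:E.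
    rewrite -(pE i) (_ : (fun _ => _) = (fun omega => (\1_(X i @^-1` A) omega)%:E))//.
    rewrite integral_indic ?setIT//.
    by rewrite -[X in measurable X]setTI; exact: measurable_funPT.
  have i01 omega : (0 <= (\1_A (X i omega) : R) <= 1)%R.
    by rewrite indicE; case: (_ \in _); rewrite /= ?lexx ?ler01.
  rewrite ge0_integralD//; last 4 first.
  - move=> omega _; rewrite lee_fin; have := i01 omega; nra.
  - by apply/measurable_EFinP; apply: measurable_funB => //; exact: measurable_funM.
  - move=> omega _; rewrite -!EFinM -EFinD lee_fin; have := i01 omega; have := nn1 omega; nra.
  - apply/measurable_EFinP; apply: measurable_funD; exact: measurable_funM.
  rewrite ge0_integralD//; last 4 first.
  - move=> omega _; rewrite -!EFinM lee_fin; have := nn1 omega; nra.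
  - by apply/measurable_EFinP; exact: measurable_funM.
  - move=> omega _; rewrite -!EFinM lee_fin; have := i01 omega; nra.
  - by apply/measurable_EFinP; exact: measurable_funM.
  rewrite ge0_integralZl_EFin//; last 2 first.
  - by move=> omega _; rewrite lee_fin.
  - exact/measurable_EFinP.
  have s20 : (0 <= 2 * s ^+ 2)%R by rewrite mulr_ge0// sqr_ge0.
  rewrite ge0_integralZl_EFin//; last exact/measurable_EFinP.
  rewrite E1.
  (* Instead of integrating a difference, the finite number [s p] is added, the two nonnegative
     integrands sum to 1, and [s p] is cancelled. *)
  have E2 : \int[P]_omega (1 - s * \1_A (X i omega))%:E = (1 - s * p)%:E.
    set I := \int[P]_omega _.
    transitivity (I + s%:E * p%:E - s%:E * p%:E); first by rewrite addeK.
    suff -> : I + s%:E * p%:E = 1%:E by [].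
    rewrite -E1 -ge0_integralZl_EFin//; last exact/measurable_EFinP.
    rewrite /I.
    rewrite -ge0_integralD//; last 4 first.
    - move=> omega _; rewrite lee_fin; have := i01 omega; nra.
    - by apply/measurable_EFinP; apply: measurable_funB => //; exact: measurable_funM.
    - move=> omega _; rewrite -!EFinM lee_fin; have := i01 omega; nra.
    - by apply/measurable_EFinP; exact: measurable_funM.
    under eq_integral do rewrite -EFinM -EFinD subrK.
    by rewrite integral_cst//= probability_setT mule1.
  rewrite E2.
  apply: (@le_trans _ _ ((1 - s * p)%:E + (s%:E * (mean + p)%:E + (2 * s ^+ 2)%:E * p%:E))).
    by apply: leeD2l; apply: leeD2r; exact: lee_wpmul2l.
  rewrite -!EFinM -!EFinD lee_fin.
  have := expR_ge1Dx (s * mean + 2 * s ^+ 2 * p); lra.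
have := expectation_prod n mexp (fun x => expR_ge0 _) Eexp.
under eq_integral do rewrite -expR_sum -mulr_sumr.
move=> H.
set t := (n%:R * mean + u)%R; set B := [set _ | _].
have mS : measurable_fun setT (fun omega => \sum_(i < n) g (X i omega))%R.
  by apply: measurable_sum => i; exact: measurable_RV_comp.
have mB : measurable B by exact: measurable_set_ge.
have : (expR (s * t))%:E * P B <= (expR (s * mean + 2 * s ^+ 2 * p) ^+ n)%:E.
  apply: le_trans H.
  rewrite -[P B]/(P B) -(setIT B) -integral_indic//.
  rewrite -ge0_integralZl_EFin ?expR_ge0//; last exact/measurable_EFinP.
  apply: ge0_le_integral => //.
  - by apply/measurable_EFinP; exact: measurable_funM.
  - by apply/measurable_EFinP; apply: measurableT_comp => //; exact: measurable_funM.
  - move=> omega _; rewrite -EFinM lee_fin indicE.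
    case: (boolP (omega \in B)) => [/set_mem tS|_]; last by rewrite mulr0 expR_ge0.
    by rewrite mulr1 ler_expR ler_wpM2l.
rewrite -expRM_natl muleC -lee_pdivlMr ?expR_gt0//.
move=> /le_trans; apply.
rewrite -expRN -EFinM lee_fin -expRD ler_expR /t.
lra.
Qed.

End independence.

(** * Lebesgue measure of wedges *)

Lemma measurable_set_le (R : realType) d (T : measurableType d) (S : T -> R) t :
  measurable_fun setT S -> measurable [set x | S x <= t].
Proof.
move=> mS; rewrite (_ : [set _ | _] = S @^-1` `]-oo, t]%classic); last first.
  by apply/seteqP; split => x /=; rewrite in_itv.
by rewrite -[X in measurable X]setTI; exact: mS.
Qed.

Lemma measurable_set_gt (R : realType) d (T : measurableType d) (S : T -> R) t :
  measurable_fun setT S -> measurable [set x | t < S x].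
Proof.
move=> mS; rewrite (_ : [set _ | _] = S @^-1` `]t, +oo[%classic); last first.
  by apply/seteqP; split => x /=; rewrite in_itv/= andbT.
by rewrite -[X in measurable X]setTI; exact: mS.
Qed.

Section lebesgue_row_theory.
Local Open Scope ereal_scope.
Variable R : realType.
Notation rowT n := ('rV[R]_n).

Lemma measurable_coord n (i : 'I_n) :
  measurable_fun setT (fun v : rowT n => v ord0 i).
Proof. exact: (iffLR (measurable_fun_matrixP (id : 'rV[measurableTypeR R]_n -> _))). Qed.

Lemma measurable_rowP d (T : measurableType d) n (f : T -> rowT n) :
  (forall j, measurable_fun setT (fun x => f x ord0 j)) <->
  measurable_fun setT f.
Proof.
split=> [h|h j].
  apply: (iffRL (measurable_fun_matrixP (f : T -> 'rV[measurableTypeR R]_n))).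
  by move=> i j; rewrite (ord1 i); exact: h.
exact: (iffLR (measurable_fun_matrixP (f : T -> 'rV[measurableTypeR R]_n))).
Qed.

Lemma measurable_row_add d (T : measurableType d) n (f g : T -> rowT n) :
  measurable_fun setT f -> measurable_fun setT g ->
  measurable_fun setT (fun x => (f x + g x)%R : rowT n).
Proof.
move=> /measurable_rowP mf /measurable_rowP mg; apply/measurable_rowP => j.
under eq_fun do rewrite mxE.
by apply: measurable_funD.
Qed.

Lemma measurable_row_opp d (T : measurableType d) n (f : T -> rowT n) :
  measurable_fun setT f -> measurable_fun setT (fun x => (- f x)%R : rowT n).
Proof.
move=> /measurable_rowP mf; apply/measurable_rowP => j.
under eq_fun do rewrite mxE.
by apply: measurableT_comp.
Qed.

Lemma measurable_row_mul d (T : measurableType d) n p (U : 'M[R]_(n, p))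
    (f : T -> rowT n) :
  measurable_fun setT f -> measurable_fun setT (fun x => (f x *m U)%R : rowT p).
Proof.
move=> /measurable_rowP mf; apply/measurable_rowP => j.
under eq_fun do rewrite mxE.
by apply: measurable_sum => i; apply: measurable_funM.
Qed.

Lemma ge0_integral_lebesgue_rowS n (h : rowT n.+1 -> \bar R) :
  measurable_fun setT h -> (forall v, 0 <= h v) ->
  \int[lebesgue_row R n.+1]_v h v =
  \int[@lebesgue_measure R]_x \int[lebesgue_row R n]_v h (row_cons (x, v)).
Proof.
move=> mh h0.
have mhc : measurable_fun setT (h \o @row_cons R n).
  by apply: measurableT_comp => //; exact: measurable_row_cons.
transitivity (\int[@lebesgue_measure R \x lebesgue_row R n]_z h (row_cons z)).
  exact: (ge0_integral_pushforward (@measurable_row_cons R n)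
    (@lebesgue_measure R \x lebesgue_row R n) measurableT mh (fun v _ => h0 v)).
exact: (fubini_tonelli1 _ mhc (fun z => h0 _)).
Qed.

Lemma ge0_integral_lebesgue_translate (h : measurableTypeR R -> \bar R) (a : R) :
  measurable_fun setT h -> (forall v, 0 <= h v) ->
  \int[@lebesgue_measure R]_x h (x + a)%R = \int[@lebesgue_measure R]_x h x.
Proof.
move=> mh h0.
have ma : measurable_fun setT (fun x : measurableTypeR R => (x + a)%R : measurableTypeR R).
  exact: measurable_funD.
rewrite -[LHS](ge0_integral_pushforward ma _ measurableT)//.
apply/esym; apply: (eq_measure_integral (pushforward _ _)) => //= A mA _.
apply: lebesgue_measure_unique => //= _ [[x y]] _ <-.
rewrite /pushforward.
rewrite (_ : _ @^-1` _ = `](x - a)%R, (y - a)%R]%classic); last first.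
  by apply/seteqP; split => z /=; rewrite !in_itv/= ltrBlDr lerBrDr.
rewrite !lebesgue_measure_itv/= !lte_fin ltrD2r.
by case: ifP => // _; rewrite -!EFinB; congr EFin; ring.
Qed.

Lemma ge0_integral_lebesgue_row_translate n (h : rowT n -> \bar R) (a : rowT n) :
  measurable_fun setT h -> (forall v, 0 <= h v) ->
  \int[lebesgue_row R n]_v h (v + a)%R = \int[lebesgue_row R n]_v h v.
Proof.
elim: n h a => [|n IHn] h a mh h0.
  by apply: eq_integral => v _; congr h; apply/rowP => -[].
pose a0 := (row_uncons a).1; pose a' := (row_uncons a).2.
have mha : measurable_fun setT (fun v : rowT n.+1 => h (v + a)%R).
  apply: measurableT_comp => //.
  by apply: measurable_row_add => //; exact: measurable_id.
rewrite (ge0_integral_lebesgue_rowS mha (fun v => h0 _)) (ge0_integral_lebesgue_rowS mh h0).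
have rcD x v : (row_cons (x, v) + a = row_cons (x + a0, v + a'))%R.
  by apply/rowP => i; rewrite !mxE; case: unliftP => [j ->|->]; rewrite //= !mxE.
have mhc : measurable_fun setT (h \o @row_cons R n).
  by apply: measurableT_comp => //; exact: measurable_row_cons.
transitivity (\int[@lebesgue_measure R]_x \int[lebesgue_row R n]_v
    h (row_cons ((x + a0)%R, v))).
  apply: eq_integral => x _.
  under eq_integral do rewrite rcD.
  rewrite (IHn (fun v => h (row_cons ((x + a0)%R, v))))//.
  exact: (measurable_fun_pair2 _ mhc).
rewrite (ge0_integral_lebesgue_translate (h := fun x =>
  \int[lebesgue_row R n]_v h (row_cons (x, v))))//.
- exact: (measurable_fun_fubini_tonelli_F _ mhc (fun z => h0 _)).
- by move=> x; apply: integral_ge0.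
Qed.

Lemma lebesgue_row_cube n (A : set R) : measurable A ->
  lebesgue_row R n [set v : rowT n | forall i, A (v ord0 i)] =
  \prod_(i < n) lebesgue_measure A.
Proof.
move=> mA; elim: n => [|n IHn].
  by rewrite big_ord0 /= diracE mem_set// => -[].
have mB : measurable [set v : rowT n | forall i, A (v ord0 i)].
  rewrite (_ : [set _ | _] = \bigcap_(i in [set: 'I_n])
      ((fun v : rowT n => v ord0 i) @^-1` A)).
    apply: fin_bigcap_measurable => // i _; rewrite -[X in measurable X]setTI.
    exact: measurable_coord.
  by apply/seteqP; split=> v /= h i; [move=> _|]; exact: h.
rewrite [LHS]/= /row_product /pushforward.
rewrite (_ : _ @^-1` _ = A `*` [set v : rowT n | forall i, A (v ord0 i)]).
  by rewrite product_measure1E//= big_ord_recl IHn.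
apply/seteqP; split=> -[x v] /=.
- move=> h; split; first by have := h ord0; rewrite mxE unlift_none.
  by move=> i; have := h (lift ord0 i); rewrite !mxE liftK.
- move=> [xab vB] i; rewrite mxE.
  by case: (unliftP ord0 i) => [k _|_].
Qed.

(* Both sides are the integral of [1_A(x U) 1_B(y)]: Fubini and two
   translations exchange the roles of [A] and [B]. *)
Lemma lebesgue_row_exchange n (U V : 'M[R]_n) (A B : set (rowT n)) :
  (V *m U = 1%:M)%R -> measurable A -> measurable B ->
  lebesgue_row R n ((fun v => (v *m U)%R) @^-1` A) * lebesgue_row R n B =
  lebesgue_row R n ((fun v => (v *m U)%R) @^-1` B) *
    lebesgue_row R n ((fun v => (- v)%R) @^-1` A).
Proof.
move=> VU mA mB.
set l := lebesgue_row R n.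
have mpre (A' : set (rowT n)) (phi : rowT n -> rowT n) :
    measurable_fun setT phi -> measurable A' -> measurable (phi @^-1` A').
  by move=> mphi mA'; rewrite -[X in measurable X]setTI; exact: mphi.
have mU : measurable_fun setT (fun v : rowT n => (v *m U)%R : rowT n).
  by apply: measurable_row_mul; exact: measurable_id.
have mN : measurable_fun setT (fun v : rowT n => (- v)%R : rowT n).
  by apply: measurable_row_opp; exact: measurable_id.
pose a v : R := \1_A v; pose b v : R := \1_B v.
have ma : measurable_fun setT a by exact: measurable_indic.
have mb : measurable_fun setT b by exact: measurable_indic.
have a0 v : (0 <= a v)%R by [].
have b0 v : (0 <= b v)%R by [].
have mA1 : measurable_fun setT (fun x : rowT n => (a (x *m U)%R)%:E).
  by apply/measurable_EFinP; apply: (measurableT_comp ma).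
have mxy1 : measurable_fun setT (fun z : rowT n * rowT n =>
    (a (z.1 *m U) * b (z.2 + z.1 *m U))%:E).
  apply/measurable_EFinP; apply: measurable_funM.
    apply: (measurableT_comp ma); apply: measurable_row_mul; exact: measurable_fst.
  apply: (measurableT_comp mb); apply: measurable_row_add; first exact: measurable_snd.
  by apply: measurable_row_mul; exact: measurable_fst.
have mxy2 : measurable_fun setT (fun z : rowT n * rowT n =>
    (a (z.1 *m U - z.2) * b (z.1 *m U))%:E).
  apply/measurable_EFinP; apply: measurable_funM.
    apply: (measurableT_comp ma); apply: measurable_row_add.
      apply: measurable_row_mul; exact: measurable_fst.
    by apply: measurable_row_opp; exact: measurable_snd.
  by apply: (measurableT_comp mb); apply: measurable_row_mul; exact: measurable_fst.
have mI (C : set (rowT n)) : measurable C -> measurable_fun setT (fun x => (\1_C x)%:E : \bar R).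
  by move=> mC; apply/measurable_EFinP; exact: measurable_indic.
have intI (C : set (rowT n)) : measurable C -> \int[l]_x (\1_C x)%:E = l C.
  by move=> mC; rewrite integral_indic// setIT.
transitivity (\int[l]_x \int[l]_y (a (x *m U) * b (y + x *m U))%:E).
  transitivity (\int[l]_x ((\1_((fun v => (v *m U)%R) @^-1` A) x)%:E * l B)).
    rewrite ge0_integralZr//; try by [apply: mI; exact: mpre].
    by rewrite intI//; exact: mpre.
  apply: eq_integral => x _.
  rewrite (ge0_integral_lebesgue_row_translate (h := fun y => (a (x *m U)%R * b y)%:E)).
  - under [RHS]eq_integral do rewrite EFinM.
    rewrite ge0_integralZl_EFin//; last 2 first.
    - by move=> v _; rewrite lee_fin.
    - exact/measurable_EFinP.
    by rewrite intI.
  - by apply/measurable_EFinP; exact: measurable_funM.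
  - by move=> v; rewrite lee_fin mulr_ge0.
rewrite (fubini_tonelli _ mxy1) /=; last by move=> z; rewrite lee_fin mulr_ge0.
transitivity (\int[l]_y \int[l]_x (a (x *m U - y) * b (x *m U))%:E).
  apply: eq_integral => y _.
  (* As [V U = 1], shifting [x] by [- y V] turns [x U] into [x U - y]. *)
  rewrite -(ge0_integral_lebesgue_row_translate (- (y *m V))%R).
  - by apply: eq_integral => x _; rewrite mulmxDl mulNmx -mulmxA VU mulmx1 addrCA subrr addr0.
  - exact: (measurable_fun_pair1 _ mxy1).
  - by move=> v; rewrite lee_fin mulr_ge0.
rewrite -(fubini_tonelli _ mxy2) /=; last by move=> z; rewrite lee_fin mulr_ge0.
transitivity (\int[l]_x ((\1_((fun v => (v *m U)%R) @^-1` B) x)%:E *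
    l ((fun v => (- v)%R) @^-1` A))); last first.
  rewrite ge0_integralZr//; try by [apply: mI; exact: mpre].
  by rewrite intI//; exact: mpre.
apply: eq_integral => x _.
rewrite -(ge0_integral_lebesgue_row_translate (x *m U)%R).
- under eq_integral do rewrite EFinM muleC opprD addrCA subrr addr0.
  rewrite ge0_integralZl_EFin//; last 2 first.
  - by move=> v _; rewrite lee_fin.
  - by apply/measurable_EFinP; apply: (measurableT_comp ma).
  by rewrite -(intI _ (mpre _ _ mN mA)).
- exact: (measurable_fun_pair2 _ mxy2).
- by move=> v; rewrite lee_fin mulr_ge0.
Qed.

Lemma measurable_dotr d (T : measurableType d) n (f g : T -> rowT n) :
  measurable_fun setT f -> measurable_fun setT g ->
  measurable_fun setT (fun x => dotr (f x) (g x)).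
Proof.
move=> /measurable_rowP mf /measurable_rowP mg.
rewrite /dotr; under eq_fun do rewrite mxE.
apply: measurable_sum => i; under eq_fun do rewrite mxE.
exact: measurable_funM.
Qed.

Lemma dotrE n (u v : 'rV[R]_n) : dotr u v = (\sum_i u ord0 i * v ord0 i)%R.
Proof. by rewrite /dotr mxE; apply: eq_bigr => i _; rewrite mxE. Qed.

(** A rotation-invariant set that can be cancelled from the exchange identity. It lies between two
    cubes; the side [1/(n+1)] of the inner one also makes sense for [n = 0]. *)
Lemma lebesgue_row_unit_ball n :
  0 < lebesgue_row R n [set v : rowT n | dotr v v <= 1]%R < +oo.
Proof.
have mB : measurable [set v : rowT n | dotr v v <= 1]%R.
  apply: measurable_set_le; apply: measurable_dotr; exact: measurable_id.
have mC (a b : R) : measurable [set v : rowT n | forall i, `]a, b]%classic (v ord0 i)].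
  rewrite (_ : [set _ | _] = \bigcap_(i in [set: 'I_n])
      ((fun v : rowT n => v ord0 i) @^-1` `]a, b]%classic)).
    apply: fin_bigcap_measurable => // i _; rewrite -[X in measurable X]setTI.
    exact: measurable_coord.
  by apply/seteqP; split=> v /= h i; [move=> _|]; exact: h.
apply/andP; split.
- apply: (@lt_le_trans _ _ (lebesgue_row R n
    [set v : rowT n | forall i, `]0%R, (n.+1%:R^-1)%R]%classic (v ord0 i)])).
    rewrite lebesgue_row_cube// lebesgue_measure_itv/= lte_fin invr_gt0 ltr0n/=.
    rewrite sube0; elim/big_ind : _ => [|x y|i _]; [exact: lte01|exact: mule_gt0|].
    by rewrite lte_fin invr_gt0.
  apply: le_measure; rewrite ?inE// => v /= h.
  rewrite dotrE (@le_trans _ _ (\sum_(i < n) n.+1%:R^-1)%R)//.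
    apply: ler_sum => i _; have := h i; rewrite in_itv/= => /andP[v0 v1].
    apply: (le_trans _ v1); rewrite ler_piMl ?(ltW v0)//.
    by rewrite (le_trans v1)// invf_le1 ?ltr0n// ler1n.
  by rewrite sumr_const card_ord -[leLHS]mulr_natr ler_pdivrMl ?ltr0n// mulr1 ler_nat.
- apply: (@le_lt_trans _ _ (lebesgue_row R n
    [set v : rowT n | forall i, `](-2)%R, 1%R]%classic (v ord0 i)])).
    apply: le_measure; rewrite ?inE// => v /= h i.
    rewrite in_itv/=.
    have vi : (v ord0 i ^+ 2 <= 1)%R.
      apply: le_trans h; rewrite dotrE (bigD1 i)//= -expr2 lerDl.
      by apply: sumr_ge0 => j _; rewrite -expr2 sqr_ge0.
    by apply/andP; split; nra.
  rewrite lebesgue_row_cube// lebesgue_measure_itv/=.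
  by case: ifP => _; rewrite -?EFinB prodEFin ltry.
Qed.

Lemma muleIr (x y b : \bar R) : b \is a fin_num -> 0 < b -> x * b = y * b -> x = y.
Proof.
by move=> bfin b0 H; apply/eqP; rewrite eq_le -(lee_pmul2r bfin b0 x) -(lee_pmul2r bfin b0 y) H lexx.
Qed.

(** No determinant enters: the unit ball is invariant under every orthogonal matrix, so cancelling
    it from the exchange identity shows that the preimage of [A] has the measure of [-A], whatever
    the matrix. Comparison with the identity matrix concludes. *)
Lemma lebesgue_row_orthogonal n (U : 'M[R]_n) (A : set (rowT n)) :
  (U *m U^T = 1%:M)%R -> measurable A ->
  lebesgue_row R n ((fun v => (v *m U)%R) @^-1` A) = lebesgue_row R n A.
Proof.
move=> UU mA.
pose B := [set v : rowT n | dotr v v <= 1]%R.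
have mB : measurable B.
  apply: measurable_set_le; apply: measurable_dotr; exact: measurable_id.
have /andP[B0 Boo] := lebesgue_row_unit_ball n.
have reflect (W : 'M[R]_n) : (W *m W^T = 1%:M)%R ->
    lebesgue_row R n ((fun v => (v *m W)%R) @^-1` A) =
    lebesgue_row R n ((fun v => (- v)%R) @^-1` A).
  move=> WW; have := lebesgue_row_exchange (mulmx1C WW) mA mB.
  rewrite (_ : (fun v => (v *m W)%R) @^-1` B = B); last first.
    apply/seteqP; split => v; rewrite /B /= /dotr trmx_mul mulmxA -(mulmxA v);
    by rewrite WW mulmx1.
  rewrite [RHS]muleC => H.
  have Bfin : lebesgue_row R n B \is a fin_num by rewrite ge0_fin_numE// ltW.
  exact: muleIr Bfin B0 H.
rewrite reflect// -(reflect 1%:M%R) ?trmx1 ?mulmx1//.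
by under eq_fun do rewrite mulmx1.
Qed.

Lemma ge0_integral_lebesgue_row_orthogonal n (U : 'M[R]_n) (h : rowT n -> \bar R) :
  (U *m U^T = 1%:M)%R -> measurable_fun setT h -> (forall v, 0 <= h v) ->
  \int[lebesgue_row R n]_v h (v *m U)%R = \int[lebesgue_row R n]_v h v.
Proof.
move=> UU mh h0.
have mU : measurable_fun setT (fun x : rowT n => (x *m U)%R : rowT n).
  by apply: measurable_row_mul; exact: measurable_id.
rewrite -[LHS](ge0_integral_pushforward mU (lebesgue_row R n) measurableT mh)//.
apply: (eq_measure_integral (lebesgue_row R n)) => B mB _.
exact: lebesgue_row_orthogonal.
Qed.

(** * Integrals over a wedge of functions of the height *)

Section wedge_integral.
Variables (d : nat) (W : wedge R d.+1).
Hypothesis wfW : wf_wedge W.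

Lemma measurable_wproj : measurable_fun setT (wproj W : rowT d.+1 -> R).
Proof.
rewrite /wproj; apply: measurable_dotr; last exact: measurable_cst.
by apply: measurable_row_add; [exact: measurable_id|exact: measurable_cst].
Qed.

Lemma measurable_wedge_set : measurable (wedge_set W).
Proof.
have mI : measurable_fun setT (fun x : rowT d.+1 => (x - vertex W)%R : rowT d.+1).
  by apply: measurable_row_add; [exact: measurable_id|exact: measurable_cst].
have mw := measurable_wproj.
have mtw : measurable_fun setT (fun x => tan (wedge_angle W) * wproj W x)%R.
  exact: measurable_funM.
rewrite (_ : wedge_set W = ([set x | (0 < wproj W x)%R] `&` [set x | (wproj W x <= wedge_length W)%R]) `&`
  \bigcap_(i in [set: 'I_d])
   ([set x | (0 <= tan (wedge_angle W) * wproj W x + dotr (x - vertex W) (row i (wedge_basis W)))%R] `&`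
   [set x | (0 <= tan (wedge_angle W) * wproj W x - dotr (x - vertex W) (row i (wedge_basis W)))%R])).
  apply: measurableI; first apply: measurableI.
  - exact: measurable_set_gt.
  - exact: measurable_set_le.
  apply: fin_bigcap_measurable => // i _.
  have mdi : measurable_fun setT (fun x : rowT d.+1 => dotr (x - vertex W) (row i (wedge_basis W))).
    by apply: measurable_dotr => //; exact: measurable_cst.
  apply: measurableI; apply: measurable_set_ge.
    exact: measurable_funD.
  exact: measurable_funB.
apply/seteqP; split => x /=.
- move=> [/andP[h1 h2] h]; split => // i _ /=.
  by have /andP[h3 h4] := h i; split; lra.
- move=> [[h1 h2] h]; split; first by rewrite h1.
  by move=> i; have /= [h3 h4] := h i I; apply/andP; split; lra.
Qed.

Let Q : 'M[R]_d.+1 := col_mx (direction W) (wedge_basis W).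

Lemma wedge_frame_orthogonal : (Q *m Q^T = 1%:M)%R.
Proof.
have [We WB WBe _ _] := wfW.
have e1 : (direction W *m (direction W)^T = 1%:M)%R.
  apply/matrixP => i j; rewrite !ord1 [RHS]mxE eqxx /=.
  have := We; rewrite /enorm => H.
  have h0 : (0 <= dotr (direction W) (direction W))%R.
    by rewrite dotrE; apply: sumr_ge0 => k _; rewrite -expr2 sqr_ge0.
  by rewrite -[LHS]/(dotr (direction W) (direction W)) -(sqr_sqrtr h0) H expr1n.
have eWB : (direction W *m (wedge_basis W)^T = 0)%R.
  by apply: (can_inj trmxK); rewrite trmx_mul trmxK WBe trmx0.
have -> : (Q^T = row_mx (direction W)^T (wedge_basis W)^T)%R := @tr_col_mx R 1 d d.+1 _ _.
apply: etrans (@mul_col_row R 1 d d.+1 1 d (direction W) (wedge_basis W)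
  (direction W)^T (wedge_basis W)^T) _.
by rewrite e1 WB WBe eWB -scalar_mx_block.
Qed.

Lemma wedge_frame0 x : ((x *m Q^T) ord0 ord0 = dotr x (direction W))%R.
Proof.
rewrite /dotr !mxE; apply: eq_bigr => k _; rewrite !mxE; congr (_ * _)%R.
by case: splitP => // j; rewrite (ord1 j).
Qed.

Lemma wedge_frameS x i :
  ((x *m Q^T) ord0 (lift ord0 i) = dotr x (row i (wedge_basis W)))%R.
Proof.
rewrite /dotr !mxE; apply: eq_bigr => k _; rewrite !mxE; congr (_ * _)%R.
case: splitP => [j|j /= ]; first by rewrite (ord1 j).
by rewrite /bump /= add1n => -[] ij; congr (wedge_basis W _ _); exact/val_inj.
Qed.

Lemma tan_wedge_angle_gt0 : (0 < tan (wedge_angle W))%R.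
Proof.
have [_ _ _ _ /andP[a0 api]] := wfW.
rewrite /tan divr_gt0//; first by apply: sin_gt0_pi; rewrite a0/= (lt_trans api)// ltr_pdivrMr// ltr_pMr ?pi_gt0// ltr1n.
by apply: cos_gt0_pihalf; rewrite api andbT (lt_trans _ a0)// oppr_lt0 divr_gt0// pi_gt0.
Qed.

(** In the orthonormal frame made of the direction and the basis, the section of the wedge at height
    [t] is a cube of side [2 tan(phi) t] in [d] dimensions; translation and rotation invariance
    bring the integral to this frame, and Tonelli integrates over the sections. *)
Lemma ge0_integral_wedge (h : R -> R) : measurable_fun setT h ->
  (forall t, 0 <= h t)%R ->
  \int[lebesgue_row R d.+1]_(x in wedge_set W) (h (wproj W x))%:E =
  \int[@lebesgue_measure R]_(t in `]0%R, wedge_length W])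
     (h t * (2 * tan (wedge_angle W) * t) ^+ d)%:E.
Proof.
move=> mh h0.
set T := tan _; set L := wedge_length W.
pose A : set (rowT d.+1) := [set y | (0 < y ord0 ord0 <= L)%R /\
  forall i, `[(- (T * y ord0 ord0))%R, (T * y ord0 ord0)%R]%classic (y ord0 (lift ord0 i))].
pose G (y : rowT d.+1) : R := (\1_A y * h (y ord0 ord0))%R.
have m0 : measurable_fun setT (fun y : rowT d.+1 => y ord0 ord0) by exact: measurable_coord.
have mA : measurable A.
  have mT : measurable_fun setT (fun y : rowT d.+1 => (T * y ord0 ord0)%R).
    exact: measurable_funM.
  rewrite (_ : A = ([set y | (0 < y ord0 ord0)%R] `&` [set y | (y ord0 ord0 <= L)%R]) `&`
    \bigcap_(i in [set: 'I_d])
     ([set y | (0 <= T * y ord0 ord0 + y ord0 (lift ord0 i))%R] `&`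
     [set y | (0 <= T * y ord0 ord0 - y ord0 (lift ord0 i))%R])).
    apply: measurableI; first apply: measurableI.
    - exact: measurable_set_gt.
    - exact: measurable_set_le.
    apply: fin_bigcap_measurable => // i _.
    have mi : measurable_fun setT (fun y : rowT d.+1 => y ord0 (lift ord0 i)) by exact: measurable_coord.
    apply: measurableI; apply: measurable_set_ge.
      exact: measurable_funD.
    exact: measurable_funB.
  rewrite /A; apply/seteqP; split => y /=.
  - move=> [/andP[h1 h2] hi]; split => // i _ /=.
    by have := hi i; rewrite in_itv/= => /andP[h3 h4]; split; lra.
  - move=> [[h1 h2] hi]; split; first by rewrite h1.
    by move=> i; have /= [h3 h4] := hi i I; rewrite in_itv/=; apply/andP; split; lra.
have mG : measurable_fun setT G.
  apply: measurable_funM; first exact: measurable_indic.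
  by apply: (measurableT_comp mh); exact: measurable_coord.
have G0 y : (0 <= G y)%R by rewrite mulr_ge0.
have KA x : wedge_set W x <-> A ((x - vertex W) *m Q^T)%R.
  rewrite /A /wedge_set /= wedge_frame0.
  split=> -[h1 h2]; split=> // i; have := h2 i; rewrite wedge_frameS.
    by rewrite in_itv.
  by rewrite in_itv.
rewrite integral_mkcond.
transitivity (\int[lebesgue_row R d.+1]_x (G ((x - vertex W) *m Q^T)%R)%:E).
  apply: eq_integral => x _; rewrite epatch_indic /G wedge_frame0 /= -EFinM mulrC.
  congr (_ * _)%:E; rewrite !indicE; congr (_%:R); congr nat_of_bool.
  by apply/idP/idP => /set_mem/KA/mem_set.
pose G' y : \bar R := (G (y *m Q^T)%R)%:E.
have mG' : measurable_fun setT G'.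
  apply/measurable_EFinP; apply: (measurableT_comp mG).
  by apply: measurable_row_mul; exact: measurable_id.
rewrite (ge0_integral_lebesgue_row_translate (h := G') (- vertex W)%R)//; last first.
  by move=> y; rewrite lee_fin.
have QTQ : (Q^T *m Q^T^T = 1%:M)%R by rewrite trmxK; exact: mulmx1C wedge_frame_orthogonal.
have mQ : measurable_fun setT (fun x : rowT d.+1 => (x *m Q^T)%R : rowT d.+1).
  by apply: measurable_row_mul; exact: measurable_id.
have mGE : measurable_fun setT (EFin \o G) by exact/measurable_EFinP.
transitivity (\int[lebesgue_row R d.+1]_y (G y)%:E).
  exact: (ge0_integral_lebesgue_row_orthogonal QTQ mGE).
rewrite (ge0_integral_lebesgue_rowS mGE); last by move=> y; rewrite lee_fin.
rewrite [RHS]integral_mkcond.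
apply: eq_integral => t _.
rewrite epatch_indic /=.
rewrite indicE; case: (boolP (t \in _)) => /=; last first.
  rewrite notin_setE /= in_itv/= => /negP tL; rewrite mule0.
  rewrite integral0_eq// => v _; rewrite /G indicE memNset ?mul0r// /A /= => -[].
  by rewrite mxE unlift_none/= (negbTE tL).
rewrite inE/= in_itv/= => tL; rewrite mule1.
have /andP[t0 tL'] := tL.
have mcube : measurable [set v : rowT d | forall i, `[(- (T * t))%R, (T * t)%R]%classic (v ord0 i)].
  rewrite (_ : [set _ | _] = \bigcap_(i in [set: 'I_d])
      ((fun v : rowT d => v ord0 i) @^-1` `[(- (T * t))%R, (T * t)%R]%classic)).
    apply: fin_bigcap_measurable => // i _; rewrite -[X in measurable X]setTI.
    exact: measurable_coord.
  by apply/seteqP; split=> v /= H i; [move=> _|]; exact: H.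
under eq_integral => v _.
  rewrite /G mxE unlift_none/= mulrC EFinM.
  rewrite (_ : \1_A _ = \1_[set v : rowT d | forall i, `[(- (T * t))%R, (T * t)%R]%classic (v ord0 i)] v); last first.
    rewrite !indicE; congr (_%:R); congr nat_of_bool.
    apply/idP/idP => /set_mem H; apply/mem_set; move: H; rewrite /A /= mxE unlift_none/= tL.
      by move=> [_ H] i; have := H i; rewrite mxE liftK.
    by move=> H; split => // i; rewrite mxE liftK.
  over.
rewrite ge0_integralZl_EFin//; last by apply/measurable_EFinP; exact: measurable_indic.
rewrite integral_indic// setIT.
rewrite -[X in _ * X]/(lebesgue_row R d [set v : rowT d | forall i, `[(- (T * t))%R, (T * t)%R]%classic (v ord0 i)]).
rewrite (@lebesgue_row_cube d `[(- (T * t))%R, (T * t)%R]%classic)// lebesgue_measure_itv/= lte_fin.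
have T0 := tan_wedge_angle_gt0.
have Tt : (- (T * t) < T * t)%R by have := mulr_gt0 T0 t0; rewrite -/T; lra.
rewrite Tt -EFinB prodEFin -EFinM; congr (_ * _)%:E.
by rewrite prodr_const card_ord; congr (_ ^+ _)%R; ring.
Qed.

Lemma ge0_integral_wedge_pow k :
  \int[lebesgue_row R d.+1]_(x in wedge_set W) ((wproj W x) ^+ k)%:E =
  ((2 * tan (wedge_angle W)) ^+ d * wedge_length W ^+ (k + d.+1) / (k + d.+1)%:R)%:E.
Proof.
have [_ _ _ L0 _] := wfW.
set T := tan _; set L := wedge_length W.
(* The formula for wedges asks for a function that is nonnegative on the whole line; on the wedge
   the absolute value changes nothing. *)
have mh : measurable_fun setT (fun t : R => `|t| ^+ k)%R.
  by apply: measurable_funX; exact: normr_measurable.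
transitivity (\int[lebesgue_row R d.+1]_(x in wedge_set W) (`|wproj W x| ^+ k)%:E).
  apply: eq_integral => x /[!inE] -[/andP[x0 _] _].
  by rewrite gtr0_norm.
rewrite (ge0_integral_wedge mh); last by move=> t; rewrite exprn_ge0.
transitivity (\int[@lebesgue_measure R]_(t in `]0%R, L]) ((2 * T) ^+ d * t ^+ (k + d))%:E).
  apply: eq_integral => t /[!inE]; rewrite /= in_itv/= => /andP[t0 _].
  by rewrite gtr0_norm// exprMn exprD; congr EFin; ring.
rewrite integral_itv_obnd_cbnd; last first.
  by apply/measurable_EFinP; apply: measurable_funM => //; exact: measurable_funX.
pose F (t : R) := ((2 * T) ^+ d / (k + d.+1)%:R * t ^+ (k + d.+1))%R.
have kd0 : ((k + d.+1)%:R != 0 :> R)%R by rewrite pnatr_eq0 addnS.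
pose c := ((2 * T) ^+ d / (k + d.+1)%:R)%R.
have FE : F = (c \*: ((@id R) ^+ (k + d).+1))%R.
  by apply/funext => t; rewrite /F /c addnS exprfctE.
have dF (t : R) : is_derive t 1%R F ((2 * T) ^+ d * t ^+ (k + d))%R.
  rewrite FE; apply: is_derive_eq.
  rewrite /GRing.scale/= mulr1 /c; move: kd0; rewrite addnS.
  by move: ((k + d).+1%:R : R)%R => r r0; field.
have cF : continuous F.
  by move=> t; apply/differentiable_continuous/derivable1_diffP; have [] := dF t.
rewrite (@continuous_FTC2 _ _ F)//.
- rewrite /F addnS expr0n/= mulr0 sube0; congr EFin; move: kd0; rewrite addnS.
  by move: ((k + d).+1%:R : R)%R => r r0; field.
- apply: continuous_subspaceT => t.
  by apply: cvgM; [exact: cvg_cst|exact: exprn_continuous].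
- split.
  + by move=> t _; have [] := dF t.
  + exact: cvg_at_right_filter (cF _).
  + exact: cvg_at_left_filter (cF _).
- by move=> t _; rewrite derive1E; have [] := dF t.
Qed.

End wedge_integral.

End lebesgue_row_theory.

(** * Taylor expansion *)

Section taylor.
Variables (R : realType) (d : nat).
Implicit Types (f : 'rV[R]_d -> R) (x y v w : 'rV[R]_d).

Lemma nbhs_row_coords x (Q : set 'rV[R]_d) : (\forall y \near x, Q y) ->
  exists2 r : R, 0 < r & forall y, (forall i, `|y ord0 i - x ord0 i| < r) -> Q y.
Proof.
move=> /nbhs_ballP[r /= r0 rQ]; exists r => // y xy; apply: rQ.
rewrite -ball_normE /ball_/= [ltLHS]/Num.norm /= mx_normrE.
apply/bigmax_ltP; split => //= -[i j] _ /=.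
by rewrite ord1 !mxE distrC.
Qed.

Lemma derivable_line f y (u : 'rV[R]_d) t : derivable f (y + t *: u) u ->
  is_derive t (1 : R) (fun s : R => f (y + s *: u)) ('D_u f (y + t *: u)).
Proof.
move=> df.
have E : (fun h : R => h^-1 *: (((fun s => f (y + s *: u)) \o shift t) (h *: (1 : R)) -
    f (y + t *: u))) =
  (fun h : R => h^-1 *: ((f \o shift (y + t *: u)) (h *: u) - f (y + t *: u))).
  apply/funext => h /=; congr (_ *: (f _ - _)).
  by rewrite -[h%:A]/(h * 1) mulr1 scalerDl addrCA.
by apply: DeriveDef; rewrite /derivable /derive /= E.
Qed.

(** Increments along coordinates have either sign, hence a form without an order between [a] and
    [b]. *)
Lemma MVT_abs (phi dphi : R -> R) (a b B : R) :
  (forall t, `|t - a| <= `|b - a| -> is_derive t (1 : R) phi (dphi t)) ->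
  (forall t, `|t - a| <= `|b - a| -> `|dphi t| <= B) ->
  `|phi b - phi a| <= B * `|b - a|.
Proof.
move=> dp pB.
have cts t : `|t - a| <= `|b - a| -> {for t, continuous phi}.
  by move=> h; apply/differentiable_continuous/derivable1_diffP; have [] := dp t h.
have [ab|ba|->] := ltgtP a b; last by rewrite !subrr normr0 mulr0.
- have H t : t \in `[a, b] -> `|t - a| <= `|b - a|.
    rewrite in_itv/= => /andP[at_ tb].
    by rewrite !ger0_norm ?subr_ge0// ?(ltW ab)// lerD2r.
  have [||s sab ->] := @MVT _ phi dphi a b ab.
  + by move=> t /subset_itv_oo_cc/H/dp.
  + apply: continuous_in_subspaceT => t /[!inE] tab; exact/cts/H.
  rewrite normrM ler_wpM2r//; apply/pB/H; exact: subset_itv_oo_cc.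
- have H t : t \in `[b, a] -> `|t - a| <= `|b - a|.
    rewrite in_itv/= => /andP[bt ta].
    by rewrite distrC (distrC b) !ger0_norm ?subr_ge0// ?(ltW ba)// lerD2l lerN2.
  have [||s sab E] := @MVT _ phi dphi b a ba.
  + by move=> t /subset_itv_oo_cc/H/dp.
  + apply: continuous_in_subspaceT => t /[!inE] tab; exact/cts/H.
  rewrite distrC E normrM distrC ler_wpM2r//; apply/pB/H; exact: subset_itv_oo_cc.
Qed.

Lemma coordinate_increment f y (k : 'I_d) (s a e : R) :
  (forall t, `|t| <= `|s| -> derivable f (y + t *: basis_vector R k) (basis_vector R k) /\
     `|partial f k (y + t *: basis_vector R k) - a| <= e) ->
  `|f (y + s *: basis_vector R k) - f y - a * s| <= e * `|s|.
Proof.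
move=> H.
pose phi (t : R) := f (y + t *: basis_vector R k) - a * t.
pose dphi (t : R) := partial f k (y + t *: basis_vector R k) - a.
have := @MVT_abs phi dphi 0 s e.
rewrite /phi !subr0 scale0r addr0 mulr0 subr0 addrAC; apply.
- move=> t; rewrite subr0 => /H[df _].
  have d1 := derivable_line df.
  have d2 : is_derive t (1 : R) (fun t : R => a * t) a.
    rewrite (_ : (fun _ => _) = a *: (@id R)); last exact/funext.
    by apply: is_derive_eq; rewrite /GRing.scale/= mulr1.
  exact: is_deriveB.
- by move=> t; rewrite subr0 => /H[_].
Qed.

(** Walk from [x] to [x + w] by changing one coordinate at a time; all points of the path stay
    within [r] of [x] in every coordinate. It serves for [f], to get directional derivatives, and
    for its partial derivatives, to get the second order expansion. *)
Lemma partial_increment f x (r e : R) (a : 'I_d -> R) w :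
  (forall y, (forall i, `|y ord0 i - x ord0 i| < r) -> forall k,
     derivable f y (basis_vector R k) /\ `|partial f k y - a k| <= e) ->
  (forall i, `|w ord0 i| < r) ->
  `|f (x + w) - f x - \sum_i a i * w ord0 i| <= e * \sum_i `|w ord0 i|.
Proof.
move=> H wr.
pose wk k : 'rV[R]_d := \row_i (if (i < k)%N then w ord0 i else 0).
suff K k : (k <= d)%N -> `|f (x + wk k) - f x - \sum_(i < d | (i < k)%N) a i * w ord0 i|
    <= e * \sum_(i < d | (i < k)%N) `|w ord0 i|.
  have := K d (leqnn d).
  rewrite (_ : wk d = w); last by apply/rowP => i; rewrite mxE ltn_ord.
  by under eq_bigl do rewrite ltn_ord; under [X in _ <= _ * X -> _]eq_bigl do rewrite ltn_ord.
elim: k => [_|k IHk kd].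
  rewrite !big_pred0 // mulr0 (_ : wk 0 = 0) ?addr0 ?subrr ?normr0//.
  by apply/rowP => i; rewrite !mxE.
pose j := Ordinal kd.
have wkS : wk k.+1 = wk k + w ord0 j *: basis_vector R j.
  apply/rowP => i; rewrite !mxE eqxx /= ltnS leq_eqVlt -(inj_eq val_inj) /=.
  case: (ltngtP i k) => [ik|ik|ik]; rewrite ?mulr0 ?addr0 ?mulr1 ?add0r//.
  by congr (w _ _); exact/val_inj.
have sumS (F : 'I_d -> R) : \sum_(i < d | (i < k.+1)%N) F i = \sum_(i < d | (i < k)%N) F i + F j.
  rewrite (bigD1 j)//= addrC; congr (_ + _); apply: eq_bigl => i.
  by rewrite ltnS -(inj_eq val_inj) /= andbC ltn_neqAle.
rewrite !sumS wkS mulrDr addrA.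
have := IHk (ltnW kd).
have : `|f (x + wk k + w ord0 j *: basis_vector R j) - f (x + wk k) - a j * w ord0 j| <= e * `|w ord0 j|.
  apply: coordinate_increment => t tw; apply: H => i; rewrite !mxE eqxx/=.
  rewrite (_ : _ - x ord0 i = (if (i < k)%N then w ord0 i else 0) + t * (i == j)%:R); last by ring.
  have := wr i; have := wr j; have r0 : 0 < r by exact: le_lt_trans (wr j).
  case: (ltngtP i k) => [ik|ik|ik].
  - rewrite -(inj_eq val_inj) /= (ltn_eqF ik) mulr0 addr0//.
  - rewrite -(inj_eq val_inj) /= (gtn_eqF ik) mulr0 addr0 normr0//.
  - rewrite -(inj_eq val_inj) /= ik eqxx mulr1 add0r => wj _.
    exact: le_lt_trans tw wj.
move=> h1 h2; apply: le_trans (lerD h2 h1).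
by apply: le_trans (ler_normD _ _); rewrite le_eqVlt; apply/orP; left; apply/eqP; congr (`|_|); ring.
Qed.

(** The smoothness assumption speaks only of partial derivatives; their continuity makes the
    increment along [v] linear up to [o(h)]. *)
Lemma is_derive_partial f x v :
  (\forall y \near x, forall k, derivable f y (basis_vector R k)) ->
  (forall k, {for x, continuous (partial f k)}) ->
  is_derive x v f (\sum_k v ord0 k * partial f k x).
Proof.
move=> df cp.
pose S := \sum_i `|v ord0 i|.
have S0 : 0 <= S by apply: sumr_ge0.
have cvgf : (fun h => h^-1 *: ((f \o shift x) (h *: v) - f x)) @ (0 : R)^' -->
    (\sum_k v ord0 k * partial f k x : R).
  apply/cvgrPdist_le => /= e e0.
  pose e' := e / (S + 1).
  have e'0 : 0 < e' by rewrite divr_gt0// ltr_wpDl.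
  have : \forall y \near x, forall k, derivable f y (basis_vector R k) /\
      `|partial f k y - partial f k x| <= e'.
    have nk k : \forall y \near x, `|partial f k x - partial f k y| <= e'.
      by move/cvgrPdist_le : (cp k); exact.
    have nk' : \forall y \near x, forall k, `|partial f k x - partial f k y| <= e'.
      exact: (@filter_forall _ _ (fun k y => `|partial f k x - partial f k y| <= e') (nbhs x) _ nk).
    near=> y => k; split; first by move: k; near: y.
    by rewrite distrC; move: k; near: y.
  move/nbhs_row_coords => [r r0 H].
  near=> h.
  have h0 : h != 0 by near: h; exact: nbhs_dnbhs_neq.
  have hr i : `|(h *: v) ord0 i| < r.
    rewrite mxE normrM.
    apply: (@le_lt_trans _ _ (`|h| * (S + 1))).
      rewrite ler_wpM2l// /S (bigD1 i)//= -addrA lerDl addr_ge0// sumr_ge0//.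
    rewrite -ltr_pdivlMr ?ltr_wpDl//.
    near: h; apply: dnbhs0_lt; rewrite divr_gt0// ltr_wpDl//.
  have := partial_increment H hr.
  rewrite /= [h *: v + x]addrC => K.
  rewrite distrC /GRing.scale /=.
  have -> : h^-1 * (f (x + h *: v) - f x) - \sum_k v ord0 k * partial f k x =
     h^-1 * (f (x + h *: v) - f x - \sum_i partial f i x * (h *: v) ord0 i).
    rewrite [RHS]mulrBr; congr (_ - _); rewrite mulr_sumr; apply: eq_bigr => k _.
    by rewrite mxE; field.
  rewrite normrM normfV ler_pdivrMl ?normr_gt0//.
  apply: le_trans K _.
  under eq_bigr do rewrite mxE normrM.
  rewrite -mulr_sumr -/S mulrCA ler_wpM2l// /e' mulrAC ler_pdivrMr ?ltr_wpDl//.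
  by rewrite ler_wpM2l ?lerDl// ltW.
apply: DeriveDef; first exact: cvgP cvgf.
exact: cvg_lim cvgf.
Unshelve. all: by end_near. Qed.

Lemma dotr_ge0 v : 0 <= dotr v v.
Proof. by rewrite dotrE; apply: sumr_ge0 => i _; rewrite -expr2 sqr_ge0. Qed.

Lemma sqr_enorm v : enorm v ^+ 2 = dotr v v.
Proof. by rewrite sqr_sqrtr// dotr_ge0. Qed.

Lemma ler_coord_enorm v i : `|v ord0 i| <= enorm v.
Proof.
rewrite -sqrtr_sqr ler_wsqrtr// dotrE (bigD1 i)//= -expr2 lerDl.
by apply: sumr_ge0 => j _; rewrite -expr2 sqr_ge0.
Qed.

Lemma sum_coord_le_enorm v : \sum_i `|v ord0 i| <= d%:R * enorm v.
Proof.
apply: (@le_trans _ _ (\sum_(i < d) enorm v)).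
  by apply: ler_sum => i _; exact: ler_coord_enorm.
by rewrite sumr_const card_ord -[leLHS]mulr_natl.
Qed.

Lemma hessian_formE f x v : (v *m hessian f x *m v^T) ord0 ord0 =
  \sum_k v ord0 k * \sum_j partial (partial f k) j x * v ord0 j.
Proof.
rewrite mxE; apply: eq_bigr => k _; rewrite !mxE mulrC; congr (_ * _).
by apply: eq_bigr => j _; rewrite mxE mulrC.
Qed.

(** For [psi t = f (x0 + t v) - t^2 q / 2] the derivative is the sum over [k] of [v_k] times the
    error of the linear approximation of the [k]-th partial derivative at [x0], where it vanishes.
    Each error is at most [e S] with [S] the sum of the [|v_i|], and the mean value theorem for
    [psi] between 0 and 1 gives [e S^2]. *)
Lemma taylor2 f x0 (delta : R) :
  twice_continuously_differentiable_near f x0 -> gradient f x0 = 0 -> 0 < delta ->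
  exists2 r : R, 0 < r & forall v, (forall i, `|v ord0 i| < r) ->
    `|f (x0 + v) - f x0 - 2^-1 * (v *m hessian f x0 *m v^T) ord0 ord0|
      <= delta * dotr v v.
Proof.
move=> fC2 grad0 delta0.
(* Since [S <= d |v|], this turns [e S^2] into at most [delta |v|^2]; adding 1 keeps the denominator
   positive for [d = 0]. *)
pose e := delta / (d%:R + 1) ^+ 2.
have e0 : 0 < e by rewrite divr_gt0// exprn_gt0// ltr_wpDl.
have p0 k : partial f k x0 = 0.
  by have := congr1 (fun w : 'rV[R]_d => w ord0 k) grad0; rewrite !mxE.
have nfC2 := nbhs_interior fC2.
have : \forall y \near x0, [/\ \forall z \near y, forall k, derivable f z (basis_vector R k),
   forall k, {for y, continuous (partial f k)} &
   forall k j, derivable (partial f k) y (basis_vector R j) /\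
     `|partial (partial f k) j y - partial (partial f k) j x0| <= e].
  have nk k j : \forall y \near x0, `|partial (partial f k) j x0 - partial (partial f k) j y| <= e.
    have [_ [_ /(_ k j) [_ cj]]] := nbhs_singleton fC2.
    by move/cvgrPdist_le : cj; exact.
  have nk' : \forall y \near x0, forall kj : 'I_d * 'I_d,
      `|partial (partial f kj.1) kj.2 x0 - partial (partial f kj.1) kj.2 y| <= e.
    exact: (@filter_forall _ _ (fun (kj : 'I_d * 'I_d) y =>
      `|partial (partial f kj.1) kj.2 x0 - partial (partial f kj.1) kj.2 y| <= e) (nbhs x0) _ (fun kj => nk kj.1 kj.2)).
  near=> y.
  have ny : (\forall z \near y, {for z, continuous f} /\
    (forall i, derivable f z (basis_vector R i) /\
       {for z, continuous (partial f i)}) /\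
    (forall i j, derivable (partial f i) z (basis_vector R j) /\
       {for z, continuous (partial (partial f i) j)})) by near: y; exact: nfC2.
  have [_ [py ppy]] := nbhs_singleton ny.
  split.
  - by apply: filterS ny => z [_ [H _]] k; have [] := H k.
  - by move=> k; have [] := py k.
  - move=> k j; split; first by have [] := ppy k j.
    have H : forall kj : 'I_d * 'I_d,
      `|partial (partial f kj.1) kj.2 x0 - partial (partial f kj.1) kj.2 y| <= e by near: y.
    by rewrite distrC; exact: (H (k, j)).
move=> /nbhs_row_coords[r r0 H]; exists r => // v vr.
set q := (v *m _ *m _) ord0 ord0.
pose S := \sum_i `|v ord0 i|.
have S0 : 0 <= S by apply: sumr_ge0.
have lin (t : R) : `|t| <= 1 -> forall i, `|(x0 + t *: v) ord0 i - x0 ord0 i| < r.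
  move=> t1 i; rewrite !mxE addrAC subrr add0r normrM.
  by apply: le_lt_trans (vr i); rewrite ler_piMl.
pose psi (t : R) := f (x0 + t *: v) - t ^+ 2 / 2 * q.
pose dpsi (t : R) := \sum_k v ord0 k * partial f k (x0 + t *: v) - t * q.
have := @MVT_abs psi dpsi 0 1 (e * S ^+ 2).
rewrite !subr0 normr1 mulr1 => K.
have {}K : `|psi 1 - psi 0| <= e * S ^+ 2.
  apply: K => t; rewrite subr0 => t1.
  - have [H1 H2 _] := H _ (lin _ t1).
    have [dv1 dv2] := is_derive_partial v H1 H2.
    have d1 : is_derive t (1 : R) (fun s : R => f (x0 + s *: v)) (\sum_k v ord0 k * partial f k (x0 + t *: v)).
      by have := derivable_line dv1; rewrite dv2.
    have d2 : is_derive t (1 : R) (fun t : R => t ^+ 2 / 2 * q) (t * q).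
      rewrite (_ : (fun _ => _) = (q / 2) *: ((@id R) ^+ 2)); last first.
        by apply/funext => s; rewrite exprfctE -[RHS]/(q / 2 * s ^+ 2); ring.
      by apply: is_derive_eq; rewrite /GRing.scale/= mulr1 expr1; field.
    exact: is_deriveB.
  - rewrite /dpsi.
    have -> : t * q = \sum_k v ord0 k * \sum_j partial (partial f k) j x0 * (t *: v) ord0 j.
      rewrite /q hessian_formE mulr_sumr; apply: eq_bigr => k _.
      rewrite mulrCA; congr (_ * _); rewrite mulr_sumr; apply: eq_bigr => j _.
      by rewrite mxE mulrCA.
    rewrite -sumrB; apply: le_trans (ler_norm_sum _ _ _) _.
    rewrite expr2 mulrCA mulr_suml; apply: ler_sum => k _.
    rewrite -mulrBr normrM ler_wpM2l//.
    have H' : forall y, (forall i, `|y ord0 i - x0 ord0 i| < r) -> forall j,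
      derivable (partial f k) y (basis_vector R j) /\ `|partial (partial f k) j y - partial (partial f k) j x0| <= e.
      by move=> y /H[_ _ h] j; exact: h.
    have tvr i : `|(t *: v) ord0 i| < r.
      by have := lin _ t1 i; rewrite !mxE addrAC subrr add0r.
    have := partial_increment H' tvr; rewrite p0 subr0.
    move=> /le_trans; apply; rewrite ler_wpM2l ?(ltW e0)//.
    by apply: ler_sum => j _; rewrite mxE normrM ler_piMl.
have -> : f (x0 + v) - f x0 - 2^-1 * q = psi 1 - psi 0.
  by rewrite /psi scale1r scale0r addr0 expr1n expr0n/= mul0r; ring.
apply: le_trans K _; rewrite /e -mulrA ler_wpM2l ?(ltW delta0)//.
rewrite ler_pdivrMl ?exprn_gt0 ?ltr_wpDl//.
apply: (@le_trans _ _ ((d%:R * enorm v) ^+ 2)).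
  by rewrite lerXn2r// ?nnegrE ?mulr_ge0 ?sqrtr_ge0//; exact: sum_coord_le_enorm.
rewrite exprMn sqr_enorm ler_wpM2r ?dotr_ge0// lerXn2r// ?nnegrE ?addr_ge0// lerDl//.
Unshelve. all: by end_near. Qed.

End taylor.

(** * Expansion of the density in short and narrow wedges *)

Section wedge_expansion.
Variables (R : realType) (d : nat).
Implicit Types (W : wedge R d.+1) (v u : 'rV[R]_d.+1) (H : 'M[R]_d.+1).

Lemma wedge_pythagoras W v : wf_wedge W ->
  dotr v v = dotr v (direction W) ^+ 2 +
    \sum_i dotr v (row i (wedge_basis W)) ^+ 2.
Proof.
move=> wfW.
pose Q : 'M[R]_d.+1 := col_mx (direction W) (wedge_basis W).
have QQ : Q *m Q^T = 1%:M := wedge_frame_orthogonal wfW.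
have : dotr v v = dotr (v *m Q^T) (v *m Q^T).
  by rewrite /dotr trmx_mul trmxK mulmxA -(mulmxA v) (mulmx1C QQ) mulmx1.
rewrite [X in _ = X -> _]dotrE big_ord_recl => ->.
rewrite wedge_frame0 -expr2; congr (_ + _); apply: eq_bigr => i _.
by rewrite wedge_frameS -expr2.
Qed.

Lemma wedge_coord_bound W x : wf_wedge W -> wedge_set W x ->
  let v := x - vertex W in
  dotr v v <= wproj W x ^+ 2 + d%:R * (tan (wedge_angle W) * wproj W x) ^+ 2.
Proof.
move=> wfW [_ Wx] /=; rewrite (wedge_pythagoras _ wfW) lerD2l.
apply: (@le_trans _ _ (\sum_(i < d) (tan (wedge_angle W) * wproj W x) ^+ 2)).
  by apply: ler_sum => i _; have /andP[h1 h2] := Wx i; nra.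
by rewrite sumr_const card_ord -[leLHS]mulr_natl.
Qed.

Lemma enorm_le v (b : R) : 0 <= b -> dotr v v <= b ^+ 2 -> enorm v <= b.
Proof. by move=> b0 h; rewrite -(ger0_norm b0) -sqrtr_sqr; exact: ler_wsqrtr. Qed.

Lemma bilinear_bound H v u :
  `|(v *m H *m u^T) ord0 ord0| <= (\sum_i \sum_j `|H i j|) * (enorm v * enorm u).
Proof.
rewrite mxE; under eq_bigr do rewrite !mxE mulr_suml.
rewrite exchange_big/= mulr_suml.
apply: le_trans (ler_norm_sum _ _ _) _; apply: ler_sum => i _.
rewrite mulr_suml; apply: le_trans (ler_norm_sum _ _ _) _; apply: ler_sum => j _.
rewrite !normrM mulrAC mulrC ler_wpM2l// ler_pM//; exact: ler_coord_enorm.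
Qed.

(** Write [x - x0 = t e + u] with [t] the height; then [|u| <= (d+1) T t] where [T] is the tangent
    of the angle. A small length brings [x] into the range of Taylor's formula, and a small angle
    makes the Hessian form at [x - x0] close to [t^2] times its value at [e]. *)
Lemma wedge_expansion (f : 'rV[R]_d.+1 -> R) x0 (delta : R) :
  twice_continuously_differentiable_near f x0 -> gradient f x0 = 0 -> 0 < delta ->
  exists2 rho : R, 0 < rho & forall W, wf_wedge W -> vertex W = x0 ->
    wedge_length W <= rho -> tan (wedge_angle W) <= rho ->
    forall x, wedge_set W x ->
    `|f x - f x0 - 2^-1 * (direction W *m hessian f x0 *m (direction W)^T) ord0 ord0
        * wproj W x ^+ 2| <= delta * wproj W x ^+ 2.
Proof.
move=> fC2 grad0 delta0.
set H := hessian f x0.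
pose C := \sum_i \sum_j `|H i j|.
have C0 : 0 <= C by apply: sumr_ge0 => i _; apply: sumr_ge0.
have d1 : 0 < (d%:R + 1 : R) by rewrite ltr_wpDl.
have delta'0 : 0 < delta / (2 * (d%:R + 1)) by rewrite divr_gt0// mulr_gt0.
have [r r0 taylor] := taylor2 fC2 grad0 delta'0.
have D0 : 0 < 3 * C * (d%:R + 1) + 1 by rewrite ltr_wpDl// !mulr_ge0// ltW.
(* The bound 1 gives [T <= 1]; the second one gives [|v| <= (d+1) t < r]; the third one controls the
   three terms of the quadratic form that contain [u], each at most [C (d+1) T t^2]. Half of [delta]
   goes to these terms and half to the Taylor remainder, as [|v|^2 <= (d+1) t^2]. *)
pose rho := Num.min 1 (Num.min (r / (d%:R + 2)) (delta / (3 * C * (d%:R + 1) + 1))).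
have rho0 : 0 < rho by rewrite /rho !lt_min ltr01 !divr_gt0// ltr_wpDl.
exists rho => // W wfW Wx0 Lrho; set T := tan _ => Trho x Wx.
have T0 : 0 < T := tan_wedge_angle_gt0 wfW.
have [We _ _ _ _] := wfW.
set e := direction W; set t := wproj W x.
have [/andP[t0 tL] _] := Wx; rewrite -/t in t0 tL.
have T1 : T <= 1 by rewrite (le_trans Trho)// /rho ge_min lexx.
have rho_r : rho <= r / (d%:R + 2) by rewrite /rho !ge_min lexx orbT.
have rho_d : rho <= delta / (3 * C * (d%:R + 1) + 1) by rewrite /rho !ge_min lexx !orbT.
pose v := x - x0; pose u := v - t *: e.
have vE : v = t *: e + u by rewrite /u addrC subrK.
have vv : dotr v v <= t ^+ 2 + d%:R * (T * t) ^+ 2.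
  by have := wedge_coord_bound wfW Wx; rewrite /= Wx0.
have Tt0 : 0 < T * t by rewrite mulr_gt0.
have ve : dotr v e = t by rewrite /t /wproj Wx0.
have ee : dotr e e = 1 by rewrite -sqr_enorm We expr1n.
have uu : dotr u u <= d%:R * (T * t) ^+ 2.
  suff -> : dotr u u = dotr v v - t ^+ 2 by rewrite lerBlDl.
  have dotB (a b c : 'rV[R]_d.+1) : dotr (a - b) c = dotr a c - dotr b c.
    by rewrite /dotr mulmxBl !mxE.
  have dotC (a b : 'rV[R]_d.+1) : dotr a b = dotr b a.
    by rewrite !dotrE; apply: eq_bigr => i _; rewrite mulrC.
  have dotZ (k : R) (a b : 'rV[R]_d.+1) : dotr (k *: a) b = k * dotr a b.
    by rewrite /dotr -scalemxAl mxE.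
  have dotBr (a b c0 : 'rV[R]_d.+1) : dotr c0 (a - b) = dotr c0 a - dotr c0 b.
    by rewrite dotC dotB !(dotC c0).
  have dotZr (k : R) (a b : 'rV[R]_d.+1) : dotr a (k *: b) = k * dotr a b.
    by rewrite dotC dotZ (dotC b).
  have dotq (k : R) (a b : 'rV[R]_d.+1) :
      dotr (a - k *: b) (a - k *: b) = dotr a a - 2 * k * dotr a b + k ^+ 2 * dotr b b.
    by rewrite dotB !dotBr !dotZ !dotZr (dotC b a); ring.
  by rewrite /u dotq ve ee; ring.
have dT : d%:R * (T * t) ^+ 2 <= d%:R * t ^+ 2.
  by rewrite ler_wpM2l// lerXn2r ?nnegrE ?(ltW t0) ?(ltW Tt0)// ger_pMl.
have nu : enorm u <= (d%:R + 1) * (T * t).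
  apply: enorm_le; first by rewrite mulr_ge0// ltW.
  apply: le_trans uu _; rewrite [leRHS]exprMn ler_wpM2r ?sqr_ge0//.
  by have : 0 <= (d%:R : R) by []; nra.
have nv : enorm v <= (d%:R + 1) * t.
  apply: enorm_le; first by rewrite mulr_ge0// ltW.
  apply: le_trans vv _; apply: (@le_trans _ _ (t ^+ 2 + d%:R * t ^+ 2)); first by rewrite lerD2l.
  rewrite [leRHS]exprMn -[X in X + _]mul1r -mulrDl ler_wpM2r ?sqr_ge0//.
  by have : 0 <= (d%:R : R) by []; nra.
have vr i : `|v ord0 i| < r.
  apply: le_lt_trans (ler_coord_enorm v i) _; apply: le_lt_trans nv _.
  apply: (@le_lt_trans _ _ ((d%:R + 1) * (r / (d%:R + 2)))).
    by rewrite ler_wpM2l ?(ltW d1)// (le_trans tL)// (le_trans Lrho).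
  rewrite mulrCA gtr_pMr// ltr_pdivrMr ?mul1r ?ltrD2l ?ltr1n// ltr_wpDl//.
have tay := taylor v vr; rewrite (_ : x0 + v = x) -?/H in tay; last by rewrite /v addrC subrK.
set qe := (e *m H *m e^T) ord0 ord0.
have quad : `|(v *m H *m v^T) ord0 ord0 - qe * t ^+ 2| <= delta * t ^+ 2.
  have -> : (v *m H *m v^T) ord0 ord0 - qe * t ^+ 2 =
      (u *m H *m u^T) ord0 ord0 + (t * (u *m H *m e^T) ord0 ord0 + t * (e *m H *m u^T) ord0 ord0).
    rewrite vE linearD/= linearZ/= !(mulmxDl, mulmxDr) -!(scalemxAl, scalemxAr) /qe.
    rewrite !mxE; ring.
  apply: (@le_trans _ _ (C * (enorm u * enorm u) + (t * (C * enorm u) + t * (C * enorm u)))).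
    apply: le_trans (ler_normD _ _) _; apply: lerD; first exact: bilinear_bound.
    apply: le_trans (ler_normD _ _) _; apply: lerD; rewrite normrM gtr0_norm// ler_wpM2l ?(ltW t0)//.
      by have := bilinear_bound H u e; rewrite We mulr1.
    by have := bilinear_bound H e u; rewrite We mul1r.
  have nu0 : 0 <= enorm u by exact: sqrtr_ge0.
  have nuu : enorm u * enorm u <= (d%:R + 1) * T * t ^+ 2.
    rewrite -expr2 sqr_enorm; apply: le_trans uu _.
    rewrite exprMn mulrA ler_wpM2r ?sqr_ge0//.
    have : T ^+ 2 <= T by rewrite expr2 ger_pMl.
    by have : 0 <= (d%:R : R) by []; nra.
  apply: (@le_trans _ _ (C * ((d%:R + 1) * T * t ^+ 2) + (t * (C * ((d%:R + 1) * (T * t))) + t * (C * ((d%:R + 1) * (T * t)))))).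
    apply: lerD; first by rewrite ler_wpM2l.
    by apply: lerD; rewrite ler_wpM2l ?(ltW t0)// ler_wpM2l.
  rewrite (_ : _ + _ = (3 * C * (d%:R + 1) * T) * t ^+ 2); last by ring.
  rewrite ler_wpM2r ?sqr_ge0//.
  have := le_trans Trho rho_d; rewrite ler_pdivlMr// => h.
  by nra.
have -> : f x - f x0 - 2^-1 * qe * t ^+ 2 =
  (f x - f x0 - 2^-1 * (v *m H *m v^T) ord0 ord0) + 2^-1 * ((v *m H *m v^T) ord0 ord0 - qe * t ^+ 2) by ring.
apply: le_trans (ler_normD _ _) _.
rewrite (_ : delta * t ^+ 2 = delta / 2 * t ^+ 2 + 2^-1 * (delta * t ^+ 2)); last by field.
apply: lerD; last by rewrite normrM gtr0_norm ?invr_gt0// ler_wpM2l.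
apply: le_trans tay _.
apply: (@le_trans _ _ (delta / (2 * (d%:R + 1)) * (t ^+ 2 + d%:R * t ^+ 2))).
  rewrite ler_wpM2l ?(ltW delta'0)//; apply: le_trans vv _; by rewrite lerD2l.
rewrite le_eqVlt; apply/orP; left; apply/eqP; field.
by rewrite gt_eqF.
Qed.

End wedge_expansion.

(** * The statistics as sums over the sample *)

Section statistics.
Variables (R : realType) (d : nat).
Implicit Types (W : wedge R d) (s : seq 'rV[R]_d).

(** Replaces the height of the last element of a sorted list by a maximum, whose measurability in
    the sample follows by recursion. The default 0 lies below the height of every point of the
    wedge. *)
Definition max_proj W s : R :=
  \big[Num.max/0]_(x <- s | `[< wedge_set W x >]) wproj W x.

Lemma perm_ordered_obs W s :
  perm_eq (ordered_obs W s) [seq x <- s | `[< wedge_set W x >]].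
Proof. by rewrite /ordered_obs perm_sort. Qed.

Lemma mem_ordered_obs W s x :
  (x \in ordered_obs W s) = (x \in s) && `[< wedge_set W x >].
Proof. by rewrite (perm_mem (perm_ordered_obs W s)) mem_filter andbC. Qed.

Lemma nobs_count W s : nobs W s = count (fun x => `[< wedge_set W x >]) s.
Proof. by rewrite /nobs (perm_size (perm_ordered_obs W s)) size_filter. Qed.

Lemma last_proj_mem W s : (0 < nobs W s)%N ->
  exists2 x, x \in s & wedge_set W x /\ last_proj W s = wproj W x.
Proof.
move=> N0; exists (nth 0 (ordered_obs W s) (nobs W s).-1).
  have : nth 0 (ordered_obs W s) (nobs W s).-1 \in ordered_obs W s.
    by apply: mem_nth; rewrite ltn_predL.
  by rewrite mem_ordered_obs => /andP[].
split=> //.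
have : nth 0 (ordered_obs W s) (nobs W s).-1 \in ordered_obs W s.
  by apply: mem_nth; rewrite ltn_predL.
by rewrite mem_ordered_obs => /andP[_ /asboolP].
Qed.

Lemma last_proj_ge W s x : x \in s -> wedge_set W x ->
  wproj W x <= last_proj W s.
Proof.
move=> xs Kx.
have xo : x \in ordered_obs W s by rewrite mem_ordered_obs xs; exact/asboolP.
have srt : sorted (fun x y => wproj W x <= wproj W y) (ordered_obs W s).
  by apply: sort_sorted => a b; exact: le_total.
have ltr : transitive (fun x y => wproj W x <= wproj W y).
  by move=> b a c'; exact: le_trans.
rewrite -{1}(nth_index 0 xo) /last_proj /obs_proj.
have ix : (index x (ordered_obs W s) < nobs W s)%N by rewrite index_mem.
apply: (sorted_leq_nth ltr (fun a => lexx _) 0 srt); rewrite ?inE//.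
  by rewrite ltn_predL; exact: leq_ltn_trans ix.
by rewrite -ltnS (ltn_predK ix).
Qed.

Lemma last_proj_gt0 W s : (0 < nobs W s)%N -> 0 < last_proj W s.
Proof. by move=> /last_proj_mem[x _ [[/andP[h _] _] ->]]. Qed.

Lemma max_proj_ge W s x : x \in s -> wedge_set W x -> wproj W x <= max_proj W s.
Proof.
move=> xs Kx; elim: s xs => // y s IHs; rewrite inE /max_proj big_cons.
move=> /orP[/eqP <-|xs]; first by rewrite asboolT// le_max lexx.
by case: ifP => _; rewrite ?le_max IHs ?orbT.
Qed.

Lemma max_proj_le W s (b : R) : 0 <= b ->
  (forall x, x \in s -> wedge_set W x -> wproj W x <= b) -> max_proj W s <= b.
Proof.
move=> b0; elim: s => [|y s IHs] H; first by rewrite /max_proj big_nil.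
have {}IHs : max_proj W s <= b by apply: IHs => x xs; apply: H; rewrite inE xs orbT.
rewrite /max_proj big_cons; case: ifP => [/asboolP Ky|_]; last exact: IHs.
by rewrite ge_max IHs andbT; apply: H; rewrite ?mem_head.
Qed.

Lemma last_projE W s : (0 < nobs W s)%N -> last_proj W s = max_proj W s.
Proof.
move=> N0; apply/eqP; rewrite eq_le; apply/andP; split.
  by have [x xs [Kx ->]] := last_proj_mem N0; exact: max_proj_ge.
apply: max_proj_le; first exact/ltW/last_proj_gt0.
by move=> x; exact: last_proj_ge.
Qed.

(** The statistics omit the last observation, whereas sums of independent scores run over all of
    them; the two agree because [beta], being 0 outside the open unit interval, vanishes at 1. *)
Lemma sum_ordered_obs W s (G : 'rV[R]_d -> R) :
  ((0 < nobs W s)%N -> G (nth 0 (ordered_obs W s) (nobs W s).-1) = 0) ->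
  \sum_(j < (nobs W s).-1) G (nth 0 (ordered_obs W s) j) =
  \sum_(x <- s | `[< wedge_set W x >]) G x.
Proof.
move=> Glast.
transitivity (\sum_(x <- ordered_obs W s) G x); last first.
  by rewrite (perm_big _ (perm_ordered_obs W s))/= big_filter.
rewrite (big_nth 0) big_mkord -/(nobs W s).
case: (posnP (nobs W s)) => [->|N0]; first by rewrite !big_ord0.
have := Glast N0; move: N0; case: (nobs W s) => // N _ /= GN.
by rewrite big_ord_recr/= GN addr0.
Qed.

Lemma beta1 : beta (1 : R) = 0.
Proof. by rewrite /beta in_itv/= ltxx andbF mulr0. Qed.

Lemma beta0 : beta (0 : R) = 0.
Proof. by rewrite /beta in_itv/= ltxx mulr0. Qed.

Lemma beta_le (z : R) : 0 < z -> z <= 1 -> beta z <= 2 * z - 1.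
Proof.
move=> z0 z1; rewrite /beta in_itv/= z0/=.
by case: ltP => [_|h]; [rewrite mulr1|rewrite mulr0 subr_ge0; lra].
Qed.

Lemma T_statE W s : T_stat W s =
  \sum_(x <- s | `[< wedge_set W x >]) beta (wproj W x ^+ d / max_proj W s ^+ d).
Proof.
have [N0|N0] := posnP (nobs W s).
  rewrite /T_stat N0 big_ord0 big_seq_cond big_pred0// => x.
  apply/negbTE/negP => /andP[xs Kx].
  move: N0; rewrite nobs_count => /eqP; apply/negP; rewrite -lt0n -has_count.
  by apply/hasP; exists x.
rewrite -(last_projE N0) -(sum_ordered_obs (G := fun x =>
  beta (wproj W x ^+ d / last_proj W s ^+ d)))//.
move=> _; rewrite -/(obs_proj W s (nobs W s).-1) -/(last_proj W s) divff ?beta1//.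
by rewrite expf_neq0// gt_eqF// last_proj_gt0.
Qed.

Lemma TU_statE (mu : set 'rV[R]_d -> \bar R) W s : TU_stat mu W s =
  \sum_(x <- s | `[< wedge_set W x >])
    beta (fine (mu (wedge_trunc W (wproj W x))) / fine (mu (wedge_trunc W (max_proj W s)))).
Proof.
have [N0|N0] := posnP (nobs W s).
  rewrite /TU_stat N0 big_ord0 big_seq_cond big_pred0// => x.
  apply/negbTE/negP => /andP[xs Kx].
  move: N0; rewrite nobs_count => /eqP; apply/negP; rewrite -lt0n -has_count.
  by apply/hasP; exists x.
rewrite -(last_projE N0).
transitivity (\sum_(j < (nobs W s).-1)
    beta (fine (mu (wedge_trunc W (obs_proj W s j))) / fine (mu (wedge_trunc W (last_proj W s))))).
  apply: eq_bigr => j _; congr beta; rewrite /Ftilde /cond_prob; congr (fine (mu _) / _).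
  have jN : (j < nobs W s)%N by apply: leq_trans (ltn_ord j) (leq_pred _).
  have := mem_nth 0 jN; rewrite mem_ordered_obs => /andP[js /asboolP jK].
  have jr : obs_proj W s j <= last_proj W s by exact: last_proj_ge.
  apply/seteqP; split => x /=; rewrite /wedge_trunc /=.
    by move=> [h1 [h2 /andP[h3 h4]]]; split => //; rewrite h3.
  move=> [h1 /andP[h2 h3]]; split => //; split => //.
  by rewrite h2 (le_trans h3).
rewrite -(sum_ordered_obs (G := fun x =>
  beta (fine (mu (wedge_trunc W (wproj W x))) / fine (mu (wedge_trunc W (last_proj W s))))))//.
move=> _; rewrite -/(obs_proj W s (nobs W s).-1) -/(last_proj W s).
(* If the truncated wedge has mass 0, the quotient for the last observation is 0 by convention, and
   [beta] vanishes there as well. *)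
set a := fine _; have [->|a0] := eqVneq a 0; first by rewrite mul0r beta0.
by rewrite divff// beta1.
Qed.

End statistics.

(** * The law of an observation in a wedge *)

Lemma bernoulli_lower (R : realType) (x : R) n : 0 <= x <= 1 ->
  1 - n%:R * x <= (1 - x) ^+ n.
Proof.
move=> /andP[x0 x1]; elim: n => [|n IHn]; first by rewrite mul0r subr0 expr0.
have z0 : 0 <= 1 - x by lra.
rewrite exprS -natr1; have : 0 <= (n%:R : R) by [].
by have := ler_wpM2l z0 IHn; nra.
Qed.

Section rank.
Local Open Scope ereal_scope.
Context (R : realType) d (T : measurableType d) (mu : probability T R).
Variables (K : set T) (h : T -> R).
Hypotheses (mK : measurable K) (mh : measurable_fun setT h).

Lemma measurable_lt_pair :
  measurable [set z : T * T | (h z.1 < h z.2)%R].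
Proof.
have m1 : measurable_fun setT (fun z : T * T => (h z.2 - h z.1)%R).
  apply: measurable_funB; apply: (measurableT_comp mh).
    exact: measurable_snd.
  exact: measurable_fst.
rewrite (_ : [set _ | _] = [set z : T * T | (0 < h z.2 - h z.1)%R]).
  exact: measurable_set_gt.
by apply/seteqP; split => z /=; rewrite subr_gt0.
Qed.

(* Of two independent draws from [K], at most one exceeds the other. *)
Lemma integral_rank_le :
  \int[mu]_x ((\1_K x)%:E * mu (K `&` [set y | (h x < h y)%R])) +
  \int[mu]_x ((\1_K x)%:E * mu (K `&` [set y | (h x < h y)%R])) <= mu K * mu K.
Proof.
pose H (z : T * T) : R := (\1_K z.1 * (\1_K z.2 * \1_[set z : T * T | (h z.1 < h z.2)%R] z))%R.
have m1K (T' : measurableType _) (phi : T' -> T) : measurable_fun setT phi ->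
    measurable_fun setT (fun z => \1_K (phi z) : R).
  by move=> mphi; apply: (measurableT_comp _ mphi); exact: measurable_indic.
have mH : measurable_fun setT (fun z => (H z)%:E).
  apply/measurable_EFinP; apply: measurable_funM; first exact: m1K.
  apply: measurable_funM; first exact: m1K.
  by apply: measurable_indic; exact: measurable_lt_pair.
have muE A : measurable A -> mu A = \int[mu]_x (\1_A x)%:E.
  by move=> mA; rewrite integral_indic// setIT.
have H0 z : (0 <= H z)%R by rewrite !mulr_ge0.
set I := \int[mu]_x _.
have mx x : measurable [set y | (h x < h y)%R] by exact: measurable_set_gt.
have IE : I = \int[mu]_x \int[mu]_y (H (x, y))%:E.
  apply: eq_integral => x _.
  under eq_integral do rewrite EFinM /=.
  rewrite ge0_integralZl_EFin//; last first.
    apply/measurable_EFinP; apply: measurable_funM; first exact: measurable_indic.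
    rewrite (_ : (fun y : T => _) = \1_[set y | (h x < h y)%R]); first exact: measurable_indic.
    by apply/funext => y; rewrite !indicE; congr (_%:R); congr nat_of_bool; apply/idP/idP => /set_mem ?; exact/mem_set.
  congr (_ * _); rewrite muE; last exact: measurableI.
  apply: eq_integral => y _; congr EFin; rewrite indicI; congr (_ * _)%R.
have IE' : I = \int[mu]_x \int[mu]_y (H (y, x))%:E.
  rewrite IE; apply: (fubini_tonelli (m1 := mu) (m2 := mu) (fun z => (H z)%:E) mH).
  by move=> z; rewrite lee_fin.
have mH' : measurable_fun setT (fun z : T * T => (H (z.2, z.1))%:E).
  apply: (measurableT_comp mH); apply: measurable_fun_pair; [exact: measurable_snd|exact: measurable_fst].
have mF := measurable_fun_fubini_tonelli_F _ mH (fun z => H0 z).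
have mF' := measurable_fun_fubini_tonelli_F _ mH' (fun z => H0 _).
have J0 : forall x, setT x -> 0 <= \int[mu]_y (H (x, y))%:E.
  by move=> x _; apply: integral_ge0 => y _; rewrite lee_fin.
have J0' : forall x, setT x -> 0 <= \int[mu]_y (H (y, x))%:E.
  by move=> x _; apply: integral_ge0 => y _; rewrite lee_fin.
rewrite [X in X + _]IE IE' -(ge0_integralD mu measurableT J0 (mF mu) J0' (mF' mu)).
apply: (@le_trans _ _ (\int[mu]_x ((\1_K x)%:E * mu K))).
  apply: ge0_le_integral => //.
  - by move=> x _; apply: adde_ge0; [exact: J0|exact: J0'].
  - exact: (emeasurable_funD (mF mu) (mF' mu)).
  - apply: emeasurable_funM => //; apply/measurable_EFinP; exact: measurable_indic.
  move=> x _; rewrite -ge0_integralD//; last 4 first.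
  - by move=> y _; rewrite lee_fin.
  - exact: (measurable_fun_pair2 _ mH).
  - by move=> y _; rewrite lee_fin.
  - exact: (measurable_fun_pair2 _ mH').
  rewrite [in leRHS](muE _ mK).
  rewrite -ge0_integralZl_EFin//; last by apply/measurable_EFinP; exact: measurable_indic.
  apply: ge0_le_integral => //.
  - by move=> y _; rewrite lee_fin addr_ge0.
  - apply: emeasurable_funD; first exact: (measurable_fun_pair2 _ mH).
    exact: (measurable_fun_pair2 _ mH').
  - by apply: emeasurable_funM => //; apply/measurable_EFinP; exact: measurable_indic.
  move=> y _; rewrite -EFinD -EFinM lee_fin /H /=.
  set S := [set z : T * T | (h z.1 < h z.2)%R].
  have S1 : (\1_S (x, y) + \1_S (y, x) <= 1 :> R)%R.
    rewrite !indicE; case: (boolP ((x, y) \in S)) => [/set_mem/= xy|_].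
      by rewrite memNset ?addr0//= => yx; have := lt_trans xy yx; rewrite ltxx.
    by rewrite add0r; case: (_ \in _).
  rewrite (_ : _ + _ = \1_K x * \1_K y * (\1_S (x, y) + \1_S (y, x)))%R; last by ring.
  by rewrite ler_piMr// mulr_ge0.
rewrite ge0_integralZr//; last by apply/measurable_EFinP; exact: measurable_indic.
by rewrite integral_indic// setIT.
Qed.

End rank.

Section law.
Local Open Scope ereal_scope.
Context (R : realType) (d : nat) dO (Omega : measurableType dO)
  (P : probability Omega R) (Y : {RV P >-> 'rV[R]_d}) (f : 'rV[R]_d -> R).
Hypothesis Yf : has_density Y f.

Lemma density_law_ge0 A : 0 <= density_law f A.
Proof. by have [_ f0 _] := Yf; apply: integral_ge0 => x _; rewrite lee_fin. Qed.

Lemma distribution_density A : measurable A -> distribution P Y A = density_law f A.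
Proof. by have [_ _ H] := Yf; exact: H. Qed.

Lemma density_law_fin A : measurable A -> density_law f A \is a fin_num.
Proof. by move=> mA; rewrite -distribution_density// fin_num_measure. Qed.

Lemma expectation_density (h : 'rV[R]_d -> R) : measurable_fun setT h ->
  (forall x, (0 <= h x)%R) ->
  \int[P]_omega (h (Y omega))%:E = \int[lebesgue_row R d]_x (h x * f x)%:E.
Proof.
move=> mh h0; have [mf f0 H] := Yf.
have mhE : measurable_fun setT (EFin \o h) by exact/measurable_EFinP.
have h0E x : 0 <= (EFin \o h) x by rewrite lee_fin.
rewrite -(ge0_integral_distribution Y mhE h0E).
apply: (ge0_integral_transport (m := lebesgue_row R d) (nu := distribution P Y)
  (phi := id) _ mf f0 _ mh h0) => //.
Qed.

Lemma expectation_density_in (K : set 'rV[R]_d) (h : 'rV[R]_d -> R) :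
  measurable K -> measurable_fun setT h -> (forall x, K x -> (0 <= h x)%R) ->
  \int[P]_omega (\1_K (Y omega) * h (Y omega))%:E =
  \int[lebesgue_row R d]_(x in K) (h x * f x)%:E.
Proof.
move=> mK mh h0.
rewrite (expectation_density (h := fun x => (\1_K x * h x)%R)).
- rewrite [RHS]integral_mkcond; apply: eq_integral => x _; rewrite epatch_indic/= -EFinM.
  by congr EFin; ring.
- by apply: measurable_funM => //; exact: measurable_indic.
- move=> x; rewrite indicE; case: (boolP (x \in K)) => [/set_mem/h0|_]; rewrite ?mul1r ?mul0r//.
Qed.

End law.

Section wedge_law.
Local Open Scope ereal_scope.
Context (R : realType) (d : nat) dO (Omega : measurableType dO)
  (P : probability Omega R) (Y : {RV P >-> 'rV[R]_d.+1}) (f : 'rV[R]_d.+1 -> R).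
Hypothesis Yf : has_density Y f.
Variables (W : wedge R d.+1) (f0 : R).
Hypotheses (wfW : wf_wedge W) (f0_gt0 : (0 < f0)%R).
Hypothesis fK : forall x, wedge_set W x -> (`|f x - f0| <= f0 / 2)%R.

Let K := wedge_set W.
Let L := wedge_length W.
Let tau : R := ((2 * tan (wedge_angle W)) ^+ d)%R.
(** The integral of the [k]-th power of the height over the wedge: the section at height [t] has
    volume [tau t^d]. *)
Let J (k : nat) : R := (tau * L ^+ (k + d.+1) / (k + d.+1)%:R)%R.
Let lam := lebesgue_row R d.+1.

Definition wedge_volume : R := (tau * L ^+ d.+1 / d.+1%:R)%R.
Let V := wedge_volume.

Let L0 : (0 < L)%R. Proof. by have [] := wfW. Qed.
Let tau0 : (0 < tau)%R.
Proof. by rewrite exprn_gt0// mulr_gt0// tan_wedge_angle_gt0. Qed.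
Let mK : measurable K := measurable_wedge_set W.
Let mw : measurable_fun setT (wproj W) := measurable_wproj W.

Lemma wedge_volume_gt0 : (0 < V)%R.
Proof. by rewrite divr_gt0// mulr_gt0// exprn_gt0. Qed.

Lemma integral_wedge_monomial (a : R) k : (0 <= a)%R ->
  \int[lam]_(x in K) (a * wproj W x ^+ k)%:E = (a * J k)%:E.
Proof.
move=> a0; under eq_integral do rewrite EFinM.
rewrite ge0_integralZl_EFin//.
- by rewrite ge0_integral_wedge_pow.
- by move=> x [/andP[x0 _] _]; rewrite lee_fin exprn_ge0// ltW.
- by apply/measurable_EFinP; apply: measurable_funTS; exact: measurable_funX.
Qed.

Lemma integral_wedge_binomial (a b : R) k l : (0 <= a)%R -> (0 <= b)%R ->
  \int[lam]_(x in K) (a * wproj W x ^+ k + b * wproj W x ^+ l)%:E =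
  (a * J k + b * J l)%:E.
Proof.
move=> a0 b0; under eq_integral do rewrite EFinD.
rewrite ge0_integralD//.
- by rewrite !integral_wedge_monomial.
- by move=> x [/andP[x0 _] _]; rewrite lee_fin mulr_ge0// exprn_ge0// ltW.
- by apply/measurable_EFinP; apply: measurable_funTS; apply: measurable_funM => //; exact: measurable_funX.
- by move=> x [/andP[x0 _] _]; rewrite lee_fin mulr_ge0// exprn_ge0// ltW.
- by apply/measurable_EFinP; apply: measurable_funTS; apply: measurable_funM => //; exact: measurable_funX.
Qed.

Lemma lebesgue_wedge : lam K = V%:E.
Proof.
have := @integral_wedge_monomial 1%R 0 ler01.
under eq_integral do rewrite expr0 mulr1.
by rewrite integral_cst// mul1e mul1r.
Qed.

Lemma measurable_wedge_trunc r : measurable (wedge_trunc W r).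
Proof.
apply: measurableI => //.
rewrite (_ : [set _ | _] = [set x | (0 < wproj W x)%R] `&` [set x | (wproj W x <= r)%R]).
  by apply: measurableI; [exact: measurable_set_gt|exact: measurable_set_le].
by apply/seteqP; split => x /=; [move=> /andP[]|move=> [-> ->]].
Qed.

Lemma lebesgue_wedge_trunc r : (0 < r <= L)%R ->
  lam (wedge_trunc W r) = (tau * r ^+ d.+1 / d.+1%:R)%:E.
Proof.
move=> /andP[r0 rL].
pose W' := Wedge (vertex W) (direction W) (wedge_basis W) r (wedge_angle W).
have wfW' : wf_wedge W' by have [h1 h2 h3 h4 h5] := wfW; split.
have -> : wedge_trunc W r = wedge_set W'.
  apply/seteqP; split => x; rewrite /wedge_trunc /wedge_set /= -/(wproj W x).
    by move=> [[_ h] h'].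
  move=> [/andP[h1 h2] h]; rewrite -/(wproj W x) in h1 h2; split; last by rewrite h1.
  by split => //; rewrite h1 (le_trans h2).
have := ge0_integral_wedge_pow wfW' 0.
under eq_integral do rewrite expr0.
by rewrite integral_cst ?mul1e//; exact: measurable_wedge_set.
Qed.

Lemma density_law_lebesgue A : measurable A -> A `<=` K ->
  (f0 / 2)%:E * lam A <= density_law f A <= (3 / 2 * f0)%:E * lam A.
Proof.
move=> mA AK; have [mf fge0 _] := Yf.
rewrite -!(integral_cst lam mA); apply/andP; split; apply: ge0_le_integral => //.
- by move=> x _; rewrite lee_fin divr_ge0// ltW.
- by apply/measurable_EFinP; exact: measurable_funTS.
- by move=> x /AK/fK; rewrite lee_fin ler_distl => /andP[h _]; lra.
- by move=> x _; rewrite lee_fin.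
- by apply/measurable_EFinP; exact: measurable_funTS.
- by move=> x /AK/fK; rewrite lee_fin ler_distl => /andP[_ h]; lra.
Qed.

Definition wedge_mass (A : set 'rV[R]_d.+1) : R := fine (density_law f A).

Lemma wedge_massE A : measurable A -> P (Y @^-1` A) = (wedge_mass A)%:E.
Proof. by move=> mA; have [_ _ H] := Yf; rewrite H// fineK//; exact: density_law_fin Yf _ mA. Qed.

Lemma wedge_mass_lebesgue A v : measurable A -> A `<=` K -> lam A = v%:E ->
  (f0 / 2 * v <= wedge_mass A <= 3 / 2 * f0 * v)%R.
Proof.
move=> mA AK Av; have := density_law_lebesgue mA AK.
by rewrite Av -(fineK (density_law_fin Yf mA)) -!EFinM !lee_fin.
Qed.

Lemma wedge_mass_bounds : (f0 / 2 * V <= wedge_mass K <= 3 / 2 * f0 * V)%R.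
Proof. exact: wedge_mass_lebesgue mK _ lebesgue_wedge. Qed.

Definition slab (eta : R) : set 'rV[R]_d.+1 := K `&` [set x | ((1 - eta) * L <= wproj W x)%R].

Lemma measurable_slab eta : measurable (slab eta).
Proof. by apply: measurableI => //; exact: measurable_set_ge. Qed.

Lemma slab_mass (eta : R) : (0 < eta)%R -> (2 * eta < 1)%R ->
  (f0 / 2 * (V * eta) <= wedge_mass (slab eta) <= 3 / 2 * f0 * (V * (2 * d.+1%:R * eta)))%R.
Proof.
move=> eta0 eta1.
have mS := measurable_slab eta.
have V0 := wedge_volume_gt0.
have Slam : lam (slab eta) \is a fin_num.
  rewrite ge0_fin_numE//; apply: (@le_lt_trans _ _ (lam K)).
    by apply: le_measure; rewrite ?inE//; exact: subIsetl.
  by rewrite lebesgue_wedge ltry.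
have trE a : (0 < a < 1)%R -> lam (wedge_trunc W (a * L)) = (V * a ^+ d.+1)%:E.
  move=> /andP[a0 a1]; rewrite lebesgue_wedge_trunc; last first.
    by rewrite mulr_gt0//= ger_pMl// ltW.
  by congr EFin; rewrite /V /wedge_volume exprMn; ring.
have mT a := measurable_wedge_trunc a.
have up : (fine (lam (slab eta)) <= V * (2 * d.+1%:R * eta))%R.
  (* The level [(1 - eta) L] belongs both to the slab and to the wedge truncated there. Truncating
     at [(1 - 2 eta) L] makes the sets disjoint, at the cost of the factor 2 in the upper bound. *)
  have disj : wedge_trunc W ((1 - 2 * eta) * L) `&` slab eta = set0.
    rewrite -subset0 => x [[_ /= /andP[_ h1]] [_ /= h2]].
    have := le_trans h2 h1; rewrite ler_pM2r//; lra.
  have : lam (wedge_trunc W ((1 - 2 * eta) * L) `|` slab eta) <= lam K.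
    apply: le_measure; rewrite ?inE//; first exact: measurableU.
    by move=> y [[]|[]].
  have -> : lam (wedge_trunc W ((1 - 2 * eta) * L) `|` slab eta) =
    lam (wedge_trunc W ((1 - 2 * eta) * L)) + lam (slab eta) by rewrite measureU.
  rewrite lebesgue_wedge trE; last by lra.
  rewrite -(fineK Slam) -EFinD lee_fin => h.
  have bern : (1 - d.+1%:R * (2 * eta) <= (1 - 2 * eta) ^+ d.+1)%R.
    by apply: bernoulli_lower; lra.
  have : (V * (1 - d.+1%:R * (2 * eta)) <= V * (1 - 2 * eta) ^+ d.+1)%R by rewrite ler_pM2l.
  nra.
have lo : (V * eta <= fine (lam (slab eta)))%R.
  have : lam K <= lam (wedge_trunc W ((1 - eta) * L) `|` slab eta).
    apply: le_measure; rewrite ?inE//; first exact: measurableU.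
    move=> x Kx; have [h|h] := leP (wproj W x) ((1 - eta) * L)%R; last by right; split => //; exact: ltW.
    left; split => //=; rewrite h andbT.
    by have [/andP[] ] := Kx.
  have U2 : lam (wedge_trunc W ((1 - eta) * L) `|` slab eta) <=
    lam (wedge_trunc W ((1 - eta) * L)) + lam (slab eta) by exact: measureU2.
  move=> /le_trans/(_ U2); rewrite lebesgue_wedge trE; last by lra.
  rewrite -(fineK Slam) -EFinD lee_fin => h.
  have h1 : ((1 - eta) ^+ d.+1 <= 1 - eta)%R.
    rewrite exprS ler_piMr//; first by lra.
    by apply: exprn_ile1; lra.
  have := ler_wpM2l (ltW V0) h1.
  nra.
have Smass := wedge_mass_lebesgue mS (@subIsetl _ _ _) (esym (fineK Slam)).
move: Smass => /andP[s1 s2]; apply/andP; split.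
  by apply: le_trans s1; rewrite ler_pM2l// divr_gt0.
by apply: (le_trans s2); rewrite ler_pM2l// mulr_gt0.
Qed.

(** The density is at least [f0 / 2] on the part in between, which has positive volume. Strictness
    matters because [beta] jumps from nearly 1 to 0 at the argument 1. *)
Lemma wedge_mass_trunc_lt r x : K x -> (wproj W x < r)%R -> (r <= L)%R ->
  (wedge_mass (wedge_trunc W (wproj W x)) < wedge_mass (wedge_trunc W r))%R.
Proof.
move=> Kx xr rL; have [/andP[x0 xL] _] := Kx.
set t := wproj W x in x0 xL xr *.
pose A := wedge_trunc W r `\` wedge_trunc W t.
have mT a := measurable_wedge_trunc a.
have mA : measurable A by exact: measurableD.
have tr : wedge_trunc W t `<=` wedge_trunc W r.
  move=> y [Ky /= /andP[y0 yt]]; split => //=; rewrite y0/=.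
  exact: le_trans yt (ltW xr).
have r0 := lt_trans x0 xr.
have lT : lam (wedge_trunc W r) = lam (wedge_trunc W t) + lam A.
  rewrite -measureU//; last by rewrite /A setDE setIC -setIA (setIC (~` _)) setICr setI0.
  by rewrite /A setDUK.
have Afin : lam A \is a fin_num.
  rewrite ge0_fin_numE//; apply: (@le_lt_trans _ _ (lam (wedge_trunc W r))).
    by apply: le_measure; rewrite ?inE//; exact: subDsetl.
  by rewrite lebesgue_wedge_trunc ?r0// ltry.
have AK : A `<=` K by move=> y [[]].
have /andP[lo _] := wedge_mass_lebesgue mA AK (esym (fineK Afin)).
have l0 : (0 < fine (lam A))%R.
  move: lT; rewrite !lebesgue_wedge_trunc ?r0 ?x0//.
  move=> H; have lT : (tau * r ^+ d.+1 / d.+1%:R = tau * t ^+ d.+1 / d.+1%:R + fine (lam A))%R.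
    by apply: EFin_inj; rewrite EFinD fineK.
  have : (t ^+ d.+1 < r ^+ d.+1)%R by rewrite ltrXn2r// ?nnegrE ltW.
  move=> h; have : (tau * t ^+ d.+1 / d.+1%:R < tau * r ^+ d.+1 / d.+1%:R)%R.
    by rewrite ltr_pM2r ?invr_gt0// ltr_pM2l.
  by rewrite lT ltrDl.
pose mu : probability _ R := distribution P Y.
have muE B : measurable B -> mu B = (wedge_mass B)%:E by move=> mB; exact: wedge_massE.
have : mu (wedge_trunc W r) = mu (wedge_trunc W t) + mu A.
  rewrite -measureU//.
    by rewrite /A setDUK.
  by rewrite /A setDE setIC -setIA (setIC (~` _)) setICr setI0.
rewrite !muE// -EFinD => -[pE]; rewrite pE ltrDl.
by apply: lt_le_trans lo; rewrite mulr_gt0// divr_gt0.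
Qed.

Lemma wedge_mass_le A B : measurable A -> measurable B -> A `<=` B ->
  (wedge_mass A <= wedge_mass B)%R.
Proof.
move=> mA mB AB; rewrite -lee_fin -!wedge_massE//.
apply: le_measure; rewrite ?inE//; last by move=> w /AB.
  by rewrite -[X in measurable X]setTI; exact: measurable_funPT.
by rewrite -[X in measurable X]setTI; exact: measurable_funPT.
Qed.

(** Minus the score of an observation in [T^U], with the mass of the whole wedge in place of the
    mass up to the last observation: it depends on one observation only. [radial_score] plays the
    same part for [T_K]. *)
Definition rank_score (x : 'rV[R]_d.+1) : R :=
  (\1_K x * (1 - 2 * (wedge_mass (wedge_trunc W (wproj W x)) / wedge_mass K)))%R.

Lemma measurable_rank_score : measurable_fun setT rank_score.
Proof.
have mF : measurable_fun setT (fun t : R => wedge_mass (wedge_trunc W t)).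
  apply: nondecreasing_measurable => // a b ab.
  apply: wedge_mass_le; try exact: measurable_wedge_trunc.
  by move=> y [Ky /= /andP[y0 ya]]; split => //=; rewrite y0 (le_trans ya).
apply: measurable_funM; first exact: measurable_indic.
apply: measurable_funB => //; apply: measurable_funM => //; apply: measurable_funM => //.
exact: (measurableT_comp mF).
Qed.

Lemma wedge_mass_gt0 : (0 < wedge_mass K)%R.
Proof.
have /andP[h _] := wedge_mass_bounds; apply: lt_le_trans h.
by apply: mulr_gt0; [exact: divr_gt0|exact: wedge_volume_gt0].
Qed.

Lemma rank_score_norm x : (`|rank_score x| <= \1_K x)%R.
Proof.
rewrite /rank_score indicE; case: (boolP (x \in K)) => [/set_mem Kx|_]; last by rewrite mul0r normr0.
have p0 := wedge_mass_gt0.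
have h : (wedge_mass (wedge_trunc W (wproj W x)) <= wedge_mass K)%R.
  by apply: wedge_mass_le => //; [exact: measurable_wedge_trunc|move=> y []].
have h0 : (0 <= wedge_mass (wedge_trunc W (wproj W x)))%R.
  by rewrite fine_ge0// (density_law_ge0 Yf).
have h1 : (wedge_mass (wedge_trunc W (wproj W x)) / wedge_mass K <= 1)%R by rewrite ler_pdivrMr// mul1r.
have h2 : (0 <= wedge_mass (wedge_trunc W (wproj W x)) / wedge_mass K)%R by rewrite divr_ge0// ltW.
by rewrite mul1r ler_norml; apply/andP; split; rewrite /=; lra.
Qed.

(** The mean of [rank_score] is at most 0. Indeed [rank_score x + 1_K x] is [2 / p] times the mass
    of the part of [K] above [x], with [p] the mass of [K], and two independent draws give the
    integral of that mass over [K] a value of at most [p^2 / 2]. *)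
Lemma rank_score_mean :
  \int[P]_omega (rank_score (Y omega) + \1_K (Y omega))%:E <= (wedge_mass K)%:E.
Proof.
pose mu : probability _ R := distribution P Y.
have p0 := wedge_mass_gt0.
have mS := measurable_rank_score.
have S0 x : (0 <= rank_score x + \1_K x)%R.
  by have := rank_score_norm x; rewrite ler_norml => /andP[]; lra.
have mSE : measurable_fun setT (fun x => (rank_score x + \1_K x)%:E).
  by apply/measurable_EFinP; apply: measurable_funD => //; exact: measurable_indic.
rewrite -(ge0_integral_distribution Y mSE)//.
rewrite -/mu.
have muE A : measurable A -> mu A = (wedge_mass A)%:E by move=> mA; exact: wedge_massE.
have Srank x : (\1_K x)%:E * mu (K `&` [set y | (wproj W x < wproj W y)%R]) =
    (wedge_mass K / 2)%:E * (rank_score x + \1_K x)%:E.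
  have mT := measurable_wedge_trunc (wproj W x).
  have mI : measurable (K `&` [set y | (wproj W x < wproj W y)%R]).
    by apply: measurableI => //; exact: measurable_set_gt.
  have : mu K = mu (wedge_trunc W (wproj W x)) + mu (K `&` [set y | (wproj W x < wproj W y)%R]).
    rewrite -measureU//.
      congr (mu _); apply/seteqP; split => y.
        move=> Ky; have [/andP[y0 _] _] := Ky.
        by have [h|h] := leP (wproj W y) (wproj W x); [left; split => //=; rewrite y0|right].
      by move=> [[]|[]].
    by rewrite -subset0 => y [[_ /= /andP[_ h1]] [_ /= h2]]; have := le_lt_trans h1 h2; rewrite ltxx.
  rewrite !muE// -EFinD => -[pE].
  rewrite -!EFinM; congr EFin; rewrite /rank_score.
  have -> : wedge_mass (K `&` [set y | (wproj W x < wproj W y)%R]) =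
    (wedge_mass K - wedge_mass (wedge_trunc W (wproj W x)))%R by rewrite pE addrC addKr.
  by field; rewrite gt_eqF.
have := integral_rank_le mu mK mw.
under eq_integral do rewrite Srank.
have p20 : (0 <= wedge_mass K / 2)%R by rewrite divr_ge0// ltW.
rewrite ge0_integralZl_EFin//; last by move=> x _; rewrite lee_fin.
rewrite -ge0_muleDl ?lee_fin// -EFinD -splitr muE// lee_pmul2l//.
Qed.

Definition radial_score (x : 'rV[R]_d.+1) : R :=
  (\1_K x * (2 * (wproj W x ^+ d.+1 / L ^+ d.+1) - 1))%R.

Lemma measurable_radial_score : measurable_fun setT radial_score.
Proof.
apply: measurable_funM; first exact: measurable_indic.
by apply: measurable_funB => //; apply: measurable_funM => //; apply: measurable_funM => //; exact: measurable_funX.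
Qed.

Lemma radial_score_norm x : (`|radial_score x| <= \1_K x)%R.
Proof.
rewrite /radial_score indicE; case: (boolP (x \in K)) => [/set_mem Kx|_]; last by rewrite mul0r normr0.
have [/andP[x0 xL] _] := Kx.
have h1 : (wproj W x ^+ d.+1 / L ^+ d.+1 <= 1)%R.
  by rewrite ler_pdivrMr ?exprn_gt0// mul1r lerXn2r// ?nnegrE ltW.
have h2 : (0 <= wproj W x ^+ d.+1 / L ^+ d.+1)%R by rewrite divr_ge0// exprn_ge0// ltW.
by rewrite mul1r ler_norml; apply/andP; split; rewrite /=; lra.
Qed.

(** For a constant density the score has mean 0, because [2 a J D = J 0] with [D] the dimension and
    [a = L^-D]. What remains is curvature: with [B = D V L^2] the term in [q] is
    [q B / (2 (D+2)) - q B / (2 (D+1))], and the remainders add up to [delta B (1/(D+1) + 1/(D+2))],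
    whence the factor [2 D + 3]. *)
Lemma radial_score_mean (q delta : R) : (0 <= q)%R -> (0 <= delta)%R ->
  (forall x, K x -> `|f x - f0 + q / 2 * wproj W x ^+ 2| <= delta * wproj W x ^+ 2)%R ->
  \int[P]_omega (radial_score (Y omega) + \1_K (Y omega))%:E <=
  (- (d.+1%:R * V * L ^+ 2 / (d.+2%:R * d.+3%:R) * (q / 2 - (2 * d.+1%:R + 3) * delta))
    + wedge_mass K)%:E.
Proof.
move=> q0 delta0 fexp.
have [mf fge0 _] := Yf.
pose a : R := ((L ^+ d.+1)^-1)%R.
have a0 : (0 <= a)%R by rewrite invr_ge0 exprn_ge0// ltW.
have t0 x : K x -> (0 < wproj W x)%R by move=> [/andP[]].
have mt k : measurable_fun setT (fun x => wproj W x ^+ k)%R by exact: measurable_funX.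
pose g x : R := (2 * a * wproj W x ^+ d.+1)%R.
have mg : measurable_fun setT g by exact: measurable_funM.
have g0 x : K x -> (0 <= g x)%R.
  by move=> Kx; rewrite mulr_ge0// ?mulr_ge0// exprn_ge0// ltW// t0.
have -> : \int[P]_omega (radial_score (Y omega) + \1_K (Y omega))%:E =
    \int[lam]_(x in K) (g x * f x)%:E.
  rewrite -(expectation_density_in Yf mK mg g0); apply: eq_integral => omega _.
  by congr EFin; rewrite /radial_score /g /a; ring.
set E := \int[lam]_(x in K) _.
have mgf : measurable_fun K (fun x => (g x * f x)%:E).
  by apply/measurable_EFinP; apply: measurable_funTS; exact: measurable_funM.
have mmono c k : measurable_fun K (fun x => (c * wproj W x ^+ k)%:E).
  by apply/measurable_EFinP; apply: measurable_funTS; exact: measurable_funM.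
have mono0 c k x : (0 <= c)%R -> K x -> 0 <= (c * wproj W x ^+ k)%:E.
  by move=> c0 Kx; rewrite lee_fin mulr_ge0// exprn_ge0// ltW// t0.
have qa0 : (0 <= q * a)%R by exact: mulr_ge0.
(* The negative quadratic term is kept on the left, here and in [step2], so that only nonnegative
   functions are integrated. *)
have step1 : E + (q * a * J (d.+1 + 2))%:E <=
    (2 * f0 * a * J d.+1 + 2 * delta * a * J (d.+1 + 2))%:E.
  have c1 : (0 <= 2 * f0 * a)%R by rewrite !mulr_ge0// ltW.
  have c2 : (0 <= 2 * delta * a)%R by rewrite !mulr_ge0.
  rewrite -integral_wedge_binomial// -integral_wedge_monomial// -ge0_integralD//; last 2 first.
  - by move=> x Kx; rewrite lee_fin mulr_ge0// g0.
  - by move=> x Kx; exact: mono0.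
  apply: ge0_le_integral => //.
  - by move=> x Kx; rewrite adde_ge0 ?mono0// lee_fin mulr_ge0// g0.
  - exact: emeasurable_funD.
  - apply/measurable_EFinP; apply: measurable_funTS.
    by apply: measurable_funD; exact: measurable_funM.
  - move=> x Kx; rewrite -EFinD lee_fin /g exprD.
    have := fexp _ Kx; rewrite ler_norml => /andP[_ h].
    have c3 : (0 <= 2 * a * wproj W x ^+ d.+1)%R by exact: (g0 _ Kx).
    have := ler_wpM2l c3 h; lra.
have step2 : (f0 * J 0)%:E <= (wedge_mass K)%:E + ((q / 2 + delta) * J 2)%:E.
  have c1 : (0 <= q / 2 + delta)%R by rewrite addr_ge0// divr_ge0.
  rewrite -integral_wedge_monomial ?(ltW f0_gt0)// -integral_wedge_monomial//.
  rewrite /wedge_mass fineK ?(density_law_fin Yf)// /density_law.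
  have mfK : measurable_fun K (fun x => (f x)%:E).
    by apply/measurable_EFinP; exact: measurable_funTS.
  have fK0 x : K x -> 0 <= (f x)%:E by rewrite lee_fin.
  rewrite -(ge0_integralD lam mK fK0 mfK (fun x Kx => mono0 _ 2%N x c1 Kx) (mmono _ 2%N)).
  apply: ge0_le_integral => //.
  - by move=> x Kx; rewrite mono0// ltW.
  - exact: emeasurable_funD.
  - move=> x Kx; rewrite -EFinD lee_fin expr0 mulr1.
    have := fexp _ Kx; rewrite ler_norml => /andP[h _]; lra.
have Efin : E \is a fin_num.
  rewrite ge0_fin_numE; last by apply: integral_ge0 => x Kx; rewrite lee_fin mulr_ge0// g0.
  apply: le_lt_trans (ltry _); apply: le_trans step1.
  rewrite leeDl// lee_fin; apply: mulr_ge0 => //; apply: divr_ge0 => //.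
  by apply: mulr_ge0; [exact: ltW|apply: exprn_ge0; exact: ltW].
rewrite -(fineK Efin) -!EFinD !lee_fin in step1 step2 *.
have Lam0 : (L ^+ d.+1 != 0)%R by rewrite expf_neq0// gt_eqF.
have D0 : (0 < d.+1%:R :> R)%R by [].
have D1 : (d.+2%:R = d.+1%:R + 1 :> R)%R by rewrite -natr1.
have D2 : (d.+3%:R = d.+1%:R + 2 :> R)%R by rewrite -addn2 natrD.
have JD : (a * J d.+1 = V / 2)%R.
  rewrite /a /J /V /wedge_volume exprD natrD.
  move: (d.+1%:R : R)%R D0 (L ^+ d.+1)%R Lam0 => D D0 Lam Lam0.
  by field; rewrite Lam0 !gt_eqF//; lra.
have L2 : (J 0 = V)%R by rewrite /J add0n.
have JD2 : (a * J (d.+1 + 2) = d.+1%:R * V * L ^+ 2 / (2 * d.+2%:R))%R.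
  rewrite /a /J /V /wedge_volume !exprD !natrD D1.
  move: (d.+1%:R : R)%R D0 (L ^+ d.+1)%R Lam0 => D D0 Lam Lam0.
  by field; rewrite Lam0 !gt_eqF//; lra.
have J2 : (J 2 = d.+1%:R * V * L ^+ 2 / d.+3%:R)%R.
  rewrite /J /V /wedge_volume exprD D2.
  move: (d.+1%:R : R)%R D0 (L ^+ d.+1)%R => D D0 Lam.
  by field; rewrite !gt_eqF//; lra.
rewrite L2 J2 in step2.
have {}step1 : (fine E + q * (a * J (d.+1 + 2)) <=
    2 * f0 * (a * J d.+1) + 2 * delta * (a * J (d.+1 + 2)))%R by move: step1; rewrite !mulrA.
rewrite JD JD2 in step1.
move: step1 step2; rewrite D1 D2.
move: (d.+1%:R : R)%R D0 => D D0 step1 step2.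
set B := (D * V * L ^+ 2)%R in step1 step2 *.
have -> : (B / ((D + 1) * (D + 2)) * (q / 2 - (2 * D + 3) * delta) =
  q * (B / (2 * (D + 1))) - (q / 2 + delta) * (B / (D + 2)) - 2 * delta * (B / (2 * (D + 1))))%R.
  by field; rewrite !gt_eqF//; lra.
lra.
Qed.

End wedge_law.

(** * Concentration in one wedge *)

Lemma invM_le (R : realType) (k x : R) : 0 < k -> 1 <= x -> (k * x)^-1 <= k^-1.
Proof.
move=> k0 x1; have x0 : 0 < x by exact: lt_le_trans x1.
by rewrite lef_pV2 ?posrE ?mulr_gt0// -[leLHS]mulr1 ler_pM2l.
Qed.

Lemma inv_le_half (R : realType) (k : nat) : (1 < k)%N ->
  0 <= (k%:R : R)^-1 <= 2^-1.
Proof.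
move=> k1; rewrite invr_ge0 ler0n/= lef_pV2 ?posrE ?ltr0n ?ler_nat//.
exact: ltnW.
Qed.

Section scores.
Context (R : realType) (d : nat) dO (Omega : measurableType dO)
  (P : probability Omega R) (Y : {RV P >-> 'rV[R]_d.+1}) (f : 'rV[R]_d.+1 -> R).
Hypothesis Yf : has_density Y f.
Variables (W : wedge R d.+1) (f0 : R).
Hypotheses (wfW : wf_wedge W) (f0_gt0 : 0 < f0).
Hypothesis fK : forall x, wedge_set W x -> `|f x - f0| <= f0 / 2.
Implicit Types s : seq 'rV[R]_d.+1.

Lemma sum_indic_nobs s : \sum_(x <- s) \1_(wedge_set W) x = (nobs W s)%:R :> R.
Proof.
rewrite nobs_count -sum1_count natr_sum [RHS]big_mkcond/=.
by apply: eq_bigr => x _; rewrite indicE (_ : (x \in wedge_set W) = `[< wedge_set W x >])//; case: ifP.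
Qed.

Lemma max_proj_slab (eta : R) s x : x \in s -> slab W eta x ->
  (1 - eta) * wedge_length W <= max_proj W s.
Proof. by move=> xs [Kx h]; apply: le_trans h _; exact: max_proj_ge. Qed.

(* An observation in the slab makes [P_e X_(N)] at least [(1 - eta) L], so that
   dividing by [L] instead of [P_e X_(N)] costs little. *)
Lemma T_stat_le (eta : R) s : 0 < eta -> d.+1%:R * eta <= 2^-1 ->
  (exists2 x, x \in s & slab W eta x) ->
  T_stat W s <= \sum_(x <- s) radial_score W x + 4 * d.+1%:R * eta * (nobs W s)%:R.
Proof.
move=> eta0 Deta [y ys Sy].
have [_ _ _ L0 _] := wfW.
rewrite T_statE big_mkcond /= -sum_indic_nobs mulr_sumr -big_split /=.
rewrite big_seq [leRHS]big_seq; apply: ler_sum => x xs.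
rewrite /radial_score indicE; case: (boolP (x \in wedge_set W)) => [/set_mem Kx|Kx]; last first.
  rewrite !mul0r mulr0 addr0; case: ifP => // /asboolP Kx'; move/negP : Kx => [].
  exact/mem_set.
rewrite asboolT// mul1r mulr1.
have [/andP[t0 tL] _] := Kx.
set t := wproj W x in t0 tL *; set L := wedge_length W in L0 tL *.
set M := max_proj W s.
have tM : t <= M by exact: max_proj_ge.
have M0 : 0 < M by exact: lt_le_trans tM.
have LM : (1 - eta) * L <= M by exact: max_proj_slab Sy.
have eta1 : eta <= 2^-1.
  apply: le_trans Deta; rewrite -[leLHS]mul1r ler_wpM2r ?(ltW eta0)//.
  by rewrite ler1n.
have tMD : t ^+ d.+1 / M ^+ d.+1 <= 1.
  by rewrite ler_pdivrMr ?exprn_gt0// mul1r lerXn2r// ?nnegrE ltW.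
apply: le_trans (beta_le _ tMD) _; first by rewrite divr_gt0// exprn_gt0.
have LD : (1 - d.+1%:R * eta) * L ^+ d.+1 <= M ^+ d.+1.
  apply: (@le_trans _ _ (((1 - eta) * L) ^+ d.+1)).
    rewrite exprMn ler_wpM2r ?exprn_ge0 ?(ltW L0)//.
    by apply: bernoulli_lower; rewrite (ltW eta0)/=; lra.
  by rewrite lerXn2r// nnegrE ?(ltW M0)// mulr_ge0 ?(ltW L0)//; lra.
set a := d.+1%:R * eta in Deta LD *.
have a0 : 0 < a by rewrite mulr_gt0.
(* By Bernoulli's inequality [(L/M)^D <= 1 / (1 - a) <= 1 + 2 a] for [a <= 1/2]; the factor 2 in the
   score doubles the loss to [4 a]. *)
have key : t ^+ d.+1 / M ^+ d.+1 <= t ^+ d.+1 / L ^+ d.+1 + 2 * a.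
  have -> : t ^+ d.+1 / M ^+ d.+1 = t ^+ d.+1 / L ^+ d.+1 * (L ^+ d.+1 / M ^+ d.+1).
    by rewrite mulrA divfK// gt_eqF// exprn_gt0.
  have h1 : L ^+ d.+1 / M ^+ d.+1 <= 1 + 2 * a.
    rewrite ler_pdivrMr ?exprn_gt0//.
    have M'0 : 0 < M ^+ d.+1 by exact: exprn_gt0.
    have L'0 : 0 < L ^+ d.+1 by exact: exprn_gt0.
    have : (1 + 2 * a) * ((1 - a) * L ^+ d.+1) <= (1 + 2 * a) * M ^+ d.+1.
      by rewrite ler_pM2l//; lra.
    apply: le_trans; rewrite mulrA -[leLHS]mul1r ler_pM2r//.
    by have : a * (2 * a) <= a * 1 by [rewrite ler_pM2l//; lra]; lra.
  have h2 : t ^+ d.+1 / L ^+ d.+1 <= 1.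
    by rewrite ler_pdivrMr ?exprn_gt0// mul1r lerXn2r// ?nnegrE ltW.
  have h3 : 0 <= t ^+ d.+1 / L ^+ d.+1 by rewrite divr_ge0// exprn_ge0// ltW.
  apply: le_trans (ler_wpM2l h3 h1) _.
  have : t ^+ d.+1 / L ^+ d.+1 * (2 * a) <= 1 * (2 * a) by rewrite ler_wpM2r//; lra.
  lra.
rewrite -!mulrA -/a; lra.
Qed.

(* Dividing by the mass of the whole wedge decreases the argument of [beta];
   below the slab this argument stays in the open interval where [beta] is
   increasing. *)
Lemma TU_stat_ge (eta : R) s : 0 < eta <= 2^-1 ->
  (exists2 x, x \in s & slab W eta x) ->
  - TU_stat (density_law f) W s <= \sum_(x <- s) rank_score f W x + \sum_(x <- s) \1_(slab W eta) x.
Proof.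
move=> /andP[eta0 eta1] [y ys Sy].
have [_ _ _ L0 _] := wfW.
rewrite TU_statE -sumrN big_mkcond /= -big_split /=.
rewrite big_seq [leRHS]big_seq; apply: ler_sum => x xs.
have S0 : 0 <= \1_(slab W eta) x :> R by [].
rewrite /rank_score [\1_(wedge_set W) x]indicE; case: (boolP (x \in wedge_set W)) => [/set_mem Kx|Kx]; last first.
  rewrite !mul0r add0r; case: ifP => // /asboolP Kx'; move/negP : Kx => [].
  exact/mem_set.
rewrite asboolT// mul1r.
have [/andP[t0 tL] _] := Kx.
rewrite -!/(wedge_mass _ _).
set t := wproj W x in t0 tL *.
set M := max_proj W s.
have tM : t <= M by exact: max_proj_ge.
have M0 : 0 < M by exact: lt_le_trans tM.
have ML : M <= wedge_length W.
  by apply: max_proj_le; [exact: ltW|move=> z _ [/andP[]]].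
have LM : (1 - eta) * wedge_length W <= M by exact: max_proj_slab Sy.
have mT a := measurable_wedge_trunc W a.
have mK := measurable_wedge_set W.
have trS a b : a <= b -> wedge_trunc W a `<=` wedge_trunc W b.
  by move=> ab z [Kz /= /andP[z0 za]]; split => //=; rewrite z0 (le_trans za).
have p0 : 0 < wedge_mass f (wedge_set W) := wedge_mass_gt0 Yf wfW f0_gt0 fK.
set p := wedge_mass f (wedge_set W) in p0 *.
have Fle a b : a <= b -> wedge_mass f (wedge_trunc W a) <= wedge_mass f (wedge_trunc W b).
  by move=> ab; apply: (wedge_mass_le Yf) => //; exact: trS.
have FK a : wedge_mass f (wedge_trunc W a) <= p.
  by apply: (wedge_mass_le Yf) => // z [].
have F0 a : 0 <= wedge_mass f (wedge_trunc W a).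
  by apply: fine_ge0; exact: density_law_ge0 Yf _.
set Ft := wedge_mass f (wedge_trunc W t); set FM := wedge_mass f (wedge_trunc W M).
have FtM : Ft <= FM by exact: Fle.
have Ftp : Ft / p <= 1 by rewrite ler_pdivrMr// mul1r; exact: FK.
have Ftp0 : 0 <= Ft / p by apply: divr_ge0; [exact: F0|exact: ltW].
have [Ft0|Ft0] := eqVneq Ft 0.
  by rewrite Ft0 !mul0r beta0 oppr0 mulr0 subr0 addr_ge0.
have {}Ft0 : 0 < Ft by rewrite lt_neqAle eq_sym Ft0; exact: F0.
have FM0 : 0 < FM by exact: lt_le_trans FtM.
have v0 : 0 < Ft / FM by rewrite divr_gt0.
have [tr0|rt0] := ltP t ((1 - eta) * wedge_length W).
  have : Ft / FM < 1.
    rewrite ltr_pdivrMr// mul1r.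
    apply: lt_le_trans (Fle _ _ LM).
    apply: (wedge_mass_trunc_lt Yf wfW f0_gt0 fK Kx tr0).
    by rewrite ger_pMl//; lra.
  move=> v1; rewrite /beta in_itv/= v0 v1 /= mulr1.
  have : Ft / p <= Ft / FM by rewrite ler_pM2l// lef_pV2//; exact: FK.
  lra.
(* In the slab the argument can be 1, where [beta] is 0 although [rank_score] may be close to [-1]:
   the indicator pays for the difference. *)
have -> : \1_(slab W eta) x = 1 :> R by rewrite indicE mem_set.
have v1 : Ft / FM <= 1 by rewrite ler_pdivrMr// mul1r.
have : Ft / p <= Ft / FM by rewrite ler_pM2l// lef_pV2//; exact: FK.
by rewrite /beta in_itv/= v0 /=; case: ltP => [v1'|h]; rewrite /= ?mulr1 ?mulr0; lra.
Qed.

End scores.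

Section concentration.
Context (R : realType) (d : nat) dO (Omega : measurableType dO)
  (P : probability Omega R) (X : nat -> {RV P >-> 'rV[R]_d.+1}) (f : 'rV[R]_d.+1 -> R).
Hypothesis Xind : mutually_independent X.
Hypothesis Xf : forall i, has_density (X i) f.
Variables (W : wedge R d.+1) (f0 c : R).
Hypotheses (wfW : wf_wedge W) (f0_gt0 : 0 < f0) (c_gt0 : 0 < c).
Hypothesis fK : forall x, wedge_set W x -> `|f x - f0| <= f0 / 2.
Variable q : R.
Hypothesis cq : c <= q.
Hypothesis fexp : forall x, wedge_set W x ->
  `|f x - f0 + q / 2 * wproj W x ^+ 2| <= c / (4 * (2 * d.+1%:R + 3)) * wproj W x ^+ 2.
Variables (n : nat) (l : R).

Let D : R := d.+1%:R.
Let V := wedge_volume W.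
Let K := wedge_set W.
Let L := wedge_length W.
Definition expected_count : R := n%:R * f0 * V.
Let m := expected_count.
Hypotheses (l_gt0 : 0 < l) (lm : l <= m).
Let Sg := Num.sqrt (m * l).
(** Chosen so that [eta m = Sg / (200 D)]. The expected number of points in the slab is at least a
    constant multiple of [Sg >= l], so that an empty slab has probability at most [exp (- a l)]; it
    is at most a small multiple of [Sg], the scale of the signal. *)
Definition slab_width : R := (20 * 10 * D)^-1 * Num.sqrt (l / m).
Let eta := slab_width.

Let D1 : 1 <= D. Proof. by rewrite ler1n. Qed.
Let m0 : 0 < m. Proof. exact: lt_le_trans lm. Qed.
Let V0 : 0 < V. Proof. exact: wedge_volume_gt0. Qed.

Lemma slab_width_count : eta * m = (20 * 10 * D)^-1 * Sg.
Proof.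
rewrite /eta /slab_width; set k := (_ * D)^-1; rewrite -mulrA; congr (k * _).
rewrite /Sg sqrtrM ?(ltW l_gt0)// sqrtrM ?(ltW m0)//.
rewrite -[X in _ * X = _](sqr_sqrtr (ltW m0)) sqrtrV ?(ltW m0)//.
have : Num.sqrt m != 0 by rewrite gt_eqF// sqrtr_gt0.
by move: (Num.sqrt m) (Num.sqrt l) => a b a0; field.
Qed.

Lemma le_sqrt_count : l <= Sg.
Proof.
rewrite -(ger0_norm (ltW l_gt0)) -sqrtr_sqr ler_wsqrtr// expr2.
by rewrite ler_wpM2r// ltW.
Qed.

Lemma slab_width_bounds : 0 < eta <= (20 * 10 * D)^-1.
Proof.
have e0 : 0 < (20 * 10 * D)^-1 by rewrite invr_gt0; move: D1; move: D => z; lra.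
rewrite /eta /slab_width mulr_gt0 ?sqrtr_gt0 ?divr_gt0//=.
rewrite ler_piMr ?(ltW e0)//.
by rewrite -[leRHS]sqrtr1 ler_wsqrtr// ler_pdivrMr// mul1r.
Qed.

Let mean : R := - (D * V * L ^+ 2 / (d.+2%:R * d.+3%:R) * (c / 4)).
(** One rate for all six tails. The factor [D] is due to an empty slab, whose exponent is [n pS / 8]
    with [n pS >= Sg / (400 D)]. *)
Let xi : R := expR (- (20 ^+ 4 * D)^-1 * l).

Definition sample_sum (g : 'rV[R]_d.+1 -> R) (omega : Omega) : R :=
  \sum_(i < n) g (X i omega).

(* The constants are small enough for [margin_max] and [margin_rejects]. *)
Definition good_event : set Omega := [set omega |
  [/\ m / 4 <= sample_sum \1_K omega, sample_sum \1_K omega <= 2 * m,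
     sample_sum (radial_score W) omega <= n%:R * mean + Sg / 50,
     sample_sum (rank_score f W) omega <= Sg / 50 &
     0 < sample_sum \1_(slab W eta) omega /\
     sample_sum \1_(slab W eta) omega <= 6 * D * eta * m]].

Let tail (A : set 'rV[R]_d.+1) (g : 'rV[R]_d.+1 -> R) (mu u s : R) :
  measurable A -> measurable_fun setT g ->
  (forall x, `|g x| <= \1_A x) ->
  (forall i, (\int[P]_omega (g (X i omega) + \1_A (X i omega))%:E
     <= (mu + wedge_mass f A)%:E)%E) ->
  0 <= s <= 2^-1 ->
  - s * u + 2 * s ^+ 2 * (n%:R * wedge_mass f A) <= - (20 ^+ 4 * D)^-1 * l ->
  (P [set omega | (n%:R * mu + u <= sample_sum g omega)%R] <= xi%:E)%E.
Proof.
move=> mA mg gA gE s01 h.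
apply: le_trans (bernstein_upper Xind n u mA mg gA _ gE s01) _.
  by move=> i; exact: (wedge_massE (Xf i)).
by rewrite lee_fin ler_expR.
Qed.

Let indic_mean (A : set 'rV[R]_d.+1) i : measurable A ->
  (\int[P]_omega ((\1_A : _ -> R) (X i omega) + \1_A (X i omega))%:E
     <= (wedge_mass f A + wedge_mass f A)%:E)%E.
Proof.
move=> mA.
have mX : measurable (X i @^-1` A).
  by rewrite -[Y in measurable Y]setTI; exact: measurable_funPT.
under eq_integral do rewrite EFinD.
have m1 : measurable_fun setT (fun omega => ((\1_A : _ -> R) (X i omega))%:E).
  by apply/measurable_EFinP; apply: measurable_RV_comp; exact: measurable_indic.
rewrite ge0_integralD//.
rewrite (_ : (fun _ => _) = (fun omega => (\1_(X i @^-1` A) omega)%:E))//.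
have -> : (\int[P]_omega (\1_(X i @^-1` A) omega)%:E = (wedge_mass f A)%:E)%E.
  by rewrite integral_indic// setIT; exact: wedge_massE (Xf i) _ mA.
by rewrite -EFinD.
Qed.

Let opp_indic_mean (A : set 'rV[R]_d.+1) i : measurable A ->
  (\int[P]_omega (- (\1_A : _ -> R) (X i omega) + \1_A (X i omega))%:E
     <= (- wedge_mass f A + wedge_mass f A)%:E)%E.
Proof.
by move=> mA; under eq_integral do rewrite addNr; rewrite integral0 addNr.
Qed.

Lemma good_event_prob : exists2 G, measurable G & G `<=` good_event /\
  (P (~` G) <= (6 * xi)%:E)%E.
Proof.
have mK := measurable_wedge_set W.
have mS := measurable_slab W eta.
have /andP[eta0 etaD] := slab_width_bounds.
have etam := slab_width_count.
have lSg := le_sqrt_count.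
have D0 : 0 < D by exact: lt_le_trans D1.
have eE : 20 ^+ 4 * D = 20 * 20 * 20 * 20 * D by ring.
have eD : 0 < (20 ^+ 4 * D)^-1 by rewrite invr_gt0 eE; lra.
have eD1 : (20 ^+ 4 * D)^-1 <= (20 * 20 * 20 * 20)^-1.
  by rewrite eE; apply: invM_le => //; lra.
have eDl : (20 ^+ 4 * D)^-1 * l <= (20 * 20 * 20 * 20)^-1 * l by rewrite ler_wpM2r// ltW.
have xil z : z <= - (20 * 20 * 20 * 20)^-1 * l -> z <= - (20 ^+ 4 * D)^-1 * l.
  by move=> zl; rewrite !mulNr in zl *; apply: le_trans zl _; rewrite lerN2.
have /andP[p1 p2] := wedge_mass_bounds (Xf 0) wfW f0_gt0 fK.
have n0 : 0 < (n%:R : R).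
  have h0 : 0 <= (n%:R : R) by [].
  rewrite lt_neqAle h0 andbT; apply/eqP => n0.
  by move: m0; rewrite /m /expected_count -n0 !mul0r ltxx.
set p := wedge_mass f (wedge_set W) in p1 p2.
have np1 : m / 2 <= n%:R * p.
  have := ler_wpM2l (ltW n0) p1; rewrite /m /expected_count -/V; lra.
have np2 : n%:R * p <= 3 / 2 * m.
  have := ler_wpM2l (ltW n0) p2; rewrite /m /expected_count -/V; lra.
have eta1 : 2 * eta < 1.
  have h : (20 * 10 * D)^-1 <= (20 * 10)^-1 by apply: invM_le => //; lra.
  have := le_trans etaD h; move: eta => z; lra.
have /andP[s1 s2] := slab_mass (Xf 0) wfW f0_gt0 fK eta0 eta1.
set pS := wedge_mass f (slab W eta) in s1 s2.
have nS1 : eta * m / 2 <= n%:R * pS.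
  have := ler_wpM2l (ltW n0) s1; rewrite /m /expected_count -/V; lra.
have nS2 : n%:R * pS <= 3 * D * (eta * m).
  have := ler_wpM2l (ltW n0) s2; rewrite /m /expected_count -/V -/D; lra.
have Deta : D * (eta * m) = Sg / (20 * 10).
  by rewrite etam; field; rewrite gt_eqF.
have nabs (A : set 'rV[R]_d.+1) x : `|\1_A x : R| <= \1_A x by rewrite ger0_norm.
have nabsN (A : set 'rV[R]_d.+1) x : `|- (\1_A x : R)| <= \1_A x by rewrite normrN ger0_norm.
have m1 (A : set 'rV[R]_d.+1) : measurable A -> measurable_fun setT (\1_A : _ -> R).
  by move=> mA; exact: measurable_indic.
have mN1 (A : set 'rV[R]_d.+1) : measurable A -> measurable_fun setT (fun x => - (\1_A x : R)).
  by move=> mA; apply: measurableT_comp => //; exact: measurable_indic.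
have msum g : measurable_fun setT g -> measurable_fun setT (sample_sum g).
  by move=> mg; apply: measurable_sum => i; exact: (measurable_RV_comp X i mg).
have mbad g a : measurable_fun setT g -> measurable [set omega | a <= sample_sum g omega].
  by move=> mg; apply: measurable_set_ge; exact: msum.
pose B1 := [set omega | n%:R * p + m / 2 <= sample_sum \1_K omega].
pose B2 := [set omega | n%:R * - p + m / 4 <= sample_sum (fun x => - \1_K x) omega].
pose B3 := [set omega | n%:R * mean + Sg / 50 <= sample_sum (radial_score W) omega].
pose B4 := [set omega | n%:R * 0 + Sg / 50 <= sample_sum (rank_score f W) omega].
(* The deviation equals the whole mean, so this is the event that no observation falls into the
   slab. *)
pose B5 := [set omega | n%:R * - pS + n%:R * pS <= sample_sum (fun x => - \1_(slab W eta) x) omega].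
pose B6 := [set omega | n%:R * pS + 3 * D * (eta * m) <= sample_sum \1_(slab W eta) omega].
have mrad := measurable_radial_score W.
have mrank := measurable_rank_score (Xf 0) W.
have mB1 : measurable B1 by apply: mbad; exact: m1.
have mB2 : measurable B2 by apply: mbad; exact: mN1.
have mB3 : measurable B3 by exact: mbad.
have mB4 : measurable B4 by exact: mbad.
have mB5 : measurable B5 by apply: mbad; exact: mN1.
have mB6 : measurable B6 by apply: mbad; exact: m1.
(* For the counts, [s] is the minimiser [u / (4 n p)] of [- s u + 2 s^2 n p], with [n p] replaced by
   its upper bound [3 m / 2]: this gives [1/12] for the deviation [m / 2] and [1/24] for [m / 4]. In
   the same way the slab leads to [1/4]. *)
have PB1 : (P B1 <= xi%:E)%E.
  apply: (tail (s := 12^-1) mK (m1 _ mK) (nabs K)) => //.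
  - by move=> i; exact: indic_mean.
  - exact: inv_le_half.
  - by rewrite -/p; apply: xil; move: lm (l_gt0) np1 np2 => /[swap]; rewrite -/m expr2; lra.
have PB2 : (P B2 <= xi%:E)%E.
  apply: (tail (s := 24^-1) mK (mN1 _ mK) (nabsN K)) => //.
  - by move=> i; exact: opp_indic_mean.
  - exact: inv_le_half.
  - by rewrite -/p; apply: xil; move: lm (l_gt0) np1 np2 => /[swap]; rewrite -/m expr2; lra.
pose r := Num.sqrt (l / m).
have r0 : 0 <= r by exact: sqrtr_ge0.
have r1 : r <= 1 by rewrite -[leRHS]sqrtr1 ler_wsqrtr// ler_pdivrMr// mul1r.
have rm : r * m = Sg.
  have := etam; rewrite /eta /slab_width -/r; set k := (_ * D)^-1; rewrite -mulrA => /mulfI; apply.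
  by rewrite invr_eq0 gt_eqF//; lra.
have rSg : r * Sg = l.
  rewrite -rm mulrA -expr2 sqr_sqrtr ?divfK ?gt_eqF//.
  by rewrite divr_ge0// ltW.
have rrm : r ^+ 2 * m = l by rewrite expr2 -mulrA rm.
have pos_r2 : r ^+ 2 * (n%:R * p) <= 3 / 2 * l.
  by have := ler_wpM2l (sqr_ge0 r) np2; rewrite [X in _ <= X]mulrCA rrm.
(* With [s] proportional to [r = sqrt (l/m)] both terms are multiples of [l], as [r Sg = r^2 m = l]:
   the exponent is at most [- l / 10000 + 3 l / 40000]. *)
have score_exp : - (r / (20 * 10)) * (Sg / 50) + 2 * (r / (20 * 10)) ^+ 2 * (n%:R * p) <= - (20 ^+ 4 * D)^-1 * l.
  have -> : - (r / (20 * 10)) * (Sg / 50) + 2 * (r / (20 * 10)) ^+ 2 * (n%:R * p) =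
    - (20 * 10 * 50)^-1 * (r * Sg) + 2 / (20 * 10 * (20 * 10)) * (r ^+ 2 * (n%:R * p)) by field.
  rewrite rSg; apply: xil; move: (l_gt0) pos_r2; lra.
have rs : 0 <= r / (20 * 10) <= 2^-1.
  by apply/andP; split; [exact: divr_ge0|apply: le_trans (ler_wpM2r _ r1) _ => //; rewrite mul1r; lra].
have PB3 : (P B3 <= xi%:E)%E.
  apply: (tail (s := r / (20 * 10)) mK mrad (radial_score_norm wfW)) => //.
  - move=> i.
    have q0 : 0 <= q by apply: le_trans cq; exact: ltW.
    have dl0 : 0 <= c / (4 * (2 * d.+1%:R + 3)) :> R.
      by rewrite divr_ge0 ?(ltW c_gt0)// mulr_ge0// addr_ge0// mulr_ge0.
    apply: le_trans (radial_score_mean (Xf i) wfW f0_gt0 q0 dl0 fexp) _.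
    rewrite lee_fin lerD2r /mean lerN2 ler_wpM2l//.
      rewrite divr_ge0// mulr_ge0 ?sqr_ge0// mulr_ge0 ?(ltW V0)//.
    (* The error allowed in the expansion of [f] was chosen for this: of [q / 2 >= c / 2] the
       remainder takes [c / 4]. *)
    have -> : (2 * d.+1%:R + 3) * (c / (4 * (2 * d.+1%:R + 3))) = c / 4.
      by field; rewrite gt_eqF// -/D; lra.
    move: cq; lra.
have PB4 : (P B4 <= xi%:E)%E.
  apply: (tail (s := r / (20 * 10)) mK mrank (rank_score_norm (Xf 0) wfW f0_gt0 fK)) => //.
  - by move=> i; rewrite add0r; exact: (rank_score_mean (Xf i) wfW f0_gt0 fK).
have PB5 : (P B5 <= xi%:E)%E.
  apply: (tail (s := 4^-1) mS (mN1 _ mS) (nabsN _)) => //.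
  - by move=> i; exact: opp_indic_mean.
  - exact: inv_le_half.
  - rewrite -/pS.
    have : eta * m = Sg / (20 * 10 * D) by rewrite etam mulrC.
    have : l / (20 ^+ 4 * D) <= Sg / (20 ^+ 4 * D) by rewrite ler_wpM2r// ltW.
    have -> : Sg / (20 ^+ 4 * D) = (20 * 20 * 2)^-1 * (Sg / (20 * 10 * D)).
      by rewrite eE; field; rewrite gt_eqF.
    move=> h1 h2; rewrite -h2 in h1; rewrite [leRHS]mulNr [(20 ^+ 4 * D)^-1 * l]mulrC.
    have h3 := mulr_gt0 eta0 m0; move: h1 nS1 h3.
    by move: (l / _) (eta * m) (n%:R * pS) => a b e; lra.
have PB6 : (P B6 <= xi%:E)%E.
  apply: (tail (s := 4^-1) mS (m1 _ mS) (nabs _)) => //.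
  - by move=> i; exact: indic_mean.
  - exact: inv_le_half.
  - rewrite -/pS.
    apply: xil; move: nS2 lSg (l_gt0); rewrite -mulrA Deta.
    by move: (n%:R * pS) Sg => a b; lra.
exists (~` (B1 `|` (B2 `|` (B3 `|` (B4 `|` (B5 `|` B6)))))).
  by apply: measurableC; do 5 (apply: measurableU => //).
split; last first.
  rewrite setCK.
  have U2 (A B : set Omega) (a b : R) : measurable A -> measurable B ->
      (P A <= a%:E)%E -> (P B <= b%:E)%E -> (P (A `|` B) <= (a + b)%:E)%E.
    move=> mA mB PA PB; apply: le_trans (measureU2 P mA mB) _.
    by rewrite EFinD; exact: leeD.
  have -> : 6 * xi = xi + (xi + (xi + (xi + (xi + xi)))) by ring.
  have mB56 := measurableU _ _ mB5 mB6; have mB46 := measurableU _ _ mB4 mB56.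
  have mB36 := measurableU _ _ mB3 mB46; have mB26 := measurableU _ _ mB2 mB36.
  by do 5 (apply: (U2 _ _ xi) => //).
move=> omega; rewrite !setCU => -[b1 [b2 [b3 [b4 [b5 b6]]]]].
have sumN g : sample_sum (fun x => - g x) omega = - sample_sum g omega.
  by rewrite /sample_sum sumrN.
move: b1 b2 b3 b4 b5 b6; rewrite /B1 /B2 /B3 /B4 /B5 /B6 /=.
rewrite !sumN => /negP b1 /negP b2 /negP b3 /negP b4 /negP b5 /negP b6.
rewrite -!ltNge in b1 b2 b3 b4 b5 b6.
split.
- lra.
- lra.
- exact: ltW.
- by move/ltW : b4; rewrite mulr0 add0r.
- split; lra.
Qed.

End concentration.

(** * Measurability *)

Lemma measurable_beta (R : realType) : measurable_fun setT (@beta R).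
Proof.
rewrite (_ : beta (R:=R) = fun z => (2 * z - 1) * \1_(`]0, 1[%classic) z).
  apply: measurable_funM; last exact: measurable_indic.
  by apply: measurable_funB => //; exact: measurable_funM.
by apply/funext => z; rewrite /beta indicE mem_setE.
Qed.

(* On each half-line the inverse is an exponential of a logarithm. *)
Lemma measurable_invr (R : realType) : measurable_fun setT (fun t : R => t^-1).
Proof.
rewrite (_ : (fun _ => _) = fun t : R => \1_(`]0, +oo[%classic) t * expR (- ln t)
    - \1_(`]0, +oo[%classic) (- t) * expR (- ln (- t))).
  have mpos : measurable_fun setT
      (fun t : R => \1_(`]0, +oo[%classic) t * expR (- ln t)).
    apply: measurable_funM; first exact: measurable_indic.
    apply: (measurableT_comp (@measurable_expR R)).
    by apply: measurableT_comp => //; exact: measurable_ln.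
  apply: measurable_funB => //.
  by apply: (measurableT_comp mpos).
apply/funext => t; rewrite !indicE !mem_setE !in_itv/= !andbT oppr_gt0.
have [t0|t0|->] := ltgtP t 0; rewrite /=.
- by rewrite mul0r sub0r mul1r expRN lnK ?posrE ?oppr_gt0// invrN opprK.
- by rewrite mul0r subr0 mul1r expRN lnK ?posrE.
- by rewrite !mul0r subr0 invr0.
Qed.

Lemma measurable_funV (R : realType) d (T : measurableType d) (g : T -> R) :
  measurable_fun setT g -> measurable_fun setT (fun x => (g x)^-1).
Proof. by move=> mg; exact: (measurableT_comp (@measurable_invr R) mg). Qed.

Lemma max_stat_le (R : realType) d (mu : set 'rV[R]_d -> \bar R) n M
    (K : 'I_M -> wedge R d) s (a : R) :
  (max_stat mu n K s <= a%:E)%E <->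
  forall i, (1 < nobs (K i) s)%N ->
    - (Num.sqrt (3 / ((nobs (K i) s)%:R - 1)) * TU_stat mu (K i) s)
     - Gamma ((nobs (K i) s)%:R / (n%:R - 1)) <= a.
Proof.
split=> [/bigmax_leP[_ h] i /h|h]; first by rewrite lee_fin.
by apply/bigmax_leP; split=> [|i /h]; [exact: leNye|rewrite lee_fin].
Qed.

Section sample_measurable.
Context (R : realType) (d : nat) dO (Omega : measurableType dO)
  (P : probability Omega R) (X : nat -> {RV P >-> 'rV[R]_d.+1}) (f : 'rV[R]_d.+1 -> R).
Hypothesis Xf : forall i, has_density (X i) f.
Implicit Types W : wedge R d.+1.

Definition sample n omega : seq 'rV[R]_d.+1 := [seq X i omega | i <- iota 0 n].

Lemma big_sample n (g : 'rV[R]_d.+1 -> R) omega :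
  \sum_(x <- sample n omega) g x = sample_sum X n g omega.
Proof.
by rewrite big_map (_ : iota 0 n = index_iota 0 n) ?big_mkord// /index_iota subn0.
Qed.

Lemma measurable_indic_wedge W : measurable_fun setT (\1_(wedge_set W) : _ -> R).
Proof. by apply: measurable_indic; exact: measurable_wedge_set. Qed.

Lemma measurable_nobs W n :
  measurable_fun setT (fun omega => (nobs W (sample n omega))%:R : R).
Proof.
under eq_fun do rewrite -sum_indic_nobs big_sample.
apply: measurable_sum => i; apply: (measurable_RV_comp X i).
exact: measurable_indic_wedge.
Qed.

Lemma measurable_max_proj W n :
  measurable_fun setT (fun omega => max_proj W (sample n omega)).
Proof.
rewrite /sample; elim: (iota 0 n) => [|i r IHr].
  rewrite (_ : (fun _ => _) = cst 0)//.
  by apply/funext => omega; rewrite /max_proj big_nil.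
rewrite (_ : (fun _ => _) = fun omega => Num.max
    (\1_(wedge_set W) (X i omega) * wproj W (X i omega))
    (max_proj W [seq X j omega | j <- r])).
  apply: measurable_maxr => //.
  apply: (measurable_RV_comp X i (h := fun x => \1_(wedge_set W) x * wproj W x)).
  apply: measurable_funM; first exact: measurable_indic_wedge.
  exact: measurable_wproj.
apply/funext => omega; rewrite {1}/max_proj /= big_cons indicE.
rewrite (_ : (X i omega \in wedge_set W) = `[< wedge_set W (X i omega) >])//.
case: ifP => _; rewrite ?mul1r// mul0r max_r//.
elim: r {IHr} => [|j r IHr]; rewrite /max_proj ?big_nil//= big_cons.
by case: ifP => _ //; rewrite le_max IHr orbT.
Qed.

Lemma measurable_T_stat W n :
  measurable_fun setT (fun omega => T_stat W (sample n omega)).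
Proof.
rewrite (_ : (fun _ => _) = fun omega => \sum_(i <- iota 0 n)
    \1_(wedge_set W) (X i omega) *
      beta (wproj W (X i omega) ^+ d.+1 / max_proj W (sample n omega) ^+ d.+1)).
  apply: measurable_sum => i; apply: measurable_funM.
    apply: (measurable_RV_comp X i); exact: measurable_indic_wedge.
  apply: (measurableT_comp (@measurable_beta R)); apply: measurable_funM.
    apply: measurable_funX; apply: (measurable_RV_comp X i); exact: measurable_wproj.
  apply: measurable_funV; apply: measurable_funX; exact: measurable_max_proj.
apply/funext => omega; rewrite T_statE big_map big_mkcond; apply: eq_bigr => i _.
rewrite indicE (_ : (X i omega \in wedge_set W) = `[< wedge_set W (X i omega) >])//.
by case: ifP => _; rewrite ?mul1r ?mul0r.
Qed.

Lemma measurable_mass_trunc W :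
  measurable_fun setT (fun t : R => fine (density_law f (wedge_trunc W t))).
Proof.
apply: nondecreasing_measurable => // a b ab.
apply: (wedge_mass_le (Xf 0)); try exact: measurable_wedge_trunc.
by move=> y [Ky /= /andP[y0 ya]]; split => //=; rewrite y0 (le_trans ya).
Qed.

Lemma measurable_TU_stat W n :
  measurable_fun setT (fun omega => TU_stat (density_law f) W (sample n omega)).
Proof.
rewrite (_ : (fun _ => _) = fun omega => \sum_(i <- iota 0 n)
    \1_(wedge_set W) (X i omega) *
      beta (fine (density_law f (wedge_trunc W (wproj W (X i omega)))) /
            fine (density_law f (wedge_trunc W (max_proj W (sample n omega)))))).
  apply: measurable_sum => i; apply: measurable_funM.
    apply: (measurable_RV_comp X i); exact: measurable_indic_wedge.
  apply: (measurableT_comp (@measurable_beta R)); apply: measurable_funM.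
    apply: (measurableT_comp (measurable_mass_trunc W)).
    apply: (measurable_RV_comp X i); exact: measurable_wproj.
  apply: measurable_funV; apply: (measurableT_comp (measurable_mass_trunc W)).
  exact: measurable_max_proj.
apply/funext => omega; rewrite TU_statE big_map big_mkcond; apply: eq_bigr => i _.
rewrite indicE (_ : (X i omega \in wedge_set W) = `[< wedge_set W (X i omega) >])//.
by case: ifP => _; rewrite ?mul1r ?mul0r.
Qed.

Section counts.
Variables (n M : nat) (K : 'I_M -> wedge R d.+1).

Definition counts_eq (nu : 'I_M -> nat) : set Omega :=
  [set omega | forall i, nobs (K i) (sample n omega) = nu i].

Lemma measurable_counts_eq nu : measurable (counts_eq nu).
Proof.
rewrite (_ : counts_eq nu = \bigcap_(i in [set: 'I_M])
    ((fun omega => (nobs (K i) (sample n omega))%:R : R) @^-1` [set (nu i)%:R])).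
  apply: fin_bigcap_measurable => // i _; rewrite -[X in measurable X]setTI.
  exact: measurable_nobs.
apply/seteqP; split => omega /= h i; first by rewrite /= (h i).
by apply/eqP; rewrite -(eqr_nat R) (h i I).
Qed.

Lemma measurable_on_counts nu (A : 'I_M -> set Omega) :
  (forall i, measurable (A i)) ->
  measurable (counts_eq nu `&` [set omega | forall i, A i omega]).
Proof.
move=> mA; apply: measurableI; first exact: measurable_counts_eq.
rewrite (_ : [set _ | _] = \bigcap_(i in [set: 'I_M]) A i).
  by apply: fin_bigcap_measurable.
by apply/seteqP; split => omega h i //; exact: h.
Qed.

Lemma measurable_max_stat_le nu (a : R) : measurable
  ([set omega | (max_stat (density_law f) n K (sample n omega) <= a%:E)%E]
   `&` counts_eq nu).
Proof.
rewrite setIC.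
rewrite (_ : _ `&` _ = counts_eq nu `&` [set omega | forall i,
   [set omega | (1 < nu i)%N ->
     - (Num.sqrt (3 / ((nu i)%:R - 1)) * TU_stat (density_law f) (K i) (sample n omega))
       - Gamma ((nu i)%:R / (n%:R - 1)) <= a] omega]).
  apply: measurable_on_counts => i.
  set B := (X in measurable X).
  case h1 : (1 < nu i)%N; last first.
    by rewrite (_ : B = setT)//; apply/seteqP; split => // omega _; rewrite /B /= h1.
  rewrite (_ : B = [set omega | - (Num.sqrt (3 / ((nu i)%:R - 1)) *
      TU_stat (density_law f) (K i) (sample n omega))
       - Gamma ((nu i)%:R / (n%:R - 1)) <= a]); last first.
    by apply/seteqP; split => omega; rewrite /B /= h1; [move=> h; exact: h|].
  apply: measurable_set_le; apply: measurable_funB => //.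
  by apply: measurableT_comp => //; apply: measurable_funM => //; exact: measurable_TU_stat.
apply/seteqP; split => omega [E h]; split=> //.
  by move=> i /=; rewrite -(E i) => h1; move/max_stat_le : h => /(_ i h1).
by apply/max_stat_le => i; rewrite (E i); exact: h.
Qed.

Lemma measurable_rejects_on (kappa : ('I_M -> nat) -> R) nu : measurable
  (counts_eq nu `&` [set omega | forall i,
     rejects n (K i) (kappa (fun k => nobs (K k) (sample n omega))) (sample n omega)]).
Proof.
rewrite (_ : _ `&` _ = counts_eq nu `&` [set omega | forall i,
   [set omega | (1 < nu i)%N /\ T_stat (K i) (sample n omega)
       < - crit n (nu i) (kappa nu)] omega]).
  apply: measurable_on_counts => i.
  set B := (X in measurable X).
  case h1 : (1 < nu i)%N; last first.
    by rewrite (_ : B = set0)//; apply/seteqP; split => // omega; rewrite /B /= h1 => -[].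
  rewrite (_ : B = [set omega | 0 < - crit n (nu i) (kappa nu) - T_stat (K i) (sample n omega)]).
    by apply: measurable_set_gt; apply: measurable_funB => //; exact: measurable_T_stat.
  by apply/seteqP; split => omega; rewrite /B /= h1 subr_gt0 => // -[].
apply/seteqP; split => omega [E h]; split=> //= i; move: (h i) => /=;
  have -> : (fun k => nobs (K k) (sample n omega)) = nu by exact/funext.
  by rewrite /rejects E.
by rewrite /rejects E.
Qed.

(** No wedge contains more than [n] observations, so the possible counts form a finite type and
    partition the sample space into finitely many events. *)
Let count_of (nu : {ffun 'I_M -> 'I_n.+1}) : 'I_M -> nat := fun i => nu i.

Lemma counts_cover (omega : Omega) : exists nu, counts_eq (count_of nu) omega.
Proof.
exists [ffun i => inord (nobs (K i) (sample n omega))] => i.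
rewrite /count_of ffunE inordK// ltnS nobs_count.
by apply: leq_trans (count_size _ _) _; rewrite size_map size_iota.
Qed.

Lemma counts_trivIset (D : set {ffun 'I_M -> 'I_n.+1}) (G : set Omega) :
  trivIset D (fun nu => G `&` counts_eq (count_of nu)).
Proof.
move=> nu nu' _ _ [omega [[_ E] [_ E']]].
by apply/ffunP => i; apply/val_inj; rewrite /= -[LHS](E i) -[RHS](E' i).
Qed.

(** [kappa] is an arbitrary function of the counts. On each of the finitely many events with fixed
    counts it is a constant, and so are the factors in [N] of the tests. *)
Lemma measurable_of_counts (A : set Omega) :
  (forall nu, measurable (counts_eq nu `&` A)) -> measurable A.
Proof.
move=> h; rewrite (_ : A = \bigcup_(nu in [set: {ffun 'I_M -> 'I_n.+1}])
    (counts_eq (count_of nu) `&` A)).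
  by apply: fin_bigcup_measurable.
apply/seteqP; split => [omega Aomega|omega [nu _ []]//].
by have [nu E] := counts_cover omega; exists nu.
Qed.

End counts.
End sample_measurable.

(** * Critical values *)

Section critical.
Context (R : realType) (d : nat) dO (Omega : measurableType dO)
  (P : probability Omega R) (X : nat -> {RV P >-> 'rV[R]_d.+1}) (f : 'rV[R]_d.+1 -> R).
Hypothesis Xf : forall i, has_density (X i) f.
Variables (n M : nat) (K : 'I_M -> wedge R d.+1) (alpha kap : R)
  (kappa : ('I_M -> nat) -> R) (G : set Omega).
Hypotheses (M_gt0 : (0 < M)%N) (alpha01 : 0 < alpha < 1) (mG : measurable G).
Hypothesis kappa_crit :
  critical_value P (sample X n) (density_law f) alpha n K kappa.
Hypothesis G_nobs : forall omega, G omega ->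
  forall i, (1 < nobs (K i) (sample X n omega))%N.
Hypothesis G_max : forall omega, G omega ->
  (max_stat (density_law f) n K (sample X n omega) <= kap%:E)%E.

Let E := counts_eq X n K.
Let mE nu : measurable (E nu). Proof. exact: measurable_counts_eq. Qed.

(** Splitting [P (E nu)] along [G] in [P (G & E) <= (1 - alpha) P (E)] gives [alpha P (G & E) <= (1
    - alpha) P (~ G & E)]. Null counts are treated apart, as [critical_value] is silent about them;
    otherwise a point of [G] provides the entry of [nu] above 1 that [critical_value] asks for. *)
Lemma exceed_counts nu : kap < kappa nu ->
  (P (G `&` E nu) <= (alpha^-1)%:E * P (~` G `&` E nu))%E.
Proof.
move=> kk; have /andP[a0 a1] := alpha01.
have [->|/set0P[omega [Go Eo]]] := eqVneq (G `&` E nu) set0.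
  by rewrite measure0 mule_ge0// lee_fin invr_ge0 ltW.
have mGE := measurableI _ _ mG (mE nu).
have mGcE := measurableI _ _ (measurableC mG) (mE nu).
have PE : P (E nu) = (P (G `&` E nu) + P (~` G `&` E nu))%E.
  rewrite -measureU//; last by rewrite setIACA setICr set0I.
  by rewrite -setIUl setUv setTI.
have [E0|E0] := eqVneq (P (E nu)) 0%E.
  apply: (@le_trans _ _ (P (E nu))).
    by apply: le_measure; rewrite ?inE//; exact: subIsetr.
  by rewrite E0 mule_ge0// lee_fin invr_ge0 ltW.
have {}E0 : (0 < P (E nu))%E by rewrite lt_neqAle eq_sym E0 measure_ge0.
have nu1 : exists i, (1 < nu i)%N.
  by exists (Ordinal M_gt0); rewrite -(Eo _); exact: G_nobs.
have := kappa_crit nu1 E0; rewrite /cond_prob.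
set A := [set _ | (max_stat _ _ _ _ <= _)%E]; rewrite -/E => cA.
have mA : measurable (A `&` E nu) by exact: (measurable_max_stat_le Xf n K nu).
have GA : (P (G `&` E nu) <= P (A `&` E nu))%E.
  apply: le_measure; rewrite ?inE// => w [Gw Ew]; split => //=.
  by apply: le_trans (G_max Gw) _; rewrite lee_fin ltW.
have finP B : measurable B -> P B = (fine (P B))%:E.
  by move=> mB; rewrite fineK// fin_num_measure.
move: PE E0 GA; rewrite (finP _ (mE nu)) (finP _ mGE) (finP _ mGcE) (finP _ mA).
rewrite -EFinD -EFinM => -[PE]; rewrite !lte_fin !lee_fin => E0 GA.
have {}cA : fine (P (A `&` E nu)) = (1 - alpha) * fine (P (E nu)).
  by rewrite -cA divfK// gt_eqF.
rewrite -(ler_pM2l a0) mulrA divff ?gt_eqF// mul1r.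
have g0 : 0 <= fine (P (~` G `&` E nu)) by exact: fine_ge0.
have : alpha * fine (P (G `&` E nu)) <= alpha * fine (P (E nu)).
  by rewrite ler_pM2l// PE; lra.
lra.
Qed.

Definition exceed : set Omega :=
  [set omega | G omega /\ kap < kappa (fun k => nobs (K k) (sample X n omega))].

Let nuT := {ffun 'I_M -> 'I_n.+1}.
Let cnt (nu : nuT) : 'I_M -> nat := fun i => nu i.
Let bad : set nuT := [set nu | kap < kappa (cnt nu)].

Let exceedE : exceed = \bigcup_(nu in bad) (G `&` E (cnt nu)).
Proof.
apply/seteqP; split => [omega [Gw h]|omega [nu h [Gw Ew]]].
  have [nu Ew] := counts_cover X n K omega; exists nu => //.
  by rewrite /bad /= (_ : cnt nu = fun k => nobs (K k) (sample X n omega))//; apply/funext => k; rewrite Ew.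
split=> //; rewrite (_ : (fun _ => _) = cnt nu)//; apply/funext => k; exact: Ew.
Qed.

Lemma measurable_exceed : measurable exceed.
Proof.
rewrite exceedE; apply: fin_bigcup_measurable; first exact: finite_finset.
by move=> nu _; exact: measurableI.
Qed.

Lemma exceed_prob : (P exceed <= (alpha^-1)%:E * P (~` G))%E.
Proof.
have /andP[a0 a1] := alpha01.
have finb : finite_set bad by exact: finite_finset.
have tI B : trivIset bad (fun nu => B `&` E (cnt nu)) by exact: counts_trivIset.
have mB B : measurable B -> forall nu, bad nu -> measurable (B `&` E (cnt nu)).
  by move=> mB' nu _; exact: measurableI.
rewrite exceedE measure_fin_bigcup//; last exact: mB.
apply: (@le_trans _ _ (\sum_(nu \in bad) ((alpha^-1)%:E * P (~` G `&` E (cnt nu))))%E).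
  by apply: lee_fsum => // nu h; exact: exceed_counts.
rewrite -ge0_mule_fsumr//; apply: lee_wpmul2l; first by rewrite lee_fin invr_ge0 ltW.
rewrite -measure_fin_bigcup//; last exact/mB/measurableC.
apply: le_measure; rewrite ?inE//; last by move=> w [nu _ []].
  by apply: fin_bigcup_measurable => //; exact/mB/measurableC.
exact: measurableC.
Qed.

Hypothesis G_rejects : forall omega k, G omega -> k <= kap ->
  forall i, rejects n (K i) k (sample X n omega).

Lemma reject_prob (b : R) : (P (~` G) <= b%:E)%E ->
  ((1 - (1 + alpha^-1) * b)%:E <=
   P [set omega | forall i, rejects n (K i)
        (kappa (fun k => nobs (K k) (sample X n omega))) (sample X n omega)])%E.
Proof.
move=> Gb; set A := [set _ | _]; have /andP[a0 a1] := alpha01.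
have mA : measurable A.
  by apply: (@measurable_of_counts _ _ _ _ _ X n M K A) => nu; exact: measurable_rejects_on.
have PA : (P (~` A) <= ((1 + alpha^-1) * b)%:E)%E.
  have mGc := measurableC mG; have mX := measurable_exceed.
  apply: (@le_trans _ _ (P (~` G `|` exceed))).
    apply: le_measure; rewrite ?inE//; [exact: measurableC|exact: measurableU|].
    move=> omega nA; have [Gw|] := pselect (G omega); last by left.
    right; split=> //; rewrite ltNge; apply/negP => h; apply: nA => i.
    exact: G_rejects.
  apply: le_trans (measureU2 P mGc mX) _; rewrite mulrDl mul1r EFinD.
  apply: leeD => //; apply: le_trans exceed_prob _; rewrite EFinM.
  by apply: lee_wpmul2l => //; rewrite lee_fin invr_ge0 ltW.
have := probability_setC P (measurableC mA); rewrite setCK => ->.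
rewrite EFinB leeB//.
Qed.

End critical.

(** * Rejection on the good event *)

Lemma sqrtr_le (R : realType) (x y : R) : 0 <= y -> x <= y ^+ 2 -> Num.sqrt x <= y.
Proof. by move=> y0 xy; rewrite -(ger0_norm y0) -sqrtr_sqr ler_wsqrtr. Qed.

Lemma ler_sqrtr (R : realType) (x y : R) : 0 <= y -> y ^+ 2 <= x -> y <= Num.sqrt x.
Proof. by move=> y0 xy; rewrite -[leLHS](ger0_norm y0) -sqrtr_sqr ler_wsqrtr. Qed.

(** For [m >= 8] one has [N - 1 >= m / 4 - 1 >= m / 8], hence [3 m / (N - 1) <= 25]; the root 5
    divided by 20 is the [1/4] of the conclusion. *)
Lemma margin_max (R : realType) (N m l g TU : R) :
  0 < l -> 8 <= m -> m / 4 <= N -> 0 <= g -> - TU <= Num.sqrt (m * l) / 20 ->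
  - (Num.sqrt (3 / (N - 1)) * TU) - g <= Num.sqrt l / 4.
Proof.
move=> l0 m8 N1 g0; set Sg := Num.sqrt (m * l) => hTU; have m0 : 0 < m by lra.
have N0 : 0 < N - 1 by lra.
have sl0 : 0 < Num.sqrt l by rewrite sqrtr_gt0.
have S0 : 0 <= Num.sqrt (3 / (N - 1)) by exact: sqrtr_ge0.
have h1 : - (Num.sqrt (3 / (N - 1)) * TU) <= Num.sqrt (3 / (N - 1)) * (Sg / 20).
  by rewrite -mulrN ler_wpM2l.
have h2 : Num.sqrt (3 / (N - 1)) * Sg <= 5 * Num.sqrt l.
  rewrite /Sg -sqrtrM ?divr_ge0 ?(ltW N0)//; apply: sqrtr_le; first by lra.
  rewrite exprMn sqr_sqrtr ?(ltW l0)// mulrA ler_pM2r// mulrAC ler_pdivrMr//.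
  by rewrite expr2; lra.
by have := S0; lra.
Qed.

(* [44/100 <= sqrt (1/5)] bounds [r = sqrt (d / (d + 4))] from below,
   [(53/25)^2 <= 4.5] and [2/3 <= (82/100)^2]. *)
Lemma margin_rejects (R : realType) (N m l r g T k : R) :
  0 < l -> 8 <= m -> m / 4 <= N -> N <= 2 * m -> 44 / 100 <= r -> 0 <= g -> g <= 3 / 2 * r * Num.sqrt l ->
  T <= - (53 / 25 * r * Num.sqrt (m * l)) + 3 / 50 * Num.sqrt (m * l) -> k <= Num.sqrt l / 4 ->
  T < - (Num.sqrt ((N - 1) / 3) * (k + g)).
Proof.
move=> l0 m8 N1 N2 r0 g0 hg; set Sg := Num.sqrt (m * l) => hT hk; have m0 : 0 < m by lra.
have N0 : 0 < N - 1 by lra.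
have sl0 : 0 < Num.sqrt l by rewrite sqrtr_gt0.
have Sg0 : 0 < Sg by rewrite sqrtr_gt0 mulr_gt0.
have h1 : Num.sqrt ((N - 1) / 3) * (k + g) <=
    Num.sqrt ((N - 1) / 3) * ((4^-1 + 3 / 2 * r) * Num.sqrt l).
  by rewrite ler_wpM2l ?sqrtr_ge0//; lra.
have h2 : Num.sqrt ((N - 1) / 3) * Num.sqrt l <= 82 / 100 * Sg.
  rewrite -sqrtrM ?divr_ge0 ?(ltW N0)//; apply: sqrtr_le; first by lra.
  rewrite exprMn /Sg sqr_sqrtr ?mulr_ge0 ?(ltW l0)// ?(ltW m0)// mulrA ler_pM2r//.
  by rewrite expr2; lra.
have h3 : Num.sqrt ((N - 1) / 3) * ((4^-1 + 3 / 2 * r) * Num.sqrt l) <=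
    (4^-1 + 3 / 2 * r) * (82 / 100 * Sg).
  by rewrite mulrCA ler_pM2l//; lra.
have h4 : 44 / 100 * Sg <= r * Sg by rewrite ler_pM2r.
rewrite ltrNr; apply: le_lt_trans (le_trans h1 h3) _.
have -> : (4^-1 + 3 / 2 * r) * (82 / 100 * Sg) = 82 / 400 * Sg + 123 / 100 * (r * Sg) by field.
(* What is left is [0.205 + 0.06 < (2.12 - 1.23) r], true for [r >= 0.44]. *)
move: hT; rewrite -(mulrA (53 / 25)); lra.
Qed.

Section wedge_test.
Context (R : realType) (d : nat) dO (Omega : measurableType dO)
  (P : probability Omega R) (X : nat -> {RV P >-> 'rV[R]_d.+1}) (f : 'rV[R]_d.+1 -> R).
Hypothesis Xf : forall i, has_density (X i) f.
Variables (W : wedge R d.+1) (f0 c : R).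
Hypotheses (wfW : wf_wedge W) (f0_gt0 : 0 < f0).
Hypothesis fK : forall x, wedge_set W x -> `|f x - f0| <= f0 / 2.
Variables (n : nat) (l : R) (omega : Omega).

Let D : R := d.+1%:R.
Let m := expected_count W f0 n.
Hypotheses (l_gt0 : 0 < l) (lm : l <= m).
Hypothesis good : good_event X f W f0 c n l omega.
Let Sg := Num.sqrt (m * l).
Let s := sample X n omega.
Let mean : R :=
  - (D * wedge_volume W * wedge_length W ^+ 2 / (d.+2%:R * d.+3%:R) * (c / 4)).

Let D1 : 1 <= D. Proof. by rewrite ler1n. Qed.

(** Since [D eta m = Sg / 200], the constants are [3/50 = 1/50 + 8/200], from [4 D eta N] with
    [N <= 2 m], and [1/20 = 1/50 + 6/200], from the bound [6 D eta m] on the points in the slab. *)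
Lemma good_event_stats :
  [/\ m / 4 <= (nobs W s)%:R, (nobs W s)%:R <= 2 * m,
      T_stat W s <= n%:R * mean + 3 / 50 * Sg &
      - TU_stat (density_law f) W s <= Sg / 20].
Proof.
have [] := good; rewrite -!big_sample sum_indic_nobs => N1 N2 hrad hrank [slab0 slab1].
have := slab_width_bounds l_gt0 lm; have := slab_width_count l_gt0 lm.
move: slab0 slab1; rewrite -/m -/Sg -/D -/s.
set eta := slab_width _ _ _ _ => slab0 slab1 etam /andP[eta0 etaD].
have m0 : 0 < m by exact: lt_le_trans lm.
have Deta : D * (eta * m) = Sg / (20 * 10).
  by rewrite etam; field; rewrite gt_eqF//; exact: lt_le_trans D1.
have e1 : D * eta <= (20 * 10)^-1.
  have D0 : 0 < D by exact: lt_le_trans D1.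
  have -> : (20 * 10)^-1 = D * (20 * 10 * D)^-1 :> R by field; rewrite gt_eqF.
  by rewrite ler_pM2l.
have eta1 : eta <= (20 * 10)^-1.
  by apply: le_trans e1; rewrite ler_peMl// ltW.
have [x xs Sx] : exists2 x, x \in s & slab W eta x.
  apply: contrapT => h; move: slab0; rewrite big_seq big1 ?ltxx// => x xs.
  rewrite indicE; case: (boolP (x \in slab W eta)) => // /set_mem Sx.
  by exfalso; apply: h; exists x.
split=> //.
- have De : D * eta <= 2^-1 by apply: le_trans e1 _; lra.
  apply: le_trans (T_stat_le wfW eta0 De (ex_intro2 _ _ x xs Sx)) _.
  rewrite -/D -/s.
  have : 4 * D * eta * (nobs W s)%:R <= 4 * D * eta * (2 * m).
    by rewrite ler_wpM2l// !mulr_ge0// ?(ltW eta0)//; lra.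
  have -> : 4 * D * eta * (2 * m) = 8 * (D * (eta * m)) by ring.
  rewrite Deta; move: hrad; rewrite -/s -/m -/Sg -/D -/mean; lra.
- have e2 : 0 < eta <= 2^-1 by rewrite eta0/=; apply: le_trans eta1 _; lra.
  apply: le_trans (TU_stat_ge (Xf 0) wfW f0_gt0 fK e2 (ex_intro2 _ _ x xs Sx)) _.
  have E6 : 6 * D * eta * m = 6 * (D * (eta * m)) by ring.
  move: slab1; rewrite E6 Deta.
  move: hrank; rewrite -/s -/m -/Sg; lra.
Qed.

Hypothesis m8 : 8 <= m.

Lemma good_event_max :
  - (Num.sqrt (3 / ((nobs W s)%:R - 1)) * TU_stat (density_law f) W s)
    - Gamma ((nobs W s)%:R / (n%:R - 1)) <= Num.sqrt l / 4.
Proof.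
have [N1 N2 _ hTU] := good_event_stats.
by apply: (margin_max l_gt0 m8 N1) hTU; exact: sqrtr_ge0.
Qed.

Lemma good_event_nobs : (1 < nobs W s)%N.
Proof.
have [N1 _ _ _] := good_event_stats; by rewrite -(ltr_nat R); move: m8 N1; lra.
Qed.

Lemma good_event_rejects (r k : R) : 44 / 100 <= r ->
  (forall N : nat, m / 4 <= N%:R ->
     @Gamma R (N%:R / (n%:R - 1)) <= 3 / 2 * r * Num.sqrt l) ->
  53 / 25 * r * Sg <= - (n%:R * mean) ->
  k <= Num.sqrt l / 4 -> rejects n W k s.
Proof.
move=> r0 hG hs hk; have [N1 N2 hT _] := good_event_stats.
split; first exact: good_event_nobs.
apply: (margin_rejects l_gt0 m8 N1 N2 r0 (sqrtr_ge0 _) (hG _ N1) _ hk).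
by apply: le_trans hT _; rewrite lerD2r lerNr.
Qed.

End wedge_test.

(** * Number and size of the wedges *)

Section packing.
Context (R : realType) (d : nat).
Let D : R := d.+1%:R.

Lemma wedge_coord_le (W : wedge R d.+1) x i : wf_wedge W ->
  tan (wedge_angle W) <= 1 -> wedge_set W x ->
  `|(x - vertex W) ord0 i| <= D * wedge_length W.
Proof.
move=> wfW T1 Kx; have T0 := tan_wedge_angle_gt0 wfW.
have [/andP[x0 xL] _] := Kx.
have L0 : 0 < wedge_length W by exact: lt_le_trans xL.
have D1 : 1 <= D by rewrite ler1n.
apply: le_trans (ler_coord_enorm _ _) _.
apply: sqrtr_le; first by rewrite mulr_ge0// ?(ltW L0).
apply: le_trans (wedge_coord_bound wfW Kx) _.
apply: (@le_trans _ _ (D * wproj W x ^+ 2)).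
  rewrite /D -natr1 mulrDl mul1r addrC lerD2r ler_wpM2l//.
  by rewrite exprMn ler_piMl ?sqr_ge0// exprn_ile1// ltW.
rewrite exprMn; apply: (@le_trans _ _ (D * wedge_length W ^+ 2)).
  by rewrite ler_wpM2l// ler_pXn2r// nnegrE ltW.
by rewrite ler_wpM2r ?sqr_ge0// expr2 ler_peMr.
Qed.

Lemma wedge_packing (x0 : 'rV[R]_d.+1) (L phi : R) M (K : 'I_M -> wedge R d.+1) :
  0 < L -> tan phi <= 1 ->
  (forall i, [/\ wf_wedge (K i), vertex (K i) = x0, wedge_length (K i) = L &
     wedge_angle (K i) = phi]) ->
  (forall i j : 'I_M, (j < i)%N -> wedge_set (K i) `&` wedge_set (K j) = set0) ->
  M%:R * ((2 * tan phi) ^+ d * L ^+ d.+1 / D) <= (4 * D * L) ^+ d.+1.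
Proof.
move=> L0 T1 KK disj; set lam := lebesgue_row R d.+1; set V := _ / D.
have D0 : 0 < D by rewrite ltr0n.
have LD0 : 0 < 2 * D * L by rewrite !mulr_gt0.
(* Coordinates in a wedge deviate from those of [x0] by at most [D L]; doubling this half-side
   leaves room for the open left ends of the box. *)
pose a : 'rV[R]_d.+1 := \row_j (x0 ord0 j - 2 * D * L).
pose b : 'rV[R]_d.+1 := \row_j (x0 ord0 j + 2 * D * L).
have boxE := @lebesgue_row_box R d.+1 a b.
have {}boxE : lam [set v | forall i, a ord0 i < v ord0 i <= b ord0 i] = ((4 * D * L) ^+ d.+1)%:E.
  rewrite boxE => [|i]; last by rewrite !mxE; lra.
  rewrite (eq_bigr (fun=> (4 * D * L)%:E)) => [|i _].
    by rewrite prodEFin prodr_const card_ord.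
  by rewrite !mxE; congr EFin; ring.
have KV i : lam (wedge_set (K i)) = V%:E.
  have [wfK _ KL Kphi] := KK i.
  by rewrite /lam (lebesgue_wedge wfK) /wedge_volume KL Kphi.
have mK i : measurable (wedge_set (K i)) by exact: measurable_wedge_set.
have tK : trivIset setT (fun i => wedge_set (K i)).
  move=> i j _ _ [x [xi xj]]; case: (ltngtP i j) => [ij|ji|ij].
  - by have /seteqP[h _] := disj _ _ ij; case: (h x).
  - by have /seteqP[h _] := disj _ _ ji; case: (h x).
  - exact: val_inj.
have mbox : measurable [set v : 'rV[measurableTypeR R]_d.+1 | forall i, a ord0 i < v ord0 i <= b ord0 i].
  rewrite (_ : [set _ | _] = \bigcap_(i in [set: 'I_d.+1])
      ((fun v : 'rV[measurableTypeR R]_d.+1 => v ord0 i) @^-1` `]a ord0 i, b ord0 i]%classic)).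
    apply: fin_bigcap_measurable => // i _; rewrite -[X in measurable X]setTI.
    exact: measurable_coord.
  by apply/seteqP; split=> v /= h i; rewrite ?in_itv/=; [move=> _|]; have := h i; rewrite ?in_itv//; apply.
have := measure_bigsetU_ord lam xpredT mK tK.
rewrite (eq_bigr (fun=> V%:E)); last by move=> i _; exact: KV.
rewrite sumEFin sumr_const card_ord => U.
rewrite mulr_natl -lee_fin -U -boxE; apply: le_measure; rewrite ?inE//.
  exact: bigsetU_measurable.
apply: (big_ind (fun A => A `<=` _)) => // [A B hA hB x [/hA|/hB]//|i _ x Kx j].
have [wfK Kv KL Kphi] := KK i.
have := wedge_coord_le j wfK _ Kx; rewrite Kphi Kv KL => /(_ T1).
by rewrite !mxE ler_norml => /andP[h1 h2]; apply/andP; split; move: h1 h2 LD0; rewrite -/D; lra.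
Qed.

End packing.

(** * Elementary bounds for the tangent, the logarithm and the exponential *)

Section analysis.
Variable R : realType.
Implicit Types a b e x y l : R.

Lemma le_tan x : 0 < x < pi / 2 -> x <= tan x.
Proof.
move=> /andP[x0 x1].
have cos0 y : 0 <= y <= x -> 0 < cos y.
  move=> /andP[y0 yx]; apply: cos_gt0_pihalf; rewrite (le_lt_trans yx)// andbT.
  by apply: lt_le_trans y0; rewrite oppr_lt0 divr_gt0// pi_gt0.
have [y|/=|y yx] := @MVT R tan (fun y => (cos y)^-2) 0 x x0.
- rewrite in_itv/= => /andP[y0 yx]; apply: is_derive_tan.
  by rewrite gt_eqF// cos0// !ltW.
- apply: continuous_in_subspaceT => y; rewrite inE/= in_itv/= => yx.
  by apply: continuous_tan; rewrite gt_eqF// cos0.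
rewrite tan0 !subr0 => ->; rewrite ler_peMl ?(ltW x0)//.
have c0 : 0 < cos y.
  by move: yx; rewrite in_itv/= => /andP[? ?]; rewrite cos0// !ltW.
by rewrite invf_ge1 ?exprn_gt0// exprn_ile1// ?cos_le1// ltW.
Qed.

Lemma tan_le_near0 e : 0 < e -> 0 < atan e /\
  forall x, 0 < x < atan e -> x < pi / 2 /\ tan x <= e.
Proof.
move=> e0; have a0 : 0 < atan e by rewrite -atan0 lt_atan.
split=> // x /andP[x0 xa]; have xp := lt_trans xa (atan_ltpi2 e).
split=> //; rewrite -[leRHS]atanK ltW// ltr_tan// in_itv/=.
  by rewrite xp andbT (lt_trans _ x0)// oppr_lt0 divr_gt0// pi_gt0.
by rewrite atan_gtNpi2 atan_ltpi2.
Qed.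

(** Applied with [l = ln n], it absorbs constants and iterated logarithms. From [ln (t l) < t l] one
    gets [ln l <= t l - ln t], and [t] is so small that [b t <= e / 2]. *)
Lemma ln_affine a b e : 0 <= b -> 0 < e ->
  exists l0, forall l, l0 <= l -> a + b * ln l <= e * l.
Proof.
move=> b0 e0; pose t := e / (2 * (b + 1)).
have t0 : 0 < t by rewrite divr_gt0//; lra.
exists (Num.max 1 (2 * (a - b * ln t) / e)) => l; rewrite ge_max => /andP[l1 l2].
have l0 : 0 < l by exact: lt_le_trans l1.
have h1 : ln l <= t * l - ln t.
  have := ltW (ln_sublinear (mulr_gt0 t0 l0)); rewrite lnM ?posrE//; lra.
have h2 : b * ln l <= b * (t * l - ln t) by exact: ler_wpM2l.
have h3 : 2 * (a - b * ln t) <= e * l by rewrite -ler_pdivrMl// mulrC.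
have h4 : b * t <= e / 2.
  have -> : e / 2 = (b + 1) * t by rewrite /t; field; rewrite gt_eqF//; lra.
  by rewrite ler_pM2r//; lra.
have h5 : b * t * l <= e / 2 * l by rewrite ler_pM2r.
have -> : e * l = e / 2 * l + e * l / 2 by field.
by move: h2; rewrite mulrBr mulrA; lra.
Qed.

(** Keeps the term of order [k + 1] of the exponential series, one more than the power to be beaten.
    With [l^k] bounding the number of wedges, the remaining [1 / l] makes the union bound tend to
    0. *)
Lemma expRN_pow_le (k : nat) (e l : R) : 0 < e -> 0 < l ->
  l ^+ k * expR (- e * l) <= k.+1`!%:R / e ^+ k.+1 * l^-1.
Proof.
move=> e0 l0; have el0 : 0 < e * l by exact: mulr_gt0.
have f0 : 0 < (k.+1`!%:R : R) by rewrite ltr0n fact_gt0.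
have h := @expR_ge1Dxn R (e * l) k (ltW el0).
rewrite mulNr expRN ler_pdivrMr ?expR_gt0//.
have El0 : 0 < e ^+ k.+1 * l by rewrite mulr_gt0// exprn_gt0.
rewrite -(ler_pM2r El0).
have -> : k.+1`!%:R / e ^+ k.+1 / l * expR (e * l) * (e ^+ k.+1 * l) =
    k.+1`!%:R * expR (e * l).
  by field; rewrite !gt_eqF// exprn_gt0.
have -> : l ^+ k * (e ^+ k.+1 * l) = k.+1`!%:R * ((e * l) ^+ k.+1 / k.+1`!%:R).
  by rewrite [RHS]mulrC divfK ?gt_eqF// exprMn [l ^+ k.+1]exprSr mulrCA.
by rewrite ler_pM2l//; apply: le_trans h; rewrite lerDr.
Qed.

End analysis.

(** The numerator has square [8 (D+1)^2 (D+2)^2]. In the denominator the power has base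
    [2 / (D+2) <= 2/3] and an exponent above 1, and the root is at most 1, so the square gains the
    factor [(3/2)^2]. *)
Lemma Dconst_lower (R : realType) (d : nat) :
  18 * ((d.+2%:R) ^+ 2 * (d.+3%:R) ^+ 2) <= Dconst R d.+1 ^+ 2.
Proof.
rewrite /Dconst; set D : R := d.+1%:R.
have D1 : 1 <= D by rewrite ler1n.
have -> : (d.+2%:R : R) = D + 1 by rewrite natr1.
have -> : (d.+3%:R : R) = D + 2 by rewrite -natrD addn2.
set y := (2 * D + 2) / D.
have y0 : 0 < y by apply: divr_gt0; lra.
set p := _ `^ _; set q := Num.sqrt (1 - _).
have base : 1 - D / (D + 2) = 2 / (D + 2) by field; rewrite gt_eqF//; lra.
have b0 : 0 < 2 / (D + 2) by apply: divr_gt0; lra.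
have b1 : 2 / (D + 2) <= 2 / 3 by rewrite ler_pM2l// lef_pV2 ?posrE; lra.
have p0 : 0 < p by rewrite /p base powR_gt0.
have p1 : p <= 2 / 3.
  apply: le_trans b1; rewrite /p base -[leRHS]powRr1 ?(ltW b0)//.
  apply: ger_powR; first by rewrite b0 ler_pdivrMr; lra.
  by rewrite ler_pdivlMr; lra.
have s1 : 1 <= Num.sqrt (1 + 4 * y ^+ 2).
  by apply: ler_sqrtr => //; rewrite expr1n lerDl mulr_ge0// sqr_ge0.
(* Strict, so that [q] is positive: a zero denominator would make [Dconst] zero by convention. *)
have s2 : Num.sqrt (1 + 4 * y ^+ 2) < 1 + 2 * y ^+ 2.
  have y2 : 0 < y ^+ 2 by rewrite exprn_gt0.
  rewrite -[ltRHS]ger0_norm; last by lra.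
  rewrite -sqrtr_sqr ltr_sqrt; last by rewrite exprn_gt0//; lra.
  have : 0 < (y ^+ 2) ^+ 2 by rewrite exprn_gt0.
  have -> : (1 + 2 * y ^+ 2) ^+ 2 = 1 + 4 * y ^+ 2 + 4 * (y ^+ 2) ^+ 2 by ring.
  lra.
have y2E : D ^+ 2 / (2 * (2 * D + 2) ^+ 2) = (2 * y ^+ 2)^-1.
  by rewrite /y; field; apply/andP; split; rewrite gt_eqF//; lra.
have y20 : 0 < 2 * y ^+ 2 by rewrite mulr_gt0// exprn_gt0.
have q0 : 0 < q.
  by rewrite /q y2E sqrtr_gt0 subr_gt0 mulrC ltr_pdivrMr// mul1r; lra.
have q1 : q <= 1.
  rewrite -[leRHS]sqrtr1 ler_wsqrtr// y2E gerBl mulr_ge0 ?invr_ge0 ?(ltW y20)//; lra.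
have pq : p * q <= 2 / 3.
  by apply: le_trans p1; rewrite ger_pMr.
have pq0 : 0 < p * q by exact: mulr_gt0.
have -> : 18 * ((D + 1) ^+ 2 * (D + 2) ^+ 2) =
    (Num.sqrt 2 * (2 * D + 2) * (D + 2) * (3 / 2)) ^+ 2.
  by rewrite !exprMn sqr_sqrtr//; field.
have A0 : 0 <= Num.sqrt 2 * (2 * D + 2) * (D + 2).
  by rewrite !mulr_ge0 ?sqrtr_ge0//; lra.
have h : 3 / 2 <= (p * q)^-1.
  have -> : 3 / 2 = (2 / 3)^-1 :> R by field.
  by rewrite lef_pV2 ?posrE//; lra.
apply: lerXn2r; rewrite ?nnegrE.
- by rewrite mulr_ge0//; lra.
- by rewrite mulr_ge0// invr_ge0 ltW.
- exact: ler_wpM2l.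
Qed.

(** * Length, expected count, threshold and signal for the wedges of the family *)

Section family_size.
Context (R : realType) (d : nat).
Variables (C1 C2 f0 c : R) (n : nat).
Let D : R := d.+1%:R.
Let l : R := ln n%:R.
Let L := family_length d.+1 C1 n.
Let A := C1 ^+ (d.+1 + 4) * C2 ^+ (d.+1 - 1).
Hypotheses (C1_gt0 : 0 < C1) (C2_gt0 : 0 < C2) (f0_gt0 : 0 < f0) (c_gt0 : 0 < c).
Hypothesis l_gt0 : 0 < l.

Let n0 : 0 < (n%:R : R).
Proof. by rewrite ltNge; apply/negP => h; move: l_gt0; rewrite /l ln0// ltxx. Qed.
Let n1 : 1 < (n%:R : R).
Proof.
by rewrite ltNge; apply/negP => h; move: l_gt0; rewrite ltNge /l ln_le0.
Qed.
Let D1 : 1 <= D. Proof. by rewrite ler1n. Qed.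
Let D0 : 0 < D. Proof. exact: lt_le_trans D1. Qed.
Let A0 : 0 < A. Proof. by rewrite mulr_gt0// exprn_gt0. Qed.

Lemma family_length_gt0 : 0 < L.
Proof.
by rewrite /L /family_length /lseq !mulr_gt0// powR_gt0// divr_gt0.
Qed.
Let L0 := family_length_gt0.

(** The power [D + 4] clears the real exponents: [l^(D-1)] comes from the logarithmic factor of the
    length and [l / n] from [lseq]. *)
Lemma family_length_pow : L ^+ (d.+1 + 4) = C1 ^+ (d.+1 + 4) * l ^+ d.+1 / n%:R.
Proof.
have kD : ((d.+1 + 4)%:R : R) = D + 4 by rewrite natrD.
have l0 := ltW l_gt0.
rewrite /L /family_length /lseq -/l !exprMn -!powR_mulrn ?powR_ge0 ?(ltW C1_gt0)//.
rewrite -!powRrM kD -/D divfK ?gt_eqF//; last by move: D0; lra.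
rewrite mulVf ?gt_eqF//; last by move: D0; lra.
rewrite powRr1 ?divr_ge0 ?(ltW l_gt0)// ?(ltW n0)//.
have -> : D - 1 = d%:R by rewrite /D -natr1 addrK.
by rewrite !powR_mulrn ?(ltW l_gt0) ?(ltW C1_gt0)// exprSr !mulrA.
Qed.

Lemma ln_family_length :
  (D + 4) * ln L = (D + 4) * ln C1 + D * ln l - l.
Proof.
have kD : ((d.+1 + 4)%:R : R) = D + 4 by rewrite natrD.
have h1 : 0 < C1 ^+ (d.+1 + 4) by exact: exprn_gt0.
have h2 : 0 < l ^+ d.+1 by exact: exprn_gt0.
have := congr1 (@ln R) family_length_pow.
rewrite ln_div ?posrE ?mulr_gt0// lnM ?posrE// !lnXn//.
by rewrite -!(mulr_natl (ln _)) kD.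
Qed.

Variable W : wedge R d.+1.
Hypotheses (wfW : wf_wedge W) (WL : wedge_length W = L)
  (Wphi : wedge_angle W = family_angle C2 n).
Let m := expected_count W f0 n.

Let tan_pow : (C2 / l) ^+ d <= (2 * tan (wedge_angle W)) ^+ d.
Proof.
have [_ _ _ _ phi01] := wfW; have := le_tan phi01.
have /andP[phi0 _] := phi01.
rewrite {1}Wphi /family_angle -/l => h.
have Cl0 : 0 < C2 / l by exact: divr_gt0.
apply: lerXn2r; rewrite ?nnegrE ?(ltW Cl0)//.
  by rewrite mulr_ge0// ltW// tan_wedge_angle_gt0.
by move: h; move: (tan _) => t h; move: h; move: Cl0; lra.
Qed.

Lemma wedge_volume_lower : (C2 / l) ^+ d * L ^+ d.+1 / D <= wedge_volume W.
Proof.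
by rewrite /wedge_volume WL ler_pM2r ?invr_gt0// ler_pM2r// exprn_gt0.
Qed.

(** The calibration of the family. In [n L^(D+4) (C2/l)^(D-1)] all powers of [l] but one cancel,
    which makes the signal [m L^2] comparable with [sqrt (m l)]; the powers of [C1] and [C2] gather
    in the quantity [A] of the hypothesis on the constants. *)
Lemma expected_count_lower : f0 * A * l / D <= m * L ^+ 4.
Proof.
have L40 : 0 < L ^+ 4 by exact: exprn_gt0.
apply: (@le_trans _ _ (n%:R * f0 * ((C2 / l) ^+ d * L ^+ d.+1 / D) * L ^+ 4)).
  have -> : n%:R * f0 * ((C2 / l) ^+ d * L ^+ d.+1 / D) * L ^+ 4 =
      n%:R * f0 * ((C2 / l) ^+ d / D) * L ^+ (d.+1 + 4) by rewrite exprD; ring.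
  rewrite family_length_pow /A subn1 /= expr_div_n [l ^+ d.+1]exprSr.
  rewrite le_eqVlt; apply/orP; left; apply/eqP; field.
  by rewrite !gt_eqF// exprn_gt0.
rewrite ler_pM2r// /m /expected_count ler_pM2l ?mulr_gt0//.
exact: wedge_volume_lower.
Qed.

Let m_gt0 : 0 < m.
Proof. by apply: mulr_gt0; [exact: mulr_gt0|exact: wedge_volume_gt0]. Qed.

Lemma expected_count_ge : L <= 1 -> L <= f0 * A / D -> l <= m.
Proof.
move=> L1 LA; have h := expected_count_lower.
have L4 : L ^+ 4 <= f0 * A / D.
  apply: le_trans LA; rewrite exprS ger_pMr// exprn_ile1//; exact: ltW.
have : f0 * A / D * l <= f0 * A / D * m.
  rewrite mulrAC; apply: le_trans h _.
  by rewrite mulrC; apply: ler_wpM2r L4; exact: ltW.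
by rewrite ler_pM2l// divr_gt0// mulr_gt0.
Qed.

(** Here [n / N <= 4 n / m] is at most a constant times [n L^4 / l], whose logarithm is
    [l - 4 l / (D+4) = D l / (D+4)] up to constants and multiples of [ln l]. Replacing the factor 2
    in [Gamma^2] by [9/4] leaves [D l / (4 (D+4)) >= l / 20] for these lower terms: this is the
    origin of [1/40]. *)
Lemma Gamma_le (N : nat) : 1 <= l -> 8 <= m ->
  (1 + ln (4 * D / (f0 * A)) + 4 * ln C1) + 3 * ln l <= 40^-1 * l ->
  m / 4 <= N%:R ->
  @Gamma R (N%:R / (n%:R - 1)) <= 3 / 2 * Num.sqrt (D / (D + 4)) * Num.sqrt l.
Proof.
move=> l1 m8 hB N1; have D4 : 0 < D + 4 by move: D0; lra.
have N0 : 0 < (N%:R : R) by apply: lt_le_trans N1; move: m_gt0; lra.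
have n10 : 0 < (n%:R - 1 : R) by rewrite subr_gt0.
apply: sqrtr_le; first by rewrite !mulr_ge0 ?sqrtr_ge0.
have -> : (3 / 2 * Num.sqrt (D / (D + 4)) * Num.sqrt l) ^+ 2 = 9 / 4 * (D / (D + 4)) * l.
  by rewrite !exprMn !sqr_sqrtr ?(ltW l_gt0)// ?divr_ge0 ?(ltW D0) ?(ltW D4)//; field; rewrite gt_eqF.
have fA0 : 0 < f0 * A by exact: mulr_gt0.
have b0 : 0 < 4 * D / (f0 * A) by rewrite divr_gt0// mulr_gt0.
have L40 : 0 < L ^+ 4 by exact: exprn_gt0.
have bound : expR 1 / (N%:R / (n%:R - 1)) <=
    expR 1 * (4 * D / (f0 * A)) * n%:R * L ^+ 4 / l.
  have -> : expR 1 / (N%:R / (n%:R - 1)) = expR 1 * (n%:R - 1) / N%:R :> R.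
    by rewrite invf_div mulrA.
  apply: (@le_trans _ _ (expR 1 * n%:R / (m / 4))).
    rewrite ler_pM ?mulr_ge0 ?expR_ge0 ?invr_ge0 ?(ltW n10)//.
      by rewrite ler_wpM2l ?expR_ge0// gerBl.
    by rewrite lef_pV2// posrE// divr_gt0.
  have h := expected_count_lower.
  have -> : expR 1 * (4 * D / (f0 * A)) * n%:R * L ^+ 4 / l =
      expR 1 * n%:R * (4 * D * L ^+ 4 / (f0 * A * l)).
    by field; rewrite !gt_eqF.
  rewrite ler_wpM2l ?mulr_ge0 ?expR_ge0//.
  have fAl0 : 0 < f0 * A * l by exact: mulr_gt0.
  rewrite invf_div (ler_pdivlMr _ _ fAl0) [4 / m * _]mulrAC (ler_pdivrMr _ _ m_gt0).
  move: h; rewrite ler_pdivrMr//.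
  move: (f0 * A * l) (L ^+ 4) => u v; move: D m => x y; nra.
move: hB bound b0; move: (4 * D / (f0 * A)) => b hB bound b0.
have eb0 : 0 < expR 1 * b * n%:R by exact: mulr_gt0 (mulr_gt0 (expR_gt0 1) b0) n0.
have bL0 : 0 < expR 1 * b * n%:R * L ^+ 4 by exact: mulr_gt0.
apply: (@le_trans _ _ (2 * (1 + ln b + l + 4 * ln L - ln l))).
  rewrite ler_pM2l//; apply: (@le_trans _ _ (ln (expR 1 * b * n%:R * L ^+ 4 / l))).
    rewrite ler_ln// posrE; last exact: divr_gt0.
    by apply: divr_gt0; [exact: expR_gt0|exact: divr_gt0].
  rewrite ln_div ?posrE// (lnM eb0)// (lnM _ n0) ?posrE ?mulr_gt0 ?expR_gt0//.
  by rewrite (lnM _ b0) ?posrE ?expR_gt0// expRK lnXn// -/l mulr_natl.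
have w0 : 0 <= ln l by exact: ln_ge0.
rewrite -(ler_pM2r D4).
have -> : 9 / 4 * (D / (D + 4)) * l * (D + 4) = 9 / 4 * D * l.
  by field; rewrite gt_eqF.
have := ln_family_length.
move: hB w0 D1 D4 l1.
move: (l) (D) (ln L) (ln l) (ln C1) (ln b) => l' D' z w c1 b1 hB w0 D1' D4' l1 hz.
have -> : 2 * (1 + b1 + l' + 4 * z - w) * (D' + 4) =
   2 * ((D' + 4) * (1 + b1 + l' - w) + 4 * ((D' + 4) * z)) by ring.
rewrite hz.
have h1 : (D' + 4) * (1 + b1 + 4 * c1 + 3 * w) <= (D' + 4) * (40^-1 * l') by rewrite ler_pM2l.
have h2 : 0 <= D' * w by rewrite mulr_ge0//; lra.
have h3 : l' <= D' * l' by rewrite ler_peMl//; lra.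
lra.
Qed.

(** With [Q = (D+1) (D+2)] the signal is [m L^2 D c / (4 f0 Q)]. Its square contains
    [m L^4 >= f0 A l / D], and the hypothesis with [Dconst_lower] reads [A c^2 (D+4) >= 72 Q^2 f0];
    as [72 / 16 = 4.5 >= (53/25)^2], the bound follows. *)
Lemma signal_ge :
  4 * Dconst R d.+1 ^+ 2 / c ^+ 2 * (f0 / (D + 4)) < A ->
  53 / 25 * Num.sqrt (D / (D + 4)) * Num.sqrt (m * l) <=
  n%:R * (D * wedge_volume W * wedge_length W ^+ 2 / (d.+2%:R * d.+3%:R) * (c / 4)).
Proof.
move=> hC; have D4 : 0 < D + 4 by move: D0; lra.
set Q : R := d.+2%:R * d.+3%:R.
have Q0 : 0 < Q by rewrite mulr_gt0// ltr0n.
have L20 : 0 < L ^+ 2 by exact: exprn_gt0.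
have -> : n%:R * (D * wedge_volume W * wedge_length W ^+ 2 / Q * (c / 4)) =
    m * L ^+ 2 * (D * c / (4 * f0 * Q)).
  by rewrite WL /m /expected_count; field; rewrite !gt_eqF.
rewrite -mulrA -sqrtrM ?divr_ge0 ?(ltW D0) ?(ltW D4)//.
rewrite -ler_pdivlMl//; apply: sqrtr_le.
  apply/ltW; apply: mulr_gt0; first by lra.
  by apply: mulr_gt0; [exact: mulr_gt0|rewrite divr_gt0 ?mulr_gt0].
have Dc := @Dconst_lower R d; rewrite -exprMn -/Q in Dc.
have c20 : 0 < c ^+ 2 by exact: exprn_gt0.
have hA : 72 * Q ^+ 2 * f0 <= A * (c ^+ 2 * (D + 4)).
  apply: le_trans (_ : 4 * Dconst R d.+1 ^+ 2 * f0 <= _).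
    by rewrite ler_pM2r//; move: Dc; lra.
  have := ltW hC; rewrite -(ler_pM2r (mulr_gt0 c20 D4)).
  by congr (_ <= _); field; rewrite !gt_eqF.
have h := expected_count_lower.
have -> : ((53 / 25)^-1 * (m * L ^+ 2 * (D * c / (4 * f0 * Q)))) ^+ 2 =
    (25 / 53) ^+ 2 * (m * (m * L ^+ 4) * (D ^+ 2 * c ^+ 2 / (16 * f0 ^+ 2 * Q ^+ 2))).
  by field; rewrite !gt_eqF.
have k0 : 0 < D ^+ 2 * c ^+ 2 / (16 * f0 ^+ 2 * Q ^+ 2).
  by rewrite divr_gt0 ?mulr_gt0 ?exprn_gt0.
apply: (@le_trans _ _ ((25 / 53) ^+ 2 * (m * (f0 * A * l / D) * (D ^+ 2 * c ^+ 2 / (16 * f0 ^+ 2 * Q ^+ 2))))); last first.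
  by rewrite ler_pM2l ?exprn_gt0// ler_pM2r// ler_pM2l.
have -> : (25 / 53) ^+ 2 * (m * (f0 * A * l / D) * (D ^+ 2 * c ^+ 2 / (16 * f0 ^+ 2 * Q ^+ 2))) =
    (25 / 53) ^+ 2 * ((m * l * D / (16 * f0 * Q ^+ 2 * (D + 4))) * (A * (c ^+ 2 * (D + 4)))).
  by field; rewrite !gt_eqF.
apply: (@le_trans _ _ ((25 / 53) ^+ 2 * ((m * l * D / (16 * f0 * Q ^+ 2 * (D + 4))) * (72 * Q ^+ 2 * f0)))); last first.
  rewrite ler_pM2l ?exprn_gt0// ler_pM2l//; apply: divr_gt0.
    exact: mulr_gt0 (mulr_gt0 m_gt0 l_gt0) D0.
  by rewrite !mulr_gt0// exprn_gt0.
have -> : (25 / 53) ^+ 2 * ((m * l * D / (16 * f0 * Q ^+ 2 * (D + 4))) * (72 * Q ^+ 2 * f0)) =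
    (25 / 53) ^+ 2 * (9 / 2) * (D / (D + 4) * (m * l)).
  by field; rewrite !gt_eqF.
rewrite ler_peMl//; first exact: mulr_ge0 (divr_ge0 (ltW D0) (ltW D4)) (mulr_ge0 (ltW m_gt0) (ltW l_gt0)).
by rewrite expr2; lra.
Qed.

End family_size.

(** * Proof of the theorem *)

Lemma union_bound (R : realType) dO (Omega : measurableType dO)
    (P : probability Omega R) (I : finType) (G : I -> set Omega) (b : R) :
  (forall i, measurable (G i)) -> (forall i, (P (~` G i) <= b%:E)%E) ->
  measurable [set omega | forall i, G i omega] /\
  (P (~` [set omega | forall i, G i omega]) <= (#|I|%:R * b)%:E)%E.
Proof.
move=> mG Gb.
have -> : [set omega | forall i, G i omega] = \bigcap_(i in [set: I]) G i.
  by apply/seteqP; split => omega h i //; exact: h.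
have mI : measurable (\bigcap_(i in [set: I]) G i).
  by apply: fin_bigcap_measurable => //; exact: finite_finset.
split => //.
have : (P (\big[setU/set0]_(i : I) ~` G i) <= (\sum_(i : I) b)%:E)%E /\
    measurable (\big[setU/set0]_(i : I) ~` G i).
  apply: (big_ind2 (fun A x => (P A <= x%:E)%E /\ measurable A)).
  - by rewrite measure0; split.
  - move=> A x B y [PA mA] [PB mB]; split; last exact: measurableU.
    by apply: le_trans (measureU2 P mA mB) _; rewrite EFinD; exact: leeD.
  - by move=> i _; split; [exact: Gb|exact: measurableC].
rewrite sumr_const mulr_natl => -[h mU]; apply: le_trans h.
apply: le_measure; rewrite ?inE//; first exact: measurableC.
move=> omega h; apply: contrapT => nU; apply: h => i _; apply: contrapT => nG.
by apply: nU; rewrite (bigD1 i)//=; left.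
Qed.

Section main.
Context (R : realType) (d : nat) dO (Omega : measurableType dO)
  (P : probability Omega R) (f : 'rV[R]_d.+1 -> R) (X : nat -> {RV P >-> 'rV[R]_d.+1}).
Hypotheses (Xind : mutually_independent X) (Xf : forall i, has_density (X i) f).
Variables (alpha : R) (x0 : 'rV[R]_d.+1) (c C1 C2 eps : R).
Hypotheses (alpha01 : 0 < alpha < 1) (f_C2 : twice_continuously_differentiable_near f x0)
  (f_x0 : f x0 != 0) (f_grad : gradient f x0 = 0) (c_gt0 : 0 < c)
  (f_hess : forall e0 : 'rV[R]_d.+1, enorm e0 = 1 ->
       (e0 *m hessian f x0 *m e0^T) ord0 ord0 <= - c)
  (C1_gt0 : 0 < C1) (C2_gt0 : 0 < C2).
Let D : R := d.+1%:R.
Hypothesis C1C2 : 4 * Dconst R d.+1 ^+ 2 / c ^+ 2 * (f x0 / (D + 4))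
            < C1 ^+ (d.+1 + 4) * C2 ^+ (d.+1 - 1).
Variables (M : nat -> nat) (K : forall n, 'I_(M n) -> wedge R d.+1).
Hypothesis K_family : forall n, (1 < n)%N -> family_angle C2 n < pi / 2 ->
  wedge_family C1 C2 eps x0 n (@K n).
Variable kappa : forall n, ('I_(M n) -> nat) -> R.
Hypothesis kappa_crit : forall n, (1 < n)%N -> family_angle C2 n < pi / 2 ->
  critical_value P (sample X n) (density_law f) alpha n (@K n) (@kappa n).

Let f0_gt0 : 0 < f x0.
Proof. by have [_ f0 _] := Xf 0; rewrite lt_neqAle eq_sym f_x0 f0. Qed.
Let D1 : 1 <= D. Proof. by rewrite ler1n. Qed.
Let D0 : 0 < D. Proof. exact: lt_le_trans D1. Qed.

Definition all_reject n : set Omega := [set omega | forall i : 'I_(M n),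
  rejects n (@K n i) (@kappa n (fun k => nobs (@K n k) (sample X n omega)))
    (sample X n omega)].

Lemma measurable_all_reject n : measurable (all_reject n).
Proof.
apply: (@measurable_of_counts _ _ _ _ _ X n (M n) (@K n)) => nu.
exact: measurable_rejects_on.
Qed.

(** The radius is uniform over all directions, while the curvature [q] is minus the Hessian form in
    the direction of the wedge and varies with it; only [c <= q] is common to all wedges. *)
Lemma local_bounds : exists2 rho : R, 0 < rho <= 1 & forall W,
  wf_wedge W -> vertex W = x0 -> wedge_length W <= rho -> tan (wedge_angle W) <= rho ->
  (forall x, wedge_set W x -> `|f x - f x0| <= f x0 / 2) /\
  exists2 q, c <= q & forall x, wedge_set W x ->
    `|f x - f x0 + q / 2 * wproj W x ^+ 2| <= c / (4 * (2 * D + 3)) * wproj W x ^+ 2.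
Proof.
have dl0 : 0 < c / (4 * (2 * D + 3)) by apply: divr_gt0 => //; move: D0; lra.
have [rho1 rho10 Hexp] := wedge_expansion f_C2 f_grad dl0.
have [r r0 Hr] : exists2 r : R, 0 < r & forall y : 'rV[R]_d.+1, (forall i, `|y ord0 i - x0 ord0 i| < r) ->
    `|f y - f x0| <= f x0 / 2.
  apply: (@nbhs_row_coords _ _ x0 (fun y => `|f y - f x0| <= f x0 / 2)).
  have [fcont _] := nbhs_singleton f_C2.
  have h2 : 0 < f x0 / 2 by exact: divr_gt0.
  move/cvgrPdist_le : fcont => /(_ _ h2).
  by apply: filterS => y; rewrite distrC.
exists (Num.min 1 (Num.min rho1 (r / (2 * D)))).
  by rewrite !lt_min ltr01 rho10 divr_gt0 ?mulr_gt0//= ge_min lexx.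
move=> W wfW Wv; rewrite !le_min => /and3P[L1 Lrho Lr] /and3P[T1 Trho _]; split.
  move=> x Kx; apply: Hr => i; have := wedge_coord_le i wfW T1 Kx.
  rewrite Wv !mxE => h; apply: le_lt_trans h _.
  have : D * wedge_length W <= D * (r / (2 * D)) by rewrite ler_pM2l.
  have -> : D * (r / (2 * D)) = r / 2 by field; rewrite gt_eqF.
  by rewrite -/D; lra.
have [We _ _ _ _] := wfW.
exists (- (direction W *m hessian f x0 *m (direction W)^T) ord0 ord0).
  by rewrite lerNr; exact: f_hess.
move=> x Kx; have := Hexp W wfW Wv Lrho Trho x Kx.
by congr (_ <= _); congr (`| _ |); ring.
Qed.

Let A := C1 ^+ (d.+1 + 4) * C2 ^+ (d.+1 - 1).
Let e : R := (20 ^+ 4 * D)^-1.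
(** The factors come from [reject_prob], from the bound on the number of wedges divided by [l^d],
    from the six tails of one wedge, and from [expRN_pow_le]. *)
Let Cst : R := (1 + alpha^-1) * ((4 * D) ^+ d.+1 * D / C2 ^+ d * 6 *
  (d.+1`!%:R / e ^+ d.+1)).

Lemma all_reject_lower : exists l0 : R, forall n, l0 <= ln n%:R ->
  ((1 - Cst * (ln n%:R)^-1)%:E <= P (all_reject n))%E.
Proof.
have A0 : 0 < A by rewrite mulr_gt0// exprn_gt0.
have [rho0 /andP[rho00 rho01] Hloc] := local_bounds.
(* The second bound on the length yields [l <= m]. *)
pose rho := Num.min rho0 (f x0 * A / D).
have rho_gt0 : 0 < rho by rewrite lt_min rho00 divr_gt0// mulr_gt0.
have [tan0 Htan] := tan_le_near0 rho_gt0.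
set dl := atan rho in tan0 Htan.
have [l1 Hl1] := ln_affine ((D + 4) * (ln C1 - ln rho)) (ltW D0) ltr01.
have e40 : 0 < 40^-1 :> R by rewrite invr_gt0.
have [l2 Hl2] := ln_affine (1 + ln (4 * D / (f x0 * A)) + 4 * ln C1)
  (ltW (ltr0Sn R 2)) e40.
(* The bound 8 gives [m >= 8], [l1] gives [L <= rho], [l2] is for [Gamma_le], and [C2 / dl] makes
   the angle smaller than [atan rho], hence below [pi / 2] with tangent at most [rho]. *)
exists (Num.max 8 (Num.max l1 (Num.max l2 (C2 / dl)))) => n.
set l := ln n%:R; rewrite !ge_max => /and4P[l8 ll1 ll2 ldl].
have l_gt0 : 0 < l by lra.
have n0 : 0 < (n%:R : R).
  by rewrite ltNge; apply/negP => h; move: l_gt0; rewrite /l ln0// ltxx.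
have n1 : (1 < n)%N.
  rewrite ltnNge; apply/negP => h; move: l_gt0; rewrite ltNge /l ln_le0//.
  by rewrite (ler_nat R n 1).
have phi0 : 0 < family_angle C2 n < dl.
  rewrite /family_angle -/l; have h := mulr_gt0 tan0 l_gt0.
  rewrite mulr_gt0 ?divr_gt0 ?invr_gt0//= ltr_pdivrMr//.
  by move: ldl; rewrite ler_pdivrMr// [l * _]mulrC; lra.
have [phi1 phi2] := Htan _ phi0; have /andP[phi00 _] := phi0.
have [M0 Kf Ksep _] := K_family n1 phi1.
set L := family_length d.+1 C1 n.
have L0 : 0 < L by exact: family_length_gt0.
have Lrho : L <= rho.
  rewrite -ler_ln// -(ler_pM2l (_ : 0 < D + 4)); last by move: D0; lra.
  rewrite ln_family_length// -/D -/l.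
  have := Hl1 l ll1; lra.
have [Lrho0 LA] : L <= rho0 /\ L <= f x0 * A / D by move: Lrho; rewrite le_min => /andP.
have T0 : tan (family_angle C2 n) <= rho0.
  by apply: le_trans phi2 _; rewrite ge_min lexx.
have KK i : [/\ wf_wedge (@K n i), vertex (@K n i) = x0,
    wedge_length (@K n i) = L & wedge_angle (@K n i) = family_angle C2 n].
  exact: Kf.
set r := Num.sqrt (D / (D + 4)).
have r44 : 44 / 100 <= r.
  apply: ler_sqrtr => //; rewrite ler_pdivlMr; last by move: D0; lra.
  by rewrite expr2; move: D1; lra.
set b := 6 * expR (- e * l).
have Gex i : exists2 G : set Omega, measurable G & (P (~` G) <= b%:E)%E /\
    forall omega, G omega -> let s := sample X n omega in
    [/\ (1 < nobs (@K n i) s)%N,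
      - (Num.sqrt (3 / ((nobs (@K n i) s)%:R - 1)) * TU_stat (density_law f) (@K n i) s)
        - Gamma ((nobs (@K n i) s)%:R / (n%:R - 1)) <= Num.sqrt l / 4 &
      forall k, k <= Num.sqrt l / 4 -> rejects n (@K n i) k s].
  have [wfK Kv KL Kphi] := KK i.
  have hL : wedge_length (@K n i) <= rho0 by rewrite KL.
  have hT : tan (wedge_angle (@K n i)) <= rho0 by rewrite Kphi.
  have [fK [q cq fexp]] := Hloc _ wfK Kv hL hT.
  have lm : l <= expected_count (@K n i) (f x0) n.
    apply: (expected_count_ge C1_gt0 C2_gt0 f0_gt0 l_gt0 wfK KL Kphi) => //.
    exact: le_trans rho01.
  have m8 := le_trans l8 lm.
  have [G mG [GS PG]] := good_event_prob Xind Xf wfK f0_gt0 c_gt0 fK cq fexp l_gt0 lm.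
  exists G => //; split=> // omega /GS good s; split.
  - exact: (good_event_nobs Xf wfK f0_gt0 fK l_gt0 lm good m8).
  - exact: (good_event_max Xf wfK f0_gt0 fK l_gt0 lm good m8).
  - move=> k; apply: (good_event_rejects Xf wfK f0_gt0 fK l_gt0 lm good m8 r44).
      move=> N; apply: (Gamma_le C1_gt0 C2_gt0 f0_gt0 l_gt0 wfK KL Kphi) => //.
        by apply: le_trans l8; rewrite ler1n.
      exact: Hl2.
    by rewrite mulrN opprK; exact: (signal_ge C1_gt0 C2_gt0 f0_gt0 c_gt0 l_gt0 wfK KL Kphi).
have [G mG GP] := fin_all_exists2 Gex.
have [mI PI] := union_bound mG (fun i => (GP i).1).
set G0 := [set omega | forall i, G i omega] in mI PI.
have G1 omega : G0 omega -> forall i, (1 < nobs (@K n i) (sample X n omega))%N.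
  by move=> h i; have [] := (GP i).2 omega (h i).
have G2 omega : G0 omega ->
    (max_stat (density_law f) n (@K n) (sample X n omega) <= (Num.sqrt l / 4)%:E)%E.
  by move=> h; apply/max_stat_le => i _; have [] := (GP i).2 omega (h i).
have G3 omega k : G0 omega -> k <= Num.sqrt l / 4 ->
    forall i, rejects n (@K n i) k (sample X n omega).
  by move=> h kl i; have [_ _] := (GP i).2 omega (h i); apply.
apply: le_trans (reject_prob Xf M0 alpha01 mI (kappa_crit n1 phi1) G1 G2 G3 PI).
rewrite lee_fin card_ord; apply: lerB => //; rewrite /Cst -[leRHS]mulrA; apply: ler_wpM2l.
  by rewrite addr_ge0// invr_ge0; case/andP : alpha01 => /ltW.
have T1 : tan (family_angle C2 n) <= 1 by exact: le_trans rho01.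
have disj (i j : 'I_(M n)) : (j < i)%N -> wedge_set (@K n i) `&` wedge_set (@K n j) = set0.
  by move=> /Ksep[].
have pack := wedge_packing L0 T1 KK disj.
pose i0 := Ordinal M0; have [wfK _ KL Kphi] := KK i0.
have := wedge_volume_lower C1_gt0 C2_gt0 l_gt0 wfK KL Kphi.
rewrite /wedge_volume KL Kphi -/D -/l => vol.
have LD0 : 0 < L ^+ d.+1 by exact: exprn_gt0.
have C2d : 0 < C2 ^+ d by exact: exprn_gt0.
have ld0 : 0 < l ^+ d by exact: exprn_gt0.
(* The volumes of the wedges and of the cube around them both scale as [L^D], so the length cancels
   and only the angle, of order [1 / l], counts. *)
have Mbound : (M n)%:R <= (4 * D) ^+ d.+1 * D / C2 ^+ d * l ^+ d.
  have := le_trans (ler_wpM2l (ler0n R (M n)) vol) pack.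
  rewrite expr_div_n [(4 * D * L) ^+ _]exprMn.
  have -> : (M n)%:R * (C2 ^+ d / l ^+ d * L ^+ d.+1 / D) =
    (M n)%:R * (C2 ^+ d / (l ^+ d * D)) * L ^+ d.+1 :> R.
    by field; rewrite !gt_eqF.
  rewrite ler_pM2r// -ler_pdivlMr ?divr_gt0 ?mulr_gt0//.
  by congr (_ <= _); field; rewrite !gt_eqF.
have e0 : 0 < e by rewrite invr_gt0 mulr_gt0// exprn_gt0.
have := expRN_pow_le d e0 l_gt0.
rewrite /b; set z := expR _ => hz.
have z0 : 0 <= z by exact: expR_ge0.
set B := (4 * D) ^+ d.+1 * D / C2 ^+ d in Mbound *.
have B0 : 0 <= B by rewrite divr_ge0 ?mulr_ge0 ?exprn_ge0 ?mulr_ge0 ?(ltW D0) ?(ltW C2_gt0).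
apply: (@le_trans _ _ (B * 6 * (l ^+ d * z))).
  have -> : B * 6 * (l ^+ d * z) = B * l ^+ d * (6 * z) by ring.
  by rewrite ler_wpM2r// mulr_ge0.
by rewrite -[leRHS]mulrA ler_wpM2l// mulr_ge0.
Qed.

Lemma all_reject_cvg : P (all_reject n) @[n --> \oo] --> 1%E.
Proof.
have [l0 Hl0] := all_reject_lower.
have lny : ln (n%:R : R) @[n --> \oo] --> +oo.
  apply/cvgryPge => a; near=> n.
  have h : expR a <= n%:R by near: n; exact: nbhs_infty_ger.
  by rewrite -[a]expRK ler_ln ?posrE ?expR_gt0// (lt_le_trans (expR_gt0 a)).
have low : (1 - Cst * (ln (n%:R : R))^-1)%:E @[n --> \oo] --> 1%E.
  apply: cvg_EFin; first exact: nearW.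
  rewrite -[X in _ --> X]subr0 -[X in _ - X](mulr0 Cst).
  apply: cvgB; first exact: cvg_cst.
  apply: cvgM; first exact: cvg_cst.
  apply/gtr0_cvgV0 => //; near=> n.
  by rewrite (@lt_le_trans _ _ 1)//; near: n; move/cvgryPge : lny; apply.
apply: (squeeze_cvge _ low (cvg_cst 1%E)).
near=> n; apply/andP; split; last first.
  by apply: probability_le1; exact: measurable_all_reject.
by apply: Hl0; near: n; move/cvgryPge : lny; apply.
Unshelve. all: end_near.
Qed.

End main.

Theorem theorem2p6 (R : realType) (d : nat) (d_gt0 : (0 < d)%N)
    (dO : measure_display) (Omega : measurableType dO) (P : probability Omega R)
    (f : 'rV[R]_d -> R) (X : nat -> {RV P >-> 'rV[R]_d})
    (X_indep : mutually_independent X)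
    (X_density : forall i, has_density (X i) f)
    (alpha : R) (alpha01 : 0 < alpha < 1)
    (x0 : 'rV[R]_d)
    (f_C2 : twice_continuously_differentiable_near f x0)
    (f_x0 : f x0 != 0)
    (f_grad : gradient f x0 = 0)
    (c : R) (c_gt0 : 0 < c)
    (f_hess : forall e0 : 'rV[R]_d, enorm e0 = 1 ->
       (e0 *m hessian f x0 *m e0^T) ord0 ord0 <= - c)
    (C1 C2 eps : R) (C1_gt0 : 0 < C1) (C2_gt0 : 0 < C2) (eps_gt0 : 0 < eps)
    (C1C2 : 4 * Dconst R d ^+ 2 / c ^+ 2 * (f x0 / (d%:R + 4))
            < C1 ^+ (d + 4) * C2 ^+ (d - 1))
    (M : nat -> nat) (K : forall n, 'I_(M n) -> wedge R d)
    (K_family : forall n, (1 < n)%N -> family_angle C2 n < pi / 2 ->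
       wedge_family C1 C2 eps x0 n (K n))
    (kappa : forall n, ('I_(M n) -> nat) -> R)
    (kappa_crit : forall n, (1 < n)%N -> family_angle C2 n < pi / 2 ->
       critical_value P (fun omega => [seq X i omega | i <- iota 0 n])
         (density_law f) alpha n (K n) (kappa n)) :
  P [set omega | forall i : 'I_(M n),
       let sample := [seq X j omega | j <- iota 0 n] in
       rejects n (K n i) (kappa n (fun k => nobs (K n k) sample)) sample]
    @[n --> \oo] --> 1%E.
Proof.
(* In dimension [d.+1] the number [d.+1.-1] of basis vectors of a wedge reduces to [d]. *)
destruct d as [|d]; first by [].
exact: (all_reject_cvg X_indep X_density alpha01 f_C2 f_x0 f_grad c_gt0 f_hess
  C1_gt0 C2_gt0 C1C2 K_family kappa_crit).
Qed.
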